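(* Let the domains and the kernel $\gamma$ be as in the context, with $\gamma$ in Case 1 or Case 2. Let $f\in V_c'(\Omega)$, $\widehat u\in L^2(\Omega)$, and let $\mathcal C$ be the nonempty admissible set of diffusion parameters defined in the context. For $\vartheta\in\mathcal C$ let $u(\vartheta)\in V_c(\Omega\cup\Omega_{\mathcal I})$ denote the unique solution of the weak nonlocal diffusion problem with volume constraint $g=0$. Then there exists at least one solution of the optimal control problem of minimizing $$J(u,\vartheta)=\frac12\int_\Omega (u-\widehat u)^2\,d\mathbf x$$ over $\vartheta\in\mathcal C$ and $u=u(\vartheta)$; that is, there exists $\vartheta^*\in\mathcal C$ such that, with $u^*=u(\vartheta^* )$, $$J(u^*,\vartheta^* )=\inf_{\vartheta\in\mathcal C}J(u(\vartheta),\vartheta).$$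
   Context: Domains and kernel. $\Omega\subset\mathbb R^n$ is a bounded open set and $\varepsilon>0$ is the interaction radius. The interaction domain is $\Omega_{\mathcal I}=\{\mathbf y\in\mathbb R^n\setminus\Omega:\ |\mathbf y-\mathbf x|<\varepsilon\text{ for some }\mathbf x\in\Omega\}$. The sets $\Omega$, $\Omega_{\mathcal I}$, $\Omega\cup\Omega_{\mathcal I}$ are bounded with piecewise smooth boundary and satisfy the interior cone condition. Put $B_r(\mathbf x)=\{\mathbf y\in\Omega\cup\Omega_{\mathcal I}:|\mathbf y-\mathbf x|\le r\}$. The kernel $\gamma(\mathbf x,\mathbf y)=\gamma(\mathbf y,\mathbf x)$ satisfies, for some $\gamma_0>0$ and all $\mathbf x\in\Omega\cup\Omega_{\mathcal I}$: $\gamma\ge0$ for $\mathbf y\in B_\varepsilon(\mathbf x)$; $\gamma\ge\gamma_0$ for $\mathbf y\in B_{\varepsilon/2}(\mathbf x)$; $\gamma=0$ for $\mathbf y\in(\Omega\cup\Omega_{\mathcal I})\setminus B_\varepsilon(\mathbf x)$. In addition one of the following holds. Case 1: there are $s\in(0,1)$ and $\gamma_1,\gamma_2>0$ with $\gamma_1|\mathbf y-\mathbf x|^{-(n+2s)}\le\gamma(\mathbf x,\mathbf y)\le\gamma_2|\mathbf y-\mathbf x|^{-(n+2s)}$ for all $\mathbf x\in\Omega\cup\Omega_{\mathcal I}$, $\mathbf y\in B_\varepsilon(\mathbf x)$. Case 2: there are $\gamma_3,\gamma_4>0$ with $\gamma_3|\mathbf y-\mathbf x|^{-n}\le\gamma(\mathbf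 x,\mathbf y)\le\gamma_4|\mathbf y-\mathbf x|^{-n}$ for all $\mathbf x\in\Omega\cup\Omega_{\mathcal I}$, $\mathbf y\in B_\varepsilon(\mathbf x)$. Nonlocal gradient. $\gamma=\boldsymbol\alpha\cdot\boldsymbol\alpha$ with $\boldsymbol\alpha(\mathbf x,\mathbf y)\in\mathbb R^n$ antisymmetric, and $\mathcal D^*(u)(\mathbf x,\mathbf y)=-(u(\mathbf y)-u(\mathbf x))\boldsymbol\alpha(\mathbf x,\mathbf y)$, so that $\mathcal D^*u\cdot\mathcal D^*v=(u(\mathbf y)-u(\mathbf x))(v(\mathbf y)-v(\mathbf x))\gamma(\mathbf x,\mathbf y)$. Spaces. $|||v|||^2=\int_{\Omega\cup\Omega_{\mathcal I}}\int_{\Omega\cup\Omega_{\mathcal I}}\mathcal D^*v\cdot\mathcal D^*v\,d\mathbf y\,d\mathbf x$; $V(\Omega\cup\Omega_{\mathcal I})=\{v\in L^2(\Omega\cup\Omega_{\mathcal I}):|||v|||<\infty\}$; $V_c(\Omega\cup\Omega_{\mathcal I})=\{v\in V(\Omega\cup\Omega_{\mathcal I}): v=0\text{ on }\Omega_{\mathcal I}\}$, a Hilbert space with norm $|||\cdot|||$. $V_c'(\Omega)$ is the dual of $V_c(\Omega\cup\Omega_{\mathcal I})$ with respect to the $L^2(\Omega)$ duality pairing (written $\int_\Omega fv\,d\mathbf x$), with norm $\|f\|_{V_c'(\Omega)}=\sup_{0\ne v\in V_c}\int_\Omega fv\,d\mathbf x/|||v|||$. In Cases 1 and 2 the nonlocal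 Poincaré inequality $\|v\|_{L^2(\Omega\cup\Omega_{\mathcal I})}\le C_p|||v|||$ holds on $V_c(\Omega\cup\Omega_{\mathcal I})$. Admissible parameters. With fixed constants $0<\vartheta_0\le\vartheta_1<\infty$ and $0<C<\infty$, $\mathcal C$ is the set of all symmetric functions $\vartheta(\mathbf x,\mathbf y)=\vartheta(\mathbf y,\mathbf x)$ in $W^{1,\infty}((\Omega\cup\Omega_{\mathcal I})\times(\Omega\cup\Omega_{\mathcal I}))$ with $\vartheta_0\le\vartheta\le\vartheta_1$ and $\|\vartheta\|_{1,\infty}\le C$ (the $W^{1,\infty}$ norm). State equation. For $\vartheta\in\mathcal C$, $u(\vartheta)$ is the unique $u\in V_c(\Omega\cup\Omega_{\mathcal I})$ with $$\int_{\Omega\cup\Omega_{\mathcal I}}\int_{\Omega\cup\Omega_{\mathcal I}}\vartheta\,\mathcal D^*u\cdot\mathcal D^*v\,d\mathbf y\,d\mathbf x=\int_\Omega fv\,d\mathbf x\qquad\forall v\in V_c(\Omega\cup\Omega_{\mathcal I}).$$ *)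

(* Defs.v *)
From HB Require Import structures.
From mathcomp Require Import all_boot all_order all_algebra.
From mathcomp Require Import all_classical all_reals all_analysis.

Set Implicit Arguments.
Unset Strict Implicit.
Unset Printing Implicit Defensive.

Import Order.TTheory GRing.Theory Num.Theory.
Import numFieldNormedType.Exports.

Local Open Scope classical_set_scope.
Local Open Scope ring_scope.

Definition rV_display : measure_display.
Proof. exact. Qed.

Section measurable_rV.
Context {R : realType} (n : nat).

Definition rV_coord (i : 'I_n) (x : 'rV[R]_n) : measurableTypeR R := x 0 i.

Let rV_set0 : g_sigma_preimage rV_coord set0.
Proof. exact: sigma_algebra0. Qed.

Let rV_setC A : g_sigma_preimage rV_coord A -> g_sigma_preimage rV_coord (~` A).
Proof. exact: sigma_algebraC. Qed.

Let rV_bigcup (F : _^nat) : (forall i, g_sigma_preimage rV_coord (F i)) ->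
  g_sigma_preimage rV_coord (\bigcup_i (F i)).
Proof. exact: sigma_algebra_bigcup. Qed.

(* The sigma-algebra generated by the coordinates, i.e. the Borel one. *)
HB.instance Definition _ := @isMeasurable.Build rV_display
  'rV[R]_n (g_sigma_preimage rV_coord) rV_set0 rV_setC rV_bigcup.

Lemma measurable_rV_coord (i : 'I_n) :
  measurable_fun [set: 'rV[R]_n] (fun x => x 0 i : measurableTypeR R).
Proof.
move=> _ Y mY; rewrite setTI; apply: sub_sigma_algebra => /=.
rewrite -bigcup_seq/=; exists i => /=; first by rewrite mem_index_enum.
by exists Y => //; rewrite setTI.
Qed.

Lemma measurable_fun_rVP d (T : measurableType d) (f : T -> 'rV[R]_n) :
  (forall i, measurable_fun [set: T] (fun t => f t 0 i : measurableTypeR R)) ->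
  measurable_fun [set: T] f.
Proof.
move=> mf _ A mA; rewrite setTI.
suff : <<s \big[setU/set0]_(i < n)
    preimage_set_system setT (rV_coord i) measurable >> `<=`
    [set B | measurable (f @^-1` B)] by apply.
apply: smallest_sub.
  split=> /=; first by rewrite preimage_set0.
  - by move=> B mB; rewrite setTD preimage_setC; exact: measurableC.
  - by move=> F mF; rewrite preimage_bigcup; exact: bigcup_measurable.
elim/big_ind : _ => // [B C sB sC X [|]|i _ _ [Y mY <-]]; [exact: sB|exact: sC|].
by rewrite /= setTI -[X in measurable X]setTI; exact: mf.
Qed.

End measurable_rV.

Section lebesgue_rV.
Context {R : realType}.
Local Open Scope ereal_scope.

Definition rV_cons n (p : measurableTypeR R * 'rV[R]_n) : 'rV[R]_n.+1 :=
  \row_i (if unlift ord0 i is Some j then p.2 0%R j else p.1).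

Definition rV_uncons n (x : 'rV[R]_n.+1) : measurableTypeR R * 'rV[R]_n :=
  (x 0%R ord0, \row_i x 0%R (lift ord0 i)).

Lemma rV_unconsK n : cancel (@rV_uncons n) (@rV_cons n).
Proof.
by move=> x; apply/rowP => i; rewrite mxE; case: unliftP => [j ->|->]//=; rewrite mxE.
Qed.

Lemma rV_consK n : cancel (@rV_cons n) (@rV_uncons n).
Proof.
move=> [a x]; rewrite /rV_uncons mxE unlift_none/=; congr pair.
by apply/rowP => i; rewrite !mxE liftK.
Qed.

Lemma measurable_rV_cons n : measurable_fun setT (@rV_cons n).
Proof.
apply: measurable_fun_rVP => i.
case: (unliftP ord0 i) => [j|] ->.
  rewrite (_ : (fun t => _) = (fun x : 'rV[R]_n => x 0%R j : measurableTypeR R) \o snd).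
    by apply: measurableT_comp; [exact: measurable_rV_coord|exact: measurable_snd].
  by apply/funext => t /=; rewrite mxE liftK.
rewrite (_ : (fun t => _) = fst); first exact: measurable_fst.
by apply/funext => t /=; rewrite mxE unlift_none.
Qed.

Lemma measurable_rV_uncons n : measurable_fun setT (@rV_uncons n).
Proof.
apply/measurable_fun_pairP; split; first exact: measurable_rV_coord.
apply: measurable_fun_rVP => i.
rewrite (_ : (fun t => _) = (fun x : 'rV[R]_n.+1 => x 0%R (lift ord0 i) : measurableTypeR R)).
  exact: measurable_rV_coord.
by apply/funext => t /=; rewrite mxE.
Qed.

Section step.
Variables (n : nat) (m : {sigma_finite_measure set 'rV[R]_n -> \bar R}).

Definition lebesgue_rV_step : set 'rV[R]_n.+1 -> \bar R :=
  pushforward (lebesgue_measure \x m) (@rV_cons n).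

Let step0 : lebesgue_rV_step set0 = 0.
Proof. by rewrite /lebesgue_rV_step /pushforward preimage_set0 measure0. Qed.

Let step_ge0 A : 0 <= lebesgue_rV_step A.
Proof. by rewrite /lebesgue_rV_step /pushforward measure_ge0. Qed.

Let measurable_preimage_cons (A : set 'rV[R]_n.+1) :
  measurable A -> measurable (@rV_cons n @^-1` A).
Proof. by move=> mA; rewrite -[X in measurable X]setTI; exact: measurable_rV_cons. Qed.

Let step_sigma_additive : semi_sigma_additive lebesgue_rV_step.
Proof.
move=> F mF tF mUF; rewrite /lebesgue_rV_step /pushforward preimage_bigcup.
apply: measure_semi_sigma_additive.
- by move=> k; exact: measurable_preimage_cons.
- apply/trivIsetP => /= i j _ _ ij; rewrite -preimage_setI.
  by move/trivIsetP : tF => /(_ _ _ _ _ ij) ->//; rewrite preimage_set0.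
- by rewrite -preimage_bigcup; exact: measurable_preimage_cons.
Qed.

HB.instance Definition _ :=
  isMeasure.Build _ _ _ lebesgue_rV_step step0 step_ge0 step_sigma_additive.

Let step_sigma_finite : sigma_finite setT lebesgue_rV_step.
Proof.
have /sigma_finiteP[F [TF ndF Foo]] := sigma_finiteT (@lebesgue_measure R).
have /sigma_finiteP[G [TG ndG Goo]] := sigma_finiteT m.
exists (fun k => @rV_uncons n @^-1` (F k `*` G k)).
  rewrite -preimage_bigcup -[LHS](preimage_setT (@rV_uncons n)); congr (_ @^-1` _).
  apply/esym/seteqP; split => // -[x y] _.
  have [i _ Fix] : (\bigcup_i F i) x by rewrite -TF.
  have [j _ Gjy] : (\bigcup_i G i) y by rewrite -TG.
  exists (maxn i j) => //; split => /=.
  - by move: Fix; exact/subsetPset/ndF/leq_maxl.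
  - by move: Gjy; exact/subsetPset/ndG/leq_maxr.
move=> k; have [mF Fkoo] := Foo k; have [mG Gkoo] := Goo k; split.
  rewrite -[X in measurable X]setTI; apply: measurable_rV_uncons => //.
  exact: measurableX.
rewrite /lebesgue_rV_step /pushforward -comp_preimage.
rewrite (_ : _ \o _ = id); last by apply/funext => p /=; rewrite rV_consK.
by rewrite preimage_id product_measure1E// lte_mul_pinfty// ge0_fin_numE.
Qed.

HB.instance Definition _ :=
  Measure_isSigmaFinite.Build _ _ _ lebesgue_rV_step step_sigma_finite.
End step.

Fixpoint lebesgue_rV n : {sigma_finite_measure set 'rV[R]_n -> \bar R} :=
  match n with
  | 0 => \d_(0%R : 'rV[R]_0)
  | n'.+1 => lebesgue_rV_step (lebesgue_rV n')
  end.

Lemma lebesgue_rV_box n (a b : 'I_n -> R) : (forall i, a i <= b i)%R ->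
  lebesgue_rV n [set x | forall i, x 0%R i \in `[a i, b i]%R] =
  (\prod_(i < n) (b i - a i)%R)%:E.
Proof.
elim: n a b => [|n IH] a b ab.
  by rewrite big_ord0 /= diracE mem_set//= => -[].
rewrite big_ord_recl EFinM -IH//= /lebesgue_rV_step /pushforward.
rewrite (_ : _ @^-1` _ = `[a ord0, b ord0] `*`
  [set x : 'rV[R]_n | forall i, x 0%R i \in `[a (lift ord0 i), b (lift ord0 i)]%R]).
  rewrite product_measure1E//=.
  - rewrite lebesgue_measure_itv/= lte_fin.
    by case: ltgtP (ab ord0) => // -> _; rewrite subrr.
  - rewrite (_ : mkset _ = \bigcap_(i in [set: 'I_n])
      ((fun x : 'rV[R]_n => x 0%R i : measurableTypeR R) @^-1`
        `[a (lift ord0 i), b (lift ord0 i)])).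
      apply: fin_bigcap_measurable => [|i _]; first exact: finite_finset.
      by rewrite -[X in measurable X]setTI; exact: measurable_rV_coord.
    by apply/seteqP; split => [x /= xab i _|x xab i]; [exact: xab|exact: (xab i)].
apply/seteqP; split => [[t x] /= txab|[t x] [/= tab xab] i].
  split => [|i]; first by have := txab ord0; rewrite mxE unlift_none.
  by have := txab (lift ord0 i); rewrite mxE liftK.
by rewrite mxE; case: unliftP => [j|] ->.
Qed.

End lebesgue_rV.

Section euclidean_space.
Context {R : realType} {n : nat}.
Implicit Types (x y a b : 'rV[R]_n) (A : set 'rV[R]_n).

Definition dotv a b : R := \sum_(i < n) a 0 i * b 0 i.

(* The library norm on ['rV_n] is the sup norm; [enorm] is the Euclidean one.
   They induce the same topology and the same bounded sets. *)
Definition enorm a : R := Num.sqrt (dotv a a).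

Definition C1 (phi : 'rV[R]_n -> R) : Prop :=
  forall v, continuous ('D_v phi) /\ forall x, derivable phi x v.

(* The closure of a relatively open part of a C^1 level set, the level set
   being regular on the whole piece. *)
Definition hypersurface_piece (S : set 'rV[R]_n) : Prop :=
  exists (phi : 'rV[R]_n -> R) (O : set 'rV[R]_n),
    [/\ C1 phi, open O, S = closure ([set x | phi x = 0] `&` O) &
        forall x, S x -> exists v, 'D_v phi x != 0].

Definition piecewise_smooth_boundary A : Prop :=
  exists (m : nat) (S : 'I_m -> set 'rV[R]_n),
    (forall i, hypersurface_piece (S i)) /\
    closure A `\` A^° = \bigcup_(i in [set: 'I_m]) S i.

(* The closed finite cone with vertex [x], axis [xi], height [h] and half-angle
   [arccos c]. *)
Definition cone x xi (c h : R) : set 'rV[R]_n :=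
  [set y | enorm (y - x) <= h /\ c * enorm (y - x) <= dotv (y - x) xi].

Definition interior_cone_condition A : Prop :=
  exists c h : R, [/\ 0 < c < 1, 0 < h &
    forall x, A x -> exists2 xi, enorm xi = 1 & cone x xi c h `<=` A].

Definition regular_domain A : Prop :=
  [/\ bounded_set A, piecewise_smooth_boundary A & interior_cone_condition A].

Definition interaction_domain (Om : set 'rV[R]_n) (eps : R) : set 'rV[R]_n :=
  [set y | ~ Om y /\ exists2 x, Om x & enorm (y - x) < eps].

Definition total_domain (Om : set 'rV[R]_n) (eps : R) : set 'rV[R]_n :=
  Om `|` interaction_domain Om eps.

Definition in_L2 A (v : 'rV[R]_n -> R) : Prop :=
  v \_ A \in Lfun (lebesgue_rV n) 2%:E.

End euclidean_space.

Section W1oo.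
Context {R : realType} {n : nat}.
Local Notation E := ('rV[R]_n * 'rV[R]_n)%type.
Local Notation mu := (lebesgue_rV n \x lebesgue_rV n)%E.
Implicit Types (U : set E) (f g : E -> R).

Definition iter_deriv f (s : seq E) : E -> R := foldr (fun v g => 'D_v g) f s.

Definition smooth f : Prop :=
  forall s : seq E, continuous (iter_deriv f s) /\
    forall z v, derivable (iter_deriv f s) z v.

Definition test_function U f : Prop :=
  smooth f /\ exists K : set E, [/\ compact K, K `<=` U & forall z, ~ K z -> f z = 0].

Definition weak_deriv U (v : E) f g : Prop :=
  forall phi, test_function U phi ->
    (\int[mu]_(z in U) (f z * 'D_v phi z)%:E =
     - \int[mu]_(z in U) (g z * phi z)%:E)%E.

Definition basis_vec (k : 'I_n + 'I_n) : E :=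
  match k with
  | inl i => (delta_mx 0 i, 0)
  | inr i => (0, delta_mx 0 i)
  end.

Definition weak_gradient U f (g : 'I_n + 'I_n -> E -> R) : Prop :=
  forall k, measurable_fun U (g k) /\ weak_deriv U (basis_vec k) f (g k).

Definition Loo_norm U f : \bar R := Lnorm mu +oo (EFin \o (f \_ U)).

(* The largest of the L^oo norms of [f] and of its first-order weak
   derivatives, and +oo if there is no weak gradient. Weak gradients are unique
   up to null sets, so the infimum ranges over at most one finite value. *)
Definition W1oo_norm U f : \bar R :=
  ereal_inf [set t | exists2 g, weak_gradient U f g &
    t = maxe (Loo_norm U f) (\big[maxe/0%E]_(k : 'I_n + 'I_n) Loo_norm U (g k))].

Definition W1oo U f : Prop := measurable_fun U f /\ (W1oo_norm U f < +oo)%E.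

End W1oo.

Section nonlocal_control.
Context {R : realType} {n : nat}.
Local Notation E := 'rV[R]_n.
Local Notation lambda := (lebesgue_rV n).
Variables (Om : set E) (eps : R).
Local Notation OmI := (interaction_domain Om eps).
Local Notation D := (total_domain Om eps).

(* The conditions are imposed off the diagonal only: at [y = x] the kernel
   [alpha . alpha] vanishes by antisymmetry, whereas the bounds of cases 1 and 2
   are singular. *)
Definition kernel_conditions (gamma : E -> E -> R) : Prop :=
  (forall x y, D x -> D y -> gamma x y = gamma y x) /\
  exists2 gamma0 : R, 0 < gamma0 &
    forall x y, D x -> D y -> x != y ->
      [/\ enorm (y - x) <= eps -> 0 <= gamma x y,
          enorm (y - x) <= eps / 2 -> gamma0 <= gamma x y &
          eps < enorm (y - x) -> gamma x y = 0].

Definition kernel_bounds (gamma : E -> E -> R) (p c1 c2 : R) : Prop :=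
  forall x y, D x -> D y -> x != y -> enorm (y - x) <= eps ->
    c1 * enorm (y - x) `^ (- p) <= gamma x y <= c2 * enorm (y - x) `^ (- p).

Definition kernel_case1 (gamma : E -> E -> R) : Prop :=
  exists s gamma1 gamma2 : R, [/\ 0 < s < 1, 0 < gamma1, 0 < gamma2 &
    kernel_bounds gamma (n%:R + 2 * s) gamma1 gamma2].

Definition kernel_case2 (gamma : E -> E -> R) : Prop :=
  exists gamma3 gamma4 : R, [/\ 0 < gamma3, 0 < gamma4 &
    kernel_bounds gamma n%:R gamma3 gamma4].

Definition antisymmetric_field (alpha : E -> E -> E) : Prop :=
  measurable_fun (D `*` D) (fun z : E * E => alpha z.1 z.2) /\
  forall x y, D x -> D y -> alpha y x = - alpha x y.

Variable alpha : E -> E -> E.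

Definition Dstar (u : E -> R) (x y : E) : E := - ((u y - u x) *: alpha x y).

Definition energy (v : E -> R) : \bar R :=
  (\int[lambda]_(x in D) \int[lambda]_(y in D)
     (dotv (Dstar v x y) (Dstar v x y))%:E)%E.

Definition energy_norm (v : E -> R) : R := Num.sqrt (fine (energy v)).

Definition V (v : E -> R) : Prop := in_L2 D v /\ (energy v < +oo)%E.

Definition Vc (v : E -> R) : Prop := V v /\ ae_eq lambda OmI v (cst 0).

Definition Vc_dual_norm (f : (E -> R) -> R) : \bar R :=
  ereal_sup [set (f v / energy_norm v)%:E |
    v in [set v | Vc v /\ ~ ae_eq lambda D v (cst 0)]].

(* An element [f] of the dual of [Vc] is given by its duality pairing
   [v |-> \int_Om f v], a bounded linear functional on [Vc] that does not
   distinguish functions equal almost everywhere. *)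
Definition Vc_dual (f : (E -> R) -> R) : Prop :=
  [/\ forall v w, Vc v -> Vc w -> ae_eq lambda D v w -> f v = f w,
      forall (a : R) v w, Vc v -> Vc w ->
        f (fun x => a * v x + w x) = a * f v + f w &
      (Vc_dual_norm f < +oo)%E].

Definition admissible (th0 th1 C : R) (theta : E -> E -> R) : Prop :=
  [/\ {ae (lambda \x lambda)%E, forall z, (D `*` D) z -> theta z.1 z.2 = theta z.2 z.1},
      {ae (lambda \x lambda)%E, forall z, (D `*` D) z -> th0 <= theta z.1 z.2 <= th1},
      W1oo (D `*` D) (fun z => theta z.1 z.2) &
      (W1oo_norm (D `*` D) (fun z => theta z.1 z.2)%R <= C%:E)%E].

Definition weak_solution (f : (E -> R) -> R) (theta : E -> E -> R) (u : E -> R) : Prop :=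
  Vc u /\ forall v, Vc v ->
    (\int[lambda]_(x in D) \int[lambda]_(y in D)
       (theta x y * dotv (Dstar u x y) (Dstar v x y))%:E = (f v)%:E)%E.

Definition cost (uhat : E -> R) (u : E -> R) (theta : E -> E -> R) : \bar R :=
  ((2^-1)%:E * \int[lambda]_(x in Om) ((u x - uhat x) ^+ 2)%:E)%E.

End nonlocal_control.

(* Main.v *)
(* Write [delta v (x, y) = (v y - v x) |alpha x y|], so that the energy of [v] is the squared
   L^2 norm of [delta v] and the weak form is [<theta * delta u, delta v>]. Both cases give
   [gamma >= c |x - y|^-n] within the horizon. Chaining neighbouring cells of a grid until
   they leave [Om] yields the Poincare inequality, hence completeness of [Vc], and the Riesz
   theorem solves the state equation.

   For a minimising sequence [theta_k], take limits along a free ultrafilter: bounded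
   sequences of L^2 have weak limits, and these preserve symmetry, a.e. bounds and weak
   derivatives, so the weak limit [theta] of [theta_k] is admissible. With
   [w_k = u(theta_k) - u(theta)],
     th0 |||w_k|||^2 <= <(theta - theta_k) delta u(theta), delta w_k>,
   and the right-hand side tends to 0: where the kernel is large [u(theta)] has little
   energy, and where it is bounded [w_k] is uniformly close in L^2 to its average over [J]
   nested dyadic grids (the squared error is O(1/J) times the energy), an operator of finite
   rank, for which weak convergence of [theta_k] is enough. Hence [u(theta_k)] converges
   strongly to [u(theta)] along the ultrafilter, and so does the cost. *)

Require Import Defs.
From HB Require Import structures.
From mathcomp Require Import all_boot all_order all_algebra.
From mathcomp Require Import all_classical all_reals all_analysis.
From mathcomp Require Import measurable_realfun ess_sup_inf ring lra.

Set Implicit Arguments.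
Unset Strict Implicit.
Unset Printing Implicit Defensive.

Import Order.TTheory GRing.Theory Num.Theory.
Import numFieldNormedType.Exports.

Local Open Scope classical_set_scope.
Local Open Scope ring_scope.

(** * Semi-inner products *)

Section semi_inner_product.
Context {R : realType} {V : lmodType R}.
Implicit Types (S : V -> Prop) (B : V -> V -> R).

(** In [<(theta - theta_k) delta u, delta w_k>] both moving factors are a priori only weakly
    convergent, so the limit requires compactness of [w_k] in L^2. The obstacle is the borderline
    kernel [|x - y|^-n]: for means over cells of a single size h, the estimate bounds the squared
    error only by a fixed multiple of the energy, however small h is, because the averaging kernel
    [h^-n] is merely bounded by a multiple of [|x - y|^-n]. The gain has to come from the
    logarithmic divergence at the diagonal, of which each dyadic scale sees its own share. A single
    ultrafilter serves for all limits, so the parameters, their 2n weak derivatives and every test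
    pairing converge together, without a diagonal extraction. Functions are not identified modulo
    null sets. The Hilbert space theory is therefore developed for positive semidefinite forms
    restricted to a predicate, and limits and representatives are unique only up to seminorm
    zero. *)

Definition semi_inner S B : Prop :=
  [/\ forall a u v, S u -> S v -> S (a *: u + v),
      forall u v, S u -> S v -> B u v = B v u,
      forall a u v w, S u -> S v -> S w -> B (a *: u + v) w = a * B u w + B v w &
      forall u, S u -> 0 <= B u u].

Definition snorm B u : R := Num.sqrt (B u u).

Variables (S : V -> Prop) (B : V -> V -> R).
Hypothesis SB : semi_inner S B.

Let Scomb a u v : S u -> S v -> S (a *: u + v).
Proof. by case: SB => + _ _ _; apply. Qed.
Let Bsym u v : S u -> S v -> B u v = B v u.
Proof. by case: SB => _ + _ _; apply. Qed.
Let Bl a u v w : S u -> S v -> S w -> B (a *: u + v) w = a * B u w + B v w.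
Proof. by case: SB => _ _ + _; apply. Qed.
Let Bge0 u : S u -> 0 <= B u u.
Proof. by case: SB => _ _ _; apply. Qed.

Lemma semi_inner0 u : S u -> S 0.
Proof. by move=> Su; have := Scomb (-1) Su Su; rewrite scaleN1r addNr. Qed.

Lemma semi_innerZ a u : S u -> S (a *: u).
Proof. by move=> Su; rewrite -[_ *: _]addr0; apply: Scomb => //; exact: semi_inner0 Su. Qed.

Lemma semi_innerD u v : S u -> S v -> S (u + v).
Proof. by move=> Su Sv; rewrite -[u]scale1r; exact: Scomb. Qed.

Lemma semi_innerB u v : S u -> S v -> S (u - v).
Proof. by move=> Su Sv; rewrite addrC -scaleN1r; exact: Scomb. Qed.

Lemma semi_inner_quad a u v : S u -> S v ->
  B (a *: u + v) (a *: u + v) = a ^+ 2 * B u u + 2 * a * B u v + B v v.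
Proof.
move=> Su Sv; have Suv := Scomb a Su Sv.
rewrite Bl// (Bsym Su)// (Bsym Sv)// !Bl// (Bsym Sv Su); ring.
Qed.

Lemma semi_inner_CS u v : S u -> S v -> B u v ^+ 2 <= B u u * B v v.
Proof.
move=> Su Sv.
have q a : 0 <= a ^+ 2 * B u u + 2 * a * B u v + B v v.
  by rewrite -semi_inner_quad//; apply/Bge0/Scomb.
have := Bge0 Su; rewrite le_eqVlt => /predU1P[u0|u0].
  rewrite -u0 mul0r; have [->|uv0] := eqVneq (B u v) 0; first by rewrite expr0n.
  (* With [B u u = 0] the quadratic is affine in [a]; this [a] would give it the value -1, so its
     slope must vanish. *)
  have := q (- (B v v + 1) / (2 * B u v)).
  rewrite -u0 mulr0 add0r (_ : 2 * _ * _ = - (B v v + 1)); last by field.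
  by move=> ?; exfalso; lra.
(* The minimum of the quadratic in [a]. *)
have := q (- (B u v / B u u)).
rewrite (_ : _ + _ = (B u u * B v v - B u v ^+ 2) / B u u); last by field; rewrite gt_eqF.
by rewrite pmulr_lge0 ?invr_gt0// subr_ge0.
Qed.

Lemma snorm_ge0 u : 0 <= snorm B u. Proof. exact: sqrtr_ge0. Qed.

Lemma sqr_snorm u : S u -> snorm B u ^+ 2 = B u u.
Proof. by move=> Su; rewrite sqr_sqrtr// Bge0. Qed.

Lemma snorm_CS u v : S u -> S v -> `|B u v| <= snorm B u * snorm B v.
Proof.
move=> Su Sv; rewrite -(@ler_pXn2r _ 2)// ?nnegrE ?mulr_ge0 ?snorm_ge0//.
by rewrite exprMn !sqr_snorm// real_normK ?num_real//; exact: semi_inner_CS.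
Qed.

Lemma snormZ a u : S u -> snorm B (a *: u) = `|a| * snorm B u.
Proof.
move=> Su; rewrite /snorm -sqrtr_sqr -sqrtrM ?sqr_ge0//; congr Num.sqrt.
have S0 := semi_inner0 Su.
have := semi_inner_quad a Su S0; rewrite addr0 => ->.
have B0 w : S w -> B 0 w = 0.
  by move=> Sw; have := Bl (-1) Sw Sw Sw; rewrite scaleN1r addNr mulN1r addNr.
by rewrite Bsym// !B0// mulr0 !addr0.
Qed.

Lemma snormD u v : S u -> S v -> snorm B (u + v) <= snorm B u + snorm B v.
Proof.
move=> Su Sv; rewrite -(@ler_pXn2r _ 2)// ?nnegrE ?addr_ge0 ?snorm_ge0//.
rewrite sqr_snorm; last exact: semi_innerD.
have := semi_inner_quad 1 Su Sv; rewrite scale1r => ->.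
have := snorm_CS Su Sv; have := ler_norm (B u v).
rewrite sqrrD !sqr_snorm//; lra.
Qed.

Lemma snormB u v : S u -> S v -> snorm B (u - v) <= snorm B u + snorm B v.
Proof.
move=> Su Sv; apply: (le_trans (snormD Su _)).
  by rewrite -(scaleN1r v); exact: semi_innerZ.
by rewrite -(scaleN1r v) snormZ// normrN normr1 mul1r.
Qed.

Definition semi_complete : Prop :=
  forall x : nat -> V, (forall k, S (x k)) ->
    (forall e, 0 < e -> exists N, forall k l, (N <= k)%N -> (N <= l)%N ->
       snorm B (x k - x l) <= e) ->
    exists2 y, S y & forall e, 0 < e -> exists N, forall k, (N <= k)%N ->
       snorm B (x k - y) <= e.

(* The representative is the minimiser of [B v v - 2 L v]. *)
Lemma riesz_representation (L : V -> R) (M : R) : (exists v, S v) -> semi_complete ->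
  (forall a u v, S u -> S v -> L (a *: u + v) = a * L u + L v) ->
  (forall v, S v -> `|L v| <= M * snorm B v) ->
  exists2 u, S u & forall v, S v -> B u v = L v.
Proof.
move=> [v0 Sv0] cpl Lin Lbd.
pose G v := B v v - 2 * L v.
have Gge v : S v -> - M ^+ 2 <= G v.
  move=> Sv; have := Lbd v Sv; have := ler_norm (L v); have := sqr_snorm Sv.
  rewrite /G => <-; have := sqr_ge0 (snorm B v - M); rewrite sqrrB; lra.
pose I := inf [set G v | v in S].
have hI : has_inf [set G v | v in S].
  split; first by exists (G v0), v0.
  by exists (- M ^+ 2) => _ [v Sv <-]; exact: Gge.
have Ile v : S v -> I <= G v.
  by move=> Sv; apply: ge_inf; [case: hI|exists v].
have /choice[x xP] k : exists v, S v /\ G v <= I + k.+1%:R^-1.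
  have [|_ [v Sv <-] Gv] := @inf_adherent _ _ (k.+1%:R^-1) _ hI; first by [].
  by exists v; split => //; exact: ltW.
have Sx k : S (x k) by case: (xP k).
have Gx k : G (x k) <= I + k.+1%:R^-1 by case: (xP k).
have L0 : L 0 = 0.
  by have := Lin (-1) _ _ Sv0 Sv0; rewrite scaleN1r addNr mulN1r addNr.
have G_quad a u v : S u -> S v ->
    G (a *: v + u) = G u + 2 * a * (B v u - L v) + a ^+ 2 * B v v.
  by move=> Su Sv; rewrite /G semi_inner_quad// Lin//; ring.
clearbody I; clear hI; clearbody G.
(* Parallelogram argument: [G] is at least [I] at the midpoint of [x k] and [x l], while both
   endpoints are almost minimal. *)
have par k l : snorm B (x k - x l) ^+ 2 <= 2 * (k.+1%:R^-1 + l.+1%:R^-1).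
  have Sd := semi_innerB (Sx k) (Sx l).
  rewrite sqr_snorm//.
  have := Ile _ (Scomb (2^-1) Sd (Sx l)); rewrite G_quad//.
  rewrite (_ : (2^-1 : R) ^+ 2 = 4^-1); last by field.
  have Gk : G (x k) = G (x l) + 2 * 1 * (B (x k - x l) (x l) - L (x k - x l)) +
      1 ^+ 2 * B (x k - x l) (x k - x l) by rewrite -G_quad// scale1r subrK.
  have := Gx k; have := Gx l; rewrite Gk expr1n.
  move: (k.+1%:R^-1 : R) (l.+1%:R^-1 : R) => a b.
  move: (B (x k - x l) (x k - x l)) => q.
  move: (B (x k - x l) (x l)) => p.
  move: (L (x k - x l)) => r.
  move: (G (x l)) => g.
  lra.
have [|u Su ucvg] := cpl x Sx.
  move=> e e0; have e20 : 0 < e ^+ 2 by rewrite exprn_gt0.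
  (* Beyond [N] both inverses in [par] are at most [e ^+ 2 / 4], so its right-hand side is at most
     [e ^+ 2]. *)
  pose N := Num.truncn (4 / e ^+ 2); exists N => k l Nk Nl.
  have inv m : (N <= m)%N -> (m.+1%:R^-1 : R) <= e ^+ 2 / 4.
    move=> Nm; rewrite -[e ^+ 2 / 4]invrK invf_div lef_pV2 ?posrE ?divr_gt0//.
    have : 4 / e ^+ 2 < N.+1%:R by exact: truncnS_gt.
    by move/ltW/le_trans; apply; rewrite ler_nat ltnS.
  rewrite -(@ler_pXn2r _ 2)// ?nnegrE ?snorm_ge0//; last exact: ltW.
  move: (inv k Nk) (inv l Nl) (par k l).
  by move: (k.+1%:R^-1 : R) (l.+1%:R^-1 : R) => a b; lra.
- exists u => // v Sv.
  (* [t] ranges over all reals in the next inequality, hence its linear coefficient vanishes *)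
  have key t : 0 <= 2 * t * (B v u - L v) + t ^+ 2 * B v v.
    rewrite leNgt; apply/negP => neg.
    set c := - (2 * t * (B v u - L v) + t ^+ 2 * B v v).
    have c0 : 0 < c by rewrite oppr_gt0.
    (* With [d] absorbing the factor of the linear term, replacing [x k] by its limit costs at most
       [c / 2]; the other [c / 2] pays for [x k] being only almost minimal. *)
    pose d := 2 * `|t| * snorm B v + 1.
    have d0 : 0 < d by rewrite ltr_wpDl// !mulr_ge0// snorm_ge0.
    have [|N1 HN1] := ucvg (c / (2 * d)); first by rewrite divr_gt0// mulr_gt0.
    pose N2 := Num.truncn (2 / c).
    pose k := maxn N1 N2.
    have xu := HN1 k (leq_maxl _ _).
    have kc : (k.+1%:R^-1 : R) < c / 2.
      rewrite -[c / 2]invrK invf_div ltf_pV2 ?posrE ?divr_gt0//.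
      apply: (lt_le_trans (truncnS_gt _)).
      by rewrite ler_nat ltnS leq_maxr.
    have := Ile _ (Scomb t Sv (Sx k)); rewrite G_quad//.
    have Bd : `|B v (x k) - B v u| <= snorm B v * (c / (2 * d)).
      have Sd := semi_innerB (Sx k) Su.
      have -> : B v (x k) - B v u = B v (x k - u).
        rewrite [RHS]Bsym// [x k - u]addrC -scaleN1r Bl// mulN1r addrC.
        by rewrite (Bsym Su)// (Bsym (Sx k)).
      apply: (le_trans (snorm_CS Sv Sd)).
      by rewrite ler_wpM2l ?snorm_ge0.
    move=> G2; have G1 := Gx k.
    have tb : `|2 * t * (B v (x k) - B v u)| <= c / 2.
      rewrite normrM normrM ger0_norm//.
      apply: (@le_trans _ _ (2 * `|t| * (snorm B v * (c / (2 * d))))).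
        by rewrite ler_wpM2l// mulr_ge0.
      rewrite (_ : 2 * `|t| * (snorm B v * (c / (2 * d))) = (d - 1) / d * (c / 2)); last first.
        by rewrite /d; field; apply/lt0r_neq0.
      rewrite ler_piMl ?divr_ge0 ?(ltW c0)// ler_pdivrMr// mul1r; lra.
    move: (ler_norm (2 * t * (B v (x k) - B v u))) G2 G1 tb kc.
    rewrite /c; move: (k.+1%:R^-1 : R) => a; lra.
  rewrite Bsym//; apply/eqP; rewrite -subr_eq0; apply/eqP.
  set p := B v u - L v in key *.
  (* The vertex is [- p / B v v], but [B v v] may be 0; adding 1 keeps the denominator positive and
     the value negative unless [p = 0]. *)
  have := key (- p / (B v v + 1)); have b0 := Bge0 Sv.
  have b1 : 0 < B v v + 1 by rewrite ltr_wpDl.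
  rewrite (_ : _ + _ = - (p ^+ 2 * (B v v + 2) / (B v v + 1) ^+ 2)); last first.
    by field; rewrite gt_eqF.
  rewrite oppr_ge0 pmulr_lle0 ?invr_gt0 ?exprn_gt0// pmulr_lle0 ?ltr_wpDl//.
  by move=> p0; apply/eqP; rewrite -sqrf_eq0 eq_le p0 sqr_ge0.
Qed.

End semi_inner_product.

(** * Square integrable functions *)

(** Both conditions are relative to [A], so values off [A] never matter and no restriction has to be
    carried along. *)
Definition L2 {d} {T : measurableType d} {R : realType}
    (mu : {measure set T -> \bar R}) (A : set T) (f : T -> R) : Prop :=
  measurable_fun A f /\ mu.-integrable A (EFin \o (fun x => f x ^+ 2)).

Definition ip {d} {T : measurableType d} {R : realType}
    (mu : {measure set T -> \bar R}) (A : set T) (f g : T -> R) : R :=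
  \int[mu]_(x in A) (f x * g x).

Section ae_integrals.
Context d (T : measurableType d) (R : realType).
Variables (mu : {measure set T -> \bar R}) (A : set T).
Hypothesis mA : measurable A.
Implicit Types f g : T -> R.

Lemma ae_le_integrable f g : measurable_fun A f ->
  {ae mu, forall x, A x -> `|f x| <= `|g x|} ->
  mu.-integrable A (EFin \o g) -> mu.-integrable A (EFin \o f).
Proof.
move=> mf fg /integrableP[mg goo]; apply/integrableP; split.
  exact/measurable_EFinP.
apply: le_lt_trans goo; apply: ae_ge0_le_integral => //.
- by apply: measurableT_comp => //; exact/measurable_EFinP.
- exact: measurableT_comp.
Qed.

Lemma ae_eq_Rintegral f g : measurable_fun A f -> measurable_fun A g ->
  {ae mu, forall x, A x -> f x = g x} ->
  \int[mu]_(x in A) f x = \int[mu]_(x in A) g x.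
Proof.
move=> mf mg fg; rewrite /Rintegral; congr fine; apply: ae_eq_integral => //.
- exact/measurable_EFinP.
- exact/measurable_EFinP.
- by apply: filterS fg => x fg Ax; rewrite fg.
Qed.

Lemma integrable_measurable f : mu.-integrable A (EFin \o f) -> measurable_fun A f.
Proof. by move=> /measurable_int/measurable_EFinP. Qed.

Lemma ae_le_Rintegral f g :
  mu.-integrable A (EFin \o f) -> mu.-integrable A (EFin \o g) ->
  {ae mu, forall x, A x -> f x <= g x} ->
  \int[mu]_(x in A) f x <= \int[mu]_(x in A) g x.
Proof.
move=> fi gi fg; rewrite -subr_ge0 -RintegralB//.
rewrite (@ae_eq_Rintegral _ (fun x => `|g x - f x|)).
- by apply: Rintegral_ge0.
- by apply: measurable_funB; exact: integrable_measurable.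
- by apply: measurableT_comp => //; apply: measurable_funB; exact: integrable_measurable.
- by apply: filterS fg => x fg Ax; rewrite ger0_norm// subr_ge0 fg.
Qed.

Lemma Rintegral_eq0_ae f : mu.-integrable A (EFin \o f) ->
  (forall x, A x -> 0 <= f x) -> \int[mu]_(x in A) f x <= 0 ->
  {ae mu, forall x, A x -> f x = 0}.
Proof.
move=> fi f0 int0.
have mf := integrable_measurable fi.
have mEf : measurable_fun A (EFin \o f) by exact/measurable_EFinP.
have : (\int[mu]_(x in A) `|(EFin \o f) x| = 0)%E.
  rewrite (eq_integral (EFin \o f)).
    rewrite -[LHS]fineK; last exact: integrable_fin_num.
    congr EFin; apply/eqP; rewrite eq_le [X in X && _]int0/=.
    exact: Rintegral_ge0.
  by move=> x /set_mem Ax /=; rewrite ger0_norm// f0.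
move/(ae_eq_integral_abs _ mA mEf).
by apply: filterS => x fx Ax; have := fx Ax => /= -[].
Qed.

End ae_integrals.

Section L2_theory.
Context d (T : measurableType d) (R : realType).
Variables (mu : {measure set T -> \bar R}) (A : set T).
Hypothesis mA : measurable A.
Implicit Types f g h : T -> R.
Local Notation L2 := (L2 mu A).
Local Notation ip := (ip mu A).

Lemma L2_mul f g : L2 f -> L2 g -> mu.-integrable A (EFin \o (fun x => f x * g x)).
Proof.
move=> [mf fi] [mg gi].
apply: (@le_integrable _ _ _ _ _ mA _ (EFin \o (fun x => f x ^+ 2 + g x ^+ 2))).
- by apply/measurable_EFinP; exact: measurable_funM.
- move=> x _ /=; rewrite lee_fin.
  rewrite [leRHS]ger0_norm ?addr_ge0 ?sqr_ge0// normrM -(real_normK (num_real (f x))).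
  rewrite -(real_normK (num_real (g x))).
  have := sqr_ge0 (`|f x| - `|g x|); have := normr_ge0 (f x); have := normr_ge0 (g x).
  nra.
- by have := integrableD mA fi gi; apply: eq_integrable.
Qed.

Lemma fct_combE a f g x : (a *: f + g) x = a * f x + g x.
Proof. by []. Qed.

Lemma L2_comb a f g : L2 f -> L2 g -> L2 (a *: f + g).
Proof.
move=> Lf Lg; have fg := L2_mul Lf Lg.
case: (Lf) => mf fi; case: (Lg) => mg gi; split.
  by apply: measurable_funD => //; exact: measurable_funM.
have := integrableD mA (integrableD mA (integrableZl mA (a ^+ 2) fi)
  (integrableZl mA (2 * a) fg)) gi.
apply: eq_integrable => // x _ /=.
by rewrite -!EFinM -!EFinD fct_combE; congr EFin; ring.
Qed.

Lemma ipC f g : ip f g = ip g f.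
Proof. by apply: eq_Rintegral => x _; rewrite mulrC. Qed.

Lemma L2_semi_inner : semi_inner L2 ip.
Proof.
split; [exact: L2_comb|by move=> f g _ _; exact: ipC| |].
  move=> a f g h Lf Lg Lh; rewrite /ip -RintegralZl//; last exact: L2_mul.
  rewrite -RintegralD//; [|by have := integrableZl mA a (L2_mul Lf Lh)|exact: L2_mul].
  by apply: eq_Rintegral => x _; rewrite fct_combE; ring.
by move=> f Lf; apply: Rintegral_ge0 => x _; rewrite -expr2 sqr_ge0.
Qed.

Lemma L2_0 : L2 0.
Proof. by split; [exact: measurable_cst|rewrite /= (_ : EFin \o _ = cst 0%E);
  [exact: integrable0|apply/funext => x /=; rewrite expr0n]]. Qed.

Definition L2D f g Lf Lg := @semi_innerD _ _ _ _ L2_semi_inner f g Lf Lg.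
Definition L2B f g Lf Lg := @semi_innerB _ _ _ _ L2_semi_inner f g Lf Lg.
Definition L2Z a f Lf := @semi_innerZ _ _ _ _ L2_semi_inner a f Lf.

Lemma sqr_snorm_ip f : L2 f -> snorm ip f ^+ 2 = ip f f.
Proof. exact: (sqr_snorm L2_semi_inner). Qed.

Lemma ip_sqr f : ip f f = \int[mu]_(x in A) (f x ^+ 2).
Proof. by apply: eq_Rintegral => x _; rewrite expr2. Qed.

Lemma ip_ge0 f : 0 <= ip f f.
Proof. by rewrite ip_sqr; apply: Rintegral_ge0 => x _; rewrite sqr_ge0. Qed.

Lemma L2_bmul M h f : measurable_fun A h -> {ae mu, forall x, A x -> `|h x| <= M} ->
  L2 f -> L2 (h \* f).
Proof.
move=> mh hM [mf fi]; split; first exact: measurable_funM.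
apply: (@ae_le_integrable _ _ _ _ _ mA _ (fun x => M ^+ 2 * f x ^+ 2)).
- by apply: measurable_funX; exact: measurable_funM.
- apply: filterS hM => x hM Ax; rewrite exprMn normrM [leRHS]normrM ler_wpM2r//.
  have := hM Ax => hMx; have M0 := le_trans (normr_ge0 _) hMx.
  by rewrite !normrX ler_pXn2r ?nnegrE// (ger0_norm M0).
- by have := integrableZl mA (M ^+ 2) fi.
Qed.

Lemma snorm_bmul M h f : 0 <= M -> measurable_fun A h ->
  {ae mu, forall x, A x -> `|h x| <= M} -> L2 f -> snorm ip (h \* f) <= M * snorm ip f.
Proof.
move=> M0 mh hM Lf; have Lhf := L2_bmul mh hM Lf.
rewrite -(@ler_pXn2r _ 2)// ?nnegrE ?mulr_ge0 ?snorm_ge0//.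
rewrite exprMn !sqr_snorm_ip// !ip_sqr -RintegralZl//; last by case: Lf.
apply: ae_le_Rintegral => //; first by case: Lhf.
  by case: Lf => _ fi; have := integrableZl mA (M ^+ 2) fi.
apply: filterS hM => x hM Ax /=; rewrite exprMn ler_wpM2r ?sqr_ge0//.
by rewrite -(real_normK (num_real (h x))) ler_pXn2r ?nnegrE// hM.
Qed.

Lemma ip_eq0_ae f : L2 f -> ip f f <= 0 -> {ae mu, forall x, A x -> f x = 0}.
Proof.
move=> [mf fi]; rewrite ip_sqr => /(Rintegral_eq0_ae mA fi) h.
have {h} := h (fun x _ => sqr_ge0 (f x)).
by apply: filterS => x fx Ax; apply/eqP; rewrite -sqrf_eq0 fx.
Qed.

(** Fatou's lemma for the squares. It lets a bound pass to an a.e. limit not yet known to be square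
    integrable, and serves both for functions on the domain and for their increments on the
    product. *)
Lemma L2_fatou (f_ : nat -> T -> R) f c : (forall k, L2 (f_ k)) -> measurable_fun A f ->
  {ae mu, forall x, A x -> f_ ^~ x @ \oo --> f x} ->
  (forall k, ip (f_ k) (f_ k) <= c) -> L2 f /\ ip f f <= c.
Proof.
move=> Lf_ mf f_f f_c.
have mf2 : measurable_fun A (EFin \o (fun x => f x ^+ 2)).
  by apply/measurable_EFinP; exact: measurable_funX.
have mf_2 k : measurable_fun A (EFin \o (fun x => f_ k x ^+ 2)).
  by apply/measurable_EFinP; apply: measurable_funX; case: (Lf_ k).
have le_c : (\int[mu]_(x in A) (f x ^+ 2)%:E <= c%:E)%E.
  have -> : (\int[mu]_(x in A) (f x ^+ 2)%:E =
             \int[mu]_(x in A) limn_einf (fun k => (f_ k x ^+ 2)%:E))%E.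
    apply: ae_eq_integral => //.
      (* Measurability of the lower limit comes from that of the upper limit of the negatives. *)
      rewrite (_ : (fun x => _) =
          \- (fun x => limn_esup (fun k => - (f_ k x ^+ 2)%:E)))%E.
        apply: measurableT_comp => //; apply: measurable_fun_limn_esup => k.
        by apply: measurableT_comp (mf_2 k).
      apply/funext => x; rewrite -limn_einfN; congr limn_einf.
      by apply/funext => k /=; rewrite ?oppeK ?opprK.
    apply: filterS f_f => x f_f Ax; apply/esym.
    suff h : (fun k => (f_ k x ^+ 2)%:E) @ \oo --> (f x ^+ 2)%:E.
      by case: (cvg_limn_einf_sup h).
    apply: cvg_EFin; first exact: nearW.
    by rewrite expr2; under eq_fun do rewrite expr2; apply: cvgM; exact: f_f.
  apply: (le_trans (fatou _ _ mf_2 _)) => //.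
    by move=> k x _; rewrite lee_fin sqr_ge0.
  rewrite limn_einf_lim; apply: lime_le; first exact: is_cvg_einfs.
  apply: nearW => m; apply: ereal_inf_le; eexists; first by exists m => //=.
  have := f_c m; rewrite ip_sqr -lee_fin /Rintegral fineK//.
  by apply: integrable_fin_num => //; case: (Lf_ m).
have Lf : L2 f.
  split => //; apply/integrableP; split => //.
  rewrite (eq_integral (fun x => (f x ^+ 2)%:E)) ?(le_lt_trans le_c) ?ltry//.
  by move=> x _ /=; rewrite ger0_norm ?sqr_ge0.
split => //; rewrite ip_sqr -lee_fin /Rintegral fineK//.
by apply: integrable_fin_num => //; case: Lf.
Qed.

Lemma ip_sum {I : Type} (r : seq I) (c : I -> R) (f : I -> T -> R) g :
  (forall i, L2 (f i)) -> L2 g ->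
  L2 (fun x => \sum_(i <- r) c i * f i x) /\
  ip (fun x => \sum_(i <- r) c i * f i x) g = \sum_(i <- r) c i * ip (f i) g.
Proof.
move=> Lf Lg; elim: r => [|i r [IHL IH]].
  rewrite (_ : (fun x => _) = 0); last by apply/funext => x; rewrite big_nil.
  rewrite big_nil; split; first exact: L2_0.
  rewrite /ip (@eq_Rintegral _ _ _ _ _ (cst 0)) ?Rintegral_cst ?mul0r// => x _.
  by rewrite /= mul0r.
rewrite (_ : (fun x => _) = c i *: f i + fun x => \sum_(j <- r) c j * f j x).
  split; first exact: L2_comb.
  rewrite big_cons -IH; case: L2_semi_inner => _ _ + _; exact.
by apply/funext => x; rewrite big_cons.
Qed.

End L2_theory.

(** Compactness of the segment gives a cluster point, and an ultrafilter converges to its cluster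
    points: it contains the preimage of each neighbourhood or of its complement, and the complement
    cannot meet the neighbourhood. *)
Lemma ultra_bounded_cvg {R : realType} {I : Type} (U : set_system I) (a : I -> R) (M : R) :
  UltraFilter U -> (forall i, `|a i| <= M) -> exists l : R, a @ U --> l.
Proof.
move=> UU aM; have UP : ProperFilter U := ultra_proper.
have [|p [_ pc]] := @segment_compact R (- M) M (a @ U) _.
  apply: (@filterS _ U _ setT); last exact: filterT.
  by move=> i _; rewrite /= in_itv/= -ler_norml.
exists p => B pB; have [//|nB] := in_ultra_setVsetC (a @^-1` B) UU.
have [i [ai Bi]] := pc (~` B) B nB pB.
by case: ai.
Qed.

(** * Completeness of L^2 over a set of finite measure *)

Section L2_complete.
Context d (T : measurableType d) (R : realType).
Variables (mu : {measure set T -> \bar R}) (A : set T).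
Hypothesis mA : measurable A.
Hypothesis Afin : (mu A < +oo)%E.
Implicit Types f g h : T -> R.
Local Notation L2 := (L2 mu A).
Local Notation ip := (ip mu A).

Lemma L2_bounded M f : measurable_fun A f ->
  {ae mu, forall x, A x -> `|f x| <= M} -> L2 f.
Proof.
move=> mf fM; split => //.
apply: (@ae_le_integrable _ _ _ _ _ mA _ (cst (M ^+ 2))).
- exact: measurable_funX.
- apply: filterS fM => x fM Ax; have := fM Ax => {}fM.
  have M0 := le_trans (normr_ge0 _) fM.
  by rewrite /= !normrX ler_pXn2r ?nnegrE// (ger0_norm M0).
- apply/integrableP; split.
    by apply/measurable_EFinP; exact: measurable_cst.
  by under eq_integral do rewrite /=; rewrite integral_cst// lte_mul_pinfty.
Qed.

Lemma L2_cst c : L2 (cst c).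
Proof. by apply: (@L2_bounded `|c|); [exact: measurable_cst|exact: aeW]. Qed.

Lemma L2_integrable f : L2 f -> mu.-integrable A (EFin \o f).
Proof.
move=> Lf; have := L2_mul mA Lf (L2_cst 1).
by apply: eq_integrable => // x _ /=; rewrite mulr1.
Qed.

Lemma L2_norm f : L2 f -> L2 (fun x => `|f x|).
Proof.
move=> [mf fi]; split; first exact: measurableT_comp.
by apply: eq_integrable fi => // x _ /=; rewrite real_normK ?num_real.
Qed.

Lemma L2_indic Q : measurable Q -> L2 \1_Q.
Proof.
move=> mQ; apply: (@L2_bounded 1); first exact: measurable_indic.
by apply: aeW => x _; rewrite indicE; case: (_ \in _); rewrite ?normr1// normr0.
Qed.

(** On a set of finite measure, Cauchy-Schwarz against the constant 1 turns the geometric L^2 bounds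
    into L^1 bounds. The sum of the [|f_ k.+1 - f_ k|] is then integrable, hence finite a.e., and
    the telescoping series converges there. *)
Lemma L2_ae_lim (f_ : nat -> T -> R) : (forall k, L2 (f_ k)) ->
  (forall k, snorm ip (f_ k.+1 - f_ k) <= 1 / (2 ^ (k + 1))%:R) ->
  exists2 f : T -> R, measurable_fun A f & {ae mu, forall x, A x -> f_ ^~ x @ \oo --> f x}.
Proof.
move=> Lf_ f_fast.
pose a k x := `|f_ k.+1 x - f_ k x|.
have a0 k x : 0 <= a k x by exact: normr_ge0.
have Ld k : L2 (f_ k.+1 - f_ k) by apply: L2B.
have La k : L2 (a k) by exact: (L2_norm (Ld k)).
have ma k : measurable_fun A (fun x => (a k x)%:E).
  by apply/measurable_EFinP; case: (La k).
pose c := snorm ip (cst 1).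
have int_a k : (\int[mu]_(x in A) (a k x)%:E <= (c / (2 ^ (k + 1))%:R)%:E)%E.
  have := L2_integrable (La k) => ai.
  rewrite -[leLHS]fineK ?lee_fin; last exact: integrable_fin_num.
  have -> : fine (\int[mu]_(x in A) (a k x)%:E)%E = ip (cst 1) (a k).
    by apply: eq_Rintegral => x _; rewrite mul1r.
  have := snorm_CS (L2_semi_inner mu mA) (L2_cst 1) (La k).
  have -> : snorm ip (a k) = snorm ip (f_ k.+1 - f_ k).
    congr Num.sqrt; rewrite !ip_sqr; apply: eq_Rintegral => x _.
    by rewrite real_normK ?num_real.
  move/(le_trans (ler_norm _))/le_trans; apply.
  rewrite ler_wpM2l ?snorm_ge0//; have := f_fast k; by rewrite div1r.
pose g x := (\sum_(0 <= k <oo) (a k x)%:E)%E.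
have g_int : (\int[mu]_(x in A) g x < +oo)%E.
  rewrite /g integral_nneseries//; last by move=> k x _; rewrite lee_fin.
  apply: (@le_lt_trans _ _ (\sum_(0 <= k <oo) (c / (2 ^ (k + 1))%:R)%:E)%E).
    apply: lee_nneseries => [k _ _|k _]; last exact: int_a.
    by apply: integral_ge0 => x _; rewrite lee_fin.
  rewrite [X in (X < _)%E](cvg_lim _ (@cvg_geometric_eseries_half R c 0))//.
  by rewrite ltry.
have mg : measurable_fun A g.
  by apply: ge0_emeasurable_sum => // k x _ _; rewrite lee_fin.
have gint : mu.-integrable A g.
  apply/integrableP; split => //.
  rewrite (eq_integral g)//; last first.
    by move=> x _; rewrite gee0_abs//; apply: nneseries_ge0 => k _ _; rewrite lee_fin.
have cvg_f x : g x \is a fin_num -> cvgn (f_ ^~ x).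
  move=> gx; have sc : cvgn (series (fun k => f_ k.+1 x - f_ k x)).
    apply: normed_cvg; apply: nondecreasing_is_cvgn.
      apply/nondecreasing_seqP => n.
      by rewrite /= seriesSr lerDl.
    exists (fine (g x)) => _ [n _ <-]; rewrite -lee_fin fineK// /series /=.
    rewrite -sumEFin; apply: nneseries_lim_ge => k _ _.
    by rewrite lee_fin.
  have -> : f_ ^~ x = (fun n => f_ 0 x + series (telescope (f_ ^~ x)) n).
    by apply/funext => n; exact: eq_sum_telescope.
  by apply: is_cvgD => //; exact: is_cvg_cst.
(* The upper limit is measurable without any convergence, and agrees with the limit where there is
   one. *)
pose f x := fine (limn_esup (fun k => (f_ k x)%:E)).
exists f.
  apply: measurableT_comp; first exact: fine_measurable.
  apply: measurable_fun_limn_esup => k; apply/measurable_EFinP.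
  by case: (Lf_ k).
have := integrable_ae mA gint; apply: filterS => x gx Ax.
have /cvg_ex[l lc] := cvg_f _ (gx Ax).
suff -> : f x = l by [].
have : (fun k => (f_ k x)%:E) @ \oo --> l%:E by apply: cvg_EFin => //; exact: nearW.
by rewrite /f => /cvg_limn_einf_sup[_ ->].
Qed.

(** The running maximum of [N]; it is only nondecreasing, which is enough for the Cauchy
    estimates. *)
Lemma fast_subsequence (N : nat -> nat) : exists s : nat -> nat,
  forall k, (N k <= s k)%N /\ (s k <= s k.+1)%N.
Proof.
exists (fun k => \max_(i < k.+1) N i) => k; split.
  exact: (leq_bigmax (ord_max : 'I_k.+1)).
by rewrite [leqRHS]big_ord_recr/= leq_max leqnn.
Qed.

Lemma L2_cauchy_subsequence (f_ : nat -> T -> R) : (forall k, L2 (f_ k)) ->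
  (forall e, 0 < e -> exists N, forall k l, (N <= k)%N -> (N <= l)%N ->
     snorm ip (f_ k - f_ l) <= e) ->
  exists s : nat -> nat, (forall k, k <= s k)%N /\
    exists2 f : T -> R, measurable_fun A f &
      {ae mu, forall x, A x -> (fun k => f_ (s k) x) @ \oo --> f x}.
Proof.
move=> Lf cauchy.
have /choice[N NP] k : exists N, forall i j, (N <= i)%N -> (N <= j)%N ->
    snorm ip (f_ i - f_ j) <= 1 / (2 ^ (k + 1))%:R.
  by apply: cauchy; rewrite divr_gt0// ltr0n expn_gt0.
have [s sP] := fast_subsequence (fun k => maxn k (N k)).
have sN k : (k <= s k)%N /\ (N k <= s k)%N.
  by have [] := sP k; rewrite geq_max => /andP[].
exists s; split; first by move=> k; case: (sN k).
apply: (@L2_ae_lim (fun k => f_ (s k))) => // k.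
apply: NP; last by case: (sN k).
by apply: (leq_trans (sN k).2); case: (sP k).
Qed.

Lemma L2_semi_complete : semi_complete L2 ip.
Proof.
move=> f_ Lf cauchy; have [s [ks [f mf f_f]]] := L2_cauchy_subsequence Lf cauchy.
have key e : 0 < e -> exists N, forall k, (N <= k)%N ->
    L2 (f_ k - f) /\ snorm ip (f_ k - f) <= e.
  move=> e0; have [N NP] := cauchy e e0; exists N => k Nk.
  (* Fatou in [j] with [k] fixed carries the Cauchy bound over to [f_ k - f]; the shift by [N] keeps
     every index [s (j + N)] beyond [N]. *)
  have := @L2_fatou _ _ _ mu A mA (fun j => f_ k - f_ (s (j + N)%N)) (f_ k - f) (e ^+ 2).
  case.
  - by move=> j; exact: L2B.
  - by apply: measurable_funB => //; case: (Lf k).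
  - apply: filterS f_f => x f_f Ax; apply: cvgB; first exact: cvg_cst.
    by have := f_f Ax; rewrite -(cvg_shiftn N).
  - move=> j; rewrite -sqr_snorm_ip//; last exact: L2B.
    rewrite ler_pXn2r ?nnegrE ?snorm_ge0//; last exact: ltW.
    by apply: NP => //; apply: (leq_trans _ (ks _)); rewrite leq_addl.
  move=> Ld; split => //.
  rewrite -(@ler_pXn2r _ 2)// ?nnegrE ?snorm_ge0//; last exact: ltW.
  by rewrite sqr_snorm_ip.
have Lff : L2 f.
  have [N NP] := key 1 ltr01; have [Ld _] := NP N (leqnn _).
  by rewrite -[f](subKr (f_ N)); apply: L2B.
by exists f => // e /key[N NP]; exists N => k /NP[].
Qed.

End L2_complete.

(** * Weak limits along an ultrafilter *)

Section weak_limit.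
Context d (T : measurableType d) (R : realType).
Variables (mu : {measure set T -> \bar R}) (A : set T).
Hypothesis mA : measurable A.
Hypothesis Afin : (mu A < +oo)%E.
Context {I : Type} (U : set_system I).
Implicit Types f g : T -> R.
Local Notation L2 := (L2 mu A).
Local Notation ip := (ip mu A).

Definition weakly_to (h_ : I -> T -> R) (g : T -> R) : Prop :=
  forall phi, L2 phi -> (fun i => ip (h_ i) phi) @ U --> (ip g phi : R).

(** The limit of the pairings along [U] exists for every test function at once; it is linear and
    bounded by [M], and Riesz represents it. *)
Lemma weak_compactness (h_ : I -> T -> R) M : UltraFilter U ->
  (forall i, L2 (h_ i)) -> (forall i, snorm ip (h_ i) <= M) ->
  exists2 g, L2 g & weakly_to h_ g.
Proof.
move=> UU Lh hM; have UP : ProperFilter U := ultra_proper.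
have SI := L2_semi_inner mu mA.
(* The value 0 off [L2] is a dummy that makes the functional total. *)
have lim_ex phi : exists l : R, L2 phi -> (fun i => ip (h_ i) phi) @ U --> l.
  have [Lphi|nL] := pselect (L2 phi); last by exists 0.
  have [i|l hl] := @ultra_bounded_cvg R I U (fun i => ip (h_ i) phi) (M * snorm ip phi) UU.
    apply: (le_trans (snorm_CS SI (Lh i) Lphi)).
    by rewrite ler_wpM2r ?snorm_ge0.
  by exists l.
have [L LP] := choice lim_ex.
have [|||g Lg gP] := @riesz_representation R (T -> R) L2 ip SI L M _
    (L2_semi_complete mA Afin).
- by exists 0; exact: L2_0.
- move=> a u v Lu Lv.
  have Luv := L2_comb mA a Lu Lv.
  have h1 := LP _ Luv.
  have h2 : (fun i => ip (h_ i) (a *: u + v)) @ U --> a * L u + L v.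
    rewrite (_ : (fun i => _) = (fun i => a * ip (h_ i) u + ip (h_ i) v)).
      by apply: cvgD; [apply: cvgMr; exact: LP|exact: LP].
    apply/funext => i; rewrite !(ipC mu A (h_ i)).
    by case: SI => _ _ + _; apply.
  by rewrite -(cvg_lim _ h1)// -(cvg_lim _ h2).
- move=> v Lv; have Lvc := LP v Lv.
  have : (fun i => `|ip (h_ i) v|) @ U --> `|L v| by apply: cvg_norm.
  move/cvg_lim => <-//; apply: limr_le; first by apply/cvg_ex; exists `|L v|; exact: cvg_norm.
  apply: nearW => i; apply: (le_trans (snorm_CS SI (Lh i) Lv)).
  by rewrite ler_wpM2r ?snorm_ge0.
- by exists g => // phi Lphi; rewrite gP//; exact: LP.
Qed.

Hypothesis FU : ProperFilter U.

Lemma weakly_toB (h_ h'_ : I -> T -> R) g (g' : T -> R) : (forall i, L2 (h_ i)) -> (forall i, L2 (h'_ i)) ->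
  L2 g -> L2 g' -> weakly_to h_ g -> weakly_to h'_ g' ->
  weakly_to (fun i => h_ i - h'_ i) (g - g').
Proof.
move=> Lh Lh' Lg Lg' hg hg' phi Lphi.
have ipB u v : L2 u -> L2 v -> ip (u - v) phi = ip u phi - ip v phi.
  move=> Lu Lv; rewrite /ip -RintegralB//; [|exact: L2_mul|exact: L2_mul].
  by apply: eq_Rintegral => x _; rewrite -mulrBl.
rewrite ipB//; under eq_fun do rewrite ipB//.
by apply: cvgB; [exact: hg|exact: hg'].
Qed.

Lemma weakly_to_cst g : weakly_to (fun=> g) g.
Proof. by move=> phi _; exact: cvg_cst. Qed.

(** Testing against the positive part [p] of the limit gives [ip p p = ip g p <= 0]. *)
Lemma weakly_to_le0 (h_ : I -> T -> R) g : (forall i, L2 (h_ i)) -> L2 g -> weakly_to h_ g ->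
  (\forall i \near U, {ae mu, forall x, A x -> h_ i x <= 0}) ->
  {ae mu, forall x, A x -> g x <= 0}.
Proof.
move=> Lh Lg hg h0.
pose p x := Num.max (g x) 0.
have Lp : L2 p.
  have mp : measurable_fun A p.
    by apply: measurable_maxr; [case: Lg|exact: measurable_cst].
  split => //; case: Lg => mg gi.
  apply: (ae_le_integrable mA _ _ gi); first exact: measurable_funX.
  apply: aeW => x Ax; rewrite !ger0_norm ?sqr_ge0//.
  rewrite /p; case: (leP (g x) 0) => // _; rewrite expr0n; exact: sqr_ge0.
have p0 x : 0 <= p x by rewrite /p le_max lexx orbT.
have gp : ip g p <= 0.
  have /cvg_lim <-// := hg p Lp.
  apply: limr_le; first by apply/cvg_ex; exists (ip g p); exact: hg.
  near=> i.
  have hi : {ae mu, forall x, A x -> h_ i x <= 0} by near: i.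
  rewrite -[leRHS](mul0r (fine (mu A))) -(Rintegral_cst mu mA 0).
  apply: ae_le_Rintegral => //.
  - exact: L2_mul.
  - by have := L2_integrable mA Afin (L2_cst mA Afin 0).
  - by apply: filterS hi => x hi Ax; rewrite mulr_le0_ge0// hi.
have : ip p p <= 0.
  apply: le_trans gp; rewrite le_eqVlt; apply/orP; left; apply/eqP.
  apply: eq_Rintegral => x _; rewrite /p; case: (leP (g x) 0) => //.
  by rewrite !mulr0.
move/(ip_eq0_ae mA Lp); apply: filterS => x px Ax.
by have := px Ax; rewrite /p; case: leP => // g0 /eqP; rewrite gt_eqF.
Unshelve. all: by end_near. Qed.

(** The slack [e] is there for bounds that reach [c] only in the limit, as the gradient bounds do.
    Each [c + m.+1%:R^-1] is handled separately, and countably many null sets are discarded. *)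
Lemma weakly_to_ubound (h_ : I -> T -> R) g c : (forall i, L2 (h_ i)) -> L2 g -> weakly_to h_ g ->
  (forall e, 0 < e -> \forall i \near U, {ae mu, forall x, A x -> h_ i x <= c + e}) ->
  {ae mu, forall x, A x -> g x <= c}.
Proof.
move=> Lh Lg hg hc.
have H m : {ae mu, forall x, A x -> g x <= c + m.+1%:R^-1}.
  have Lc := L2_cst mA Afin (c + m.+1%:R^-1).
  have : {ae mu, forall x, A x -> (g - cst (c + m.+1%:R^-1)) x <= 0}.
    apply: (@weakly_to_le0 (fun i => h_ i - cst (c + m.+1%:R^-1))).
    - by move=> i; exact: L2B.
    - exact: L2B.
    - by apply: weakly_toB => //; exact: weakly_to_cst.
    - have := hc (m.+1%:R^-1); rewrite invr_gt0 => /(_ (ltr0Sn _ _)).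
      by apply: filterS => i; apply: filterS => x hx Ax; rewrite subr_le0 hx.
  by apply: filterS => x gx Ax; rewrite -subr_le0 gx.
have /ae_foralln : forall m, {ae mu, forall x, A x -> g x <= c + m.+1%:R^-1} by [].
apply: filterS => x gx Ax; apply/ler_addgt0Pr => e e0.
apply: (le_trans (gx (Num.truncn e^-1) Ax)).
rewrite lerD2l -[leRHS]invrK lef_pV2 ?posrE ?invr_gt0//.
exact/ltW/truncnS_gt.
Qed.

Lemma weakly_to_lbound (h_ : I -> T -> R) g c : (forall i, L2 (h_ i)) -> L2 g -> weakly_to h_ g ->
  (forall e, 0 < e -> \forall i \near U, {ae mu, forall x, A x -> c - e <= h_ i x}) ->
  {ae mu, forall x, A x -> c <= g x}.
Proof.
move=> Lh Lg hg hc; have L0 := L2_0 mu A.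
have : {ae mu, forall x, A x -> (0 - g) x <= - c}.
  apply: (@weakly_to_ubound (fun i => 0 - h_ i)).
  - by move=> i; exact: L2B.
  - exact: L2B.
  - by apply: weakly_toB => //; exact: weakly_to_cst.
  - move=> e /hc; apply: filterS => i; apply: filterS => x hx Ax.
    by have := hx Ax; rewrite (_ : (0 - h_ i) x = 0 - h_ i x)//; lra.
apply: filterS => x gx Ax.
by have := gx Ax; rewrite (_ : (0 - g) x = 0 - g x)//; lra.
Qed.

End weak_limit.

(** * Borel sets and boxes *)

(** The union runs over natural codes, so that stability under countable unions applies directly; a
    code contributes nothing unless it decodes to a [B j] inside [O]. *)
Lemma countable_base_bigcup {T : Type} {J : countType} (B : J -> set T) (O : set T) :
  (forall x, O x -> exists2 j, B j x & B j `<=` O) ->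
  O = \bigcup_k oapp (fun j => [set x | B j `<=` O /\ B j x]) set0 (unpickle k).
Proof.
move=> OB; apply/seteqP; split => [x /OB[j Bjx BjO]|x [k _]].
  by exists (pickle j) => //; rewrite pickleK.
by case: unpickle => //= j [BO Bx]; exact: BO.
Qed.

Section borel_rV.
Context {R : realType} {n : nat}.
Local Notation E := 'rV[R]_n.

(** Sup-norm balls are boxes, hence in the sigma-algebra generated by the coordinates; those with
    rational centre and radius [1 / (m + 1)] form a countable base, so open sets are measurable. *)
Definition rat_box (j : 'rV[rat]_n * nat) : set E :=
  ball (map_mx ratr j.1 : E) (j.2.+1%:R^-1).

Lemma measurable_ball_rV (c : E) (e : R) : 0 < e -> measurable (ball c e).
Proof.
move=> e0; rewrite (_ : ball c e = \bigcap_(i in [set: 'I_n])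
    ((fun x : E => x 0 i : measurableTypeR R) @^-1` ball (c 0 i) e)).
  apply: fin_bigcap_measurable => [|i _]; first exact: finite_finset.
  rewrite -[X in measurable X]setTI; apply: measurable_rV_coord => //.
  exact: measurable_ball.
apply/seteqP; split => [x [_ cx] i _|x cx]; first exact: cx.
by split => // i j; rewrite !ord1; exact: cx.
Qed.

(** All large [m] are allowed so that, on the product, both factors can use the same radius. *)
Lemma rat_box_approx (x : E) (e : R) : 0 < e -> exists k, forall m, (k <= m)%N ->
  exists2 c, rat_box (c, m) x & rat_box (c, m) `<=` ball x e.
Proof.
move=> e0; exists (Num.truncn (2 / e)) => m km.
have m0 : 0 < (m.+1%:R^-1 : R) by rewrite invr_gt0.
have me : m.+1%:R^-1 + m.+1%:R^-1 <= e.
  rewrite -mulr2n -[_ *+ 2]mulr_natr mulrC ler_pdivrMr// mulrC -ler_pdivrMr//.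
  apply/ltW/(lt_le_trans (truncnS_gt _)).
  by rewrite ler_nat ltnS.
have /choice[c cP] (i : 'I_n) : exists q : rat, `|ratr q - x 0 i| < m.+1%:R^-1.
  have /rat_in_itvoo[q] : x 0 i < x 0 i + m.+1%:R^-1 by rewrite ltrDl.
  rewrite in_itv/= => /andP[xq qx]; exists q.
  by rewrite ltr_distl qx andbT (lt_trans _ xq)// ltrBlDr ltrDl.
exists (\row_i c i).
  by split => // i j; rewrite !ord1 !mxE /ball/= cP.
move=> y [_ By]; split => // i j; rewrite !ord1.
have := By ord0 j; rewrite !mxE /ball/= => h1.
have h2 := cP j; rewrite -(subrK (ratr (c j)) (x 0 j)) -addrA.
apply: (le_lt_trans (ler_normD _ _)); rewrite distrC.
by apply: lt_le_trans me; exact: ltrD.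
Qed.

Lemma open_measurable_rV (O : set E) : open O -> measurable O.
Proof.
move=> oO; rewrite (@countable_base_bigcup E ('rV[rat]_n * nat)%type rat_box O).
  apply: bigcupT_measurable => k; case: unpickle => //= j.
  have [jO|jO] := pselect (rat_box j `<=` O).
    rewrite (_ : [set _ | _] = rat_box j); first by apply: measurable_ball_rV; rewrite invr_gt0.
    by apply/seteqP; split => [x []|x].
  by rewrite (_ : [set _ | _] = set0)//; apply/seteqP; split => [x []|x].
move=> x Ox; have /nbhs_ballP[e /= e0 eO] : nbhs x O by exact: open_nbhs_nbhs.
have [k kP] := rat_box_approx x e0.
have [c cx ce] := kP k (leqnn _).
by exists (c, k) => //; exact: subset_trans eO.
Qed.

Lemma open_measurable_rV_prod (O : set (E * E)) : open O -> measurable O.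
Proof.
move=> oO; pose B (j : ('rV[rat]_n * 'rV[rat]_n) * nat) :=
  rat_box (j.1.1, j.2) `*` rat_box (j.1.2, j.2).
rewrite (@countable_base_bigcup (E * E) _ B O).
  apply: bigcupT_measurable => k; case: unpickle => //= j.
  have [jO|jO] := pselect (B j `<=` O).
    rewrite (_ : [set _ | _] = B j).
      by apply: measurableX; apply: measurable_ball_rV; rewrite invr_gt0.
    by apply/seteqP; split => [x []|x].
  by rewrite (_ : [set _ | _] = set0)//; apply/seteqP; split => [x []|x].
move=> x Ox; have /nbhs_ballP[e /= e0 eO] : nbhs x O by exact: open_nbhs_nbhs.
have [k kP] := rat_box_approx x.1 e0; have [l lP] := rat_box_approx x.2 e0.
have [c cx ce] := kP _ (leq_maxl k l); have [c' cx' ce'] := lP _ (leq_maxr k l).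
exists (c, c', maxn k l) => // y [By1 By2]; apply: eO; split.
- exact: ce.
- exact: ce'.
Qed.

Lemma continuous_measurable_rV_prod (f : E * E -> R) : continuous f -> measurable_fun setT f.
Proof.
move=> /continuousP cf; apply: (measurability _ (RGenOpens.measurableE R)).
move=> _ [_ [a [b ->] <-]]; rewrite setTI.
by apply: open_measurable_rV_prod; apply: cf; exact: interval_open.
Qed.

End borel_rV.

Section box_measure.
Context {R : realType}.
Local Open Scope ereal_scope.

Lemma measurable_rV_setX n (A : 'I_n -> set (measurableTypeR R)) :
  (forall i, measurable (A i)) -> measurable [set x : 'rV[R]_n | forall i, A i (x 0%R i)].
Proof.
move=> mA; rewrite (_ : mkset _ = \bigcap_(i in [set: 'I_n])
    ((fun x : 'rV[R]_n => x 0%R i : measurableTypeR R) @^-1` A i)).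
  apply: fin_bigcap_measurable => [|i _]; first exact: finite_finset.
  by rewrite -[X in measurable X]setTI; exact: measurable_rV_coord.
by apply/seteqP; split => [x /= xab i _|x xab i]; [exact: xab|exact: (xab i)].
Qed.

(** Arbitrary measurable sides are needed for the half-open cells of a grid. *)
Lemma lebesgue_rV_setX n (A : 'I_n -> set (measurableTypeR R)) :
  (forall i, measurable (A i)) ->
  lebesgue_rV n [set x | forall i, A i (x 0%R i)] =
  \prod_(i < n) lebesgue_measure (A i).
Proof.
elim: n A => [|n IH] A mA.
  by rewrite big_ord0 /= diracE mem_set//= => -[].
rewrite big_ord_recl -IH//= /lebesgue_rV_step /pushforward.
rewrite (_ : _ @^-1` _ = A ord0 `*`
  [set x : 'rV[R]_n | forall i, A (lift ord0 i) (x 0%R i)]).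
  rewrite product_measure1E//=.
  exact: (@measurable_rV_setX n (fun i => A (lift ord0 i))).
apply/seteqP; split => [[t x] /= txab|[t x] [/= tab xab] i].
  split => [|i]; first by have := txab ord0; rewrite mxE unlift_none.
  by have := txab (lift ord0 i); rewrite mxE liftK.
by rewrite mxE; case: unliftP => [j|] ->.
Qed.

End box_measure.

Section euclidean_norm.
Context {R : realType} {n : nat}.
Implicit Types x y : 'rV[R]_n.

Lemma dotv_ge0 x : 0 <= dotv x x.
Proof. by apply: sumr_ge0 => i _; rewrite -expr2 sqr_ge0. Qed.

Lemma dotvZ (a b : R) x y : dotv (a *: x) (b *: y) = a * b * dotv x y.
Proof. by rewrite /dotv mulr_sumr; apply: eq_bigr => i _; rewrite !mxE; ring. Qed.

Lemma dotvN x y : dotv (- x) (- y) = dotv x y.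
Proof. by apply: eq_bigr => i _; rewrite !mxE; ring. Qed.

Lemma enorm_ge0 x : 0 <= enorm x.
Proof. exact: sqrtr_ge0. Qed.

Lemma enorm_le x (h : R) : 0 <= h -> (forall i, `|x 0 i| <= h) ->
  enorm x <= Num.sqrt n%:R * h.
Proof.
move=> h0 xh; rewrite -(@ler_pXn2r _ 2)// ?nnegrE ?mulr_ge0 ?sqrtr_ge0//.
rewrite exprMn !sqr_sqrtr ?ler0n ?dotv_ge0// /dotv.
apply: (@le_trans _ _ (\sum_(i < n) h ^+ 2)); last first.
  by rewrite sumr_const card_ord mulr_natl.
apply: ler_sum => i _; rewrite -expr2 -(real_normK (num_real (x 0 i))).
by rewrite ler_pXn2r ?nnegrE.
Qed.

Lemma enorm0 : enorm (0 : 'rV[R]_n) = 0.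
Proof. by rewrite /enorm /dotv big1 ?sqrtr0// => i _; rewrite mxE mul0r. Qed.

Lemma enorm_eq0 x : enorm x = 0 -> x = 0.
Proof.
move=> /eqP; rewrite sqrtr_eq0 => x0; apply/rowP => i; rewrite mxE.
have /eqP : dotv x x = 0 by apply/eqP; rewrite eq_le x0 dotv_ge0.
rewrite psumr_eq0; last by move=> j _; rewrite -expr2 sqr_ge0.
by move/allP => /(_ i (mem_index_enum _)); rewrite -expr2 sqrf_eq0 => /eqP.
Qed.

Lemma enorm_gt0 x y : x != y -> 0 < enorm (y - x).
Proof.
move=> xy; rewrite lt_neqAle enorm_ge0 andbT eq_sym; apply: contra xy => /eqP/enorm_eq0.
by move/eqP; rewrite subr_eq0 eq_sym.
Qed.

Lemma continuous_coordB x i : continuous (fun y : 'rV[R]_n => (y - x) 0 i).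
Proof.
rewrite (_ : (fun y => _) = (fun y : 'rV[R]_n => y 0 i) \- cst (x 0 i)); last first.
  by apply/funext => z; rewrite !mxE.
move=> y; apply: continuousB; last exact: cst_continuous.
exact: coord_continuous.
Qed.

Lemma continuous_enormB x : continuous (fun y : 'rV[R]_n => enorm (y - x)).
Proof.
have c : continuous (fun y : 'rV[R]_n => dotv (y - x) (y - x)).
  rewrite /dotv; refine (@continuous_big R _ +%R 0 xpredT (@add_continuous R) _ _
    (fun i (y : 'rV[R]_n) => (y - x) 0 i * (y - x) 0 i) _) => i _ y.
  by apply: continuousM; exact: continuous_coordB.
move=> y; apply: (@continuous_comp _ _ _ (fun y => dotv (y - x) (y - x)) Num.sqrt).
  exact: c.
exact: sqrt_continuous.
Qed.

End euclidean_norm.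

(** * Topology and measure of the domain with its interaction layer *)

Section domain.
Context {R : realType} {n : nat}.
Local Notation E := 'rV[R]_n.
Local Notation lambda := (lebesgue_rV n).
Variables (Om : set E) (eps : R).
Local Notation D := (total_domain Om eps).

Hypothesis eps0 : 0 < eps.

(** This is the open [eps]-neighbourhood of [Om], which makes [D] open and therefore measurable. *)
Lemma total_domainE : D = \bigcup_(x in Om) [set y | enorm (y - x) < eps].
Proof.
apply/seteqP; split => [y [Oy|[_ [x Ox xy]]]|y [x Ox xy]].
- by exists y => //=; rewrite subrr enorm0.
- by exists x.
- by have [Oy|nOy] := pselect (Om y); [left|right; split => //; exists x].
Qed.

Lemma total_domain_near x y : Om x -> enorm (y - x) < eps -> D y.
Proof. by move=> Ox xy; rewrite total_domainE; exists x. Qed.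

Lemma open_total_domain : open D.
Proof.
rewrite total_domainE; apply: bigcup_open => x _.
have := @continuous_enormB R n x => /continuousP/(_ [set r | r < eps]); apply.
exact: open_lt.
Qed.

Lemma measurable_total_domain : measurable D.
Proof. by apply: open_measurable_rV; exact: open_total_domain. Qed.

Lemma bounded_set_rV (A : set E) : bounded_set A ->
  exists2 M : R, 0 < M & forall x i, A x -> `|x 0 i| < M.
Proof.
move=> [M [Mreal MA]]; exists (`|M| + 2); first by rewrite ltr_wpDl.
move=> x i Ax; apply: (@le_lt_trans _ _ (`|M| + 1)); last by rewrite ltrD2l ltr1n.
apply: le_trans (MA (`|M| + 1) _ x Ax); last by rewrite ltr_pwDr// ler_norm.
by rewrite [leRHS]/Num.norm/= mx_normrE; apply: (le_bigmax _ (fun ij => `|x ij.1 ij.2|) (0, i)).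
Qed.

Lemma lebesgue_rV_bounded (A : set E) : measurable A -> bounded_set A -> (lambda A < +oo)%E.
Proof.
move=> mA /bounded_set_rV[M M0 AM].
have mI i : measurable (`[- M, M] : set (measurableTypeR R)) by exact: measurable_itv.
apply: (@le_lt_trans _ _ (lambda [set x | forall i, (`[- M, M]%classic : set R) (x 0 i)])).
  apply: le_measure; rewrite ?inE//; first exact: (@measurable_rV_setX R n (fun=> `[- M, M]%classic)).
  by move=> x Ax i /=; rewrite in_itv/= -ler_norml ltW// AM.
rewrite (@lebesgue_rV_box R n (fun=> - M) (fun=> M)) ?ltry// => i.
by rewrite ge0_cp// ltW.
Qed.

End domain.

(** * Tonelli and Fubini on measurable rectangles *)

Section rectangle.
Context d1 d2 (T1 : measurableType d1) (T2 : measurableType d2) (R : realType).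
Variables (m1 : {sigma_finite_measure set T1 -> \bar R}).
Variables (m2 : {sigma_finite_measure set T2 -> \bar R}).
Variables (A1 : set T1) (A2 : set T2).
Hypotheses (mA1 : measurable A1) (mA2 : measurable A2).
Local Open Scope ereal_scope.

Let restrict_rect (F : T1 * T2 -> \bar R) x y :
  (F \_ (A1 `*` A2)) (x, y) = ((fun x => ((fun y => F (x, y)) \_ A2) y) \_ A1) x.
Proof.
rewrite !patchE; case: ifPn => [/set_mem[/= A1x A2y]|].
  by rewrite !mem_set.
case: ifPn => // /set_mem A1x; case: ifPn => // /set_mem A2y.
by rewrite mem_set.
Qed.

Let restrict_int1 (F : T1 * T2 -> \bar R) :
  \int[m1]_x \int[m2]_y (F \_ (A1 `*` A2)) (x, y) =
  \int[m1]_(x in A1) \int[m2]_(y in A2) F (x, y).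
Proof.
rewrite [RHS]integral_mkcond; apply: eq_integral => x _.
rewrite patchE; case: ifPn => xA1.
  rewrite [RHS]integral_mkcond; apply: eq_integral => y _.
  by rewrite restrict_rect [LHS]patchE xA1.
by rewrite integral0_eq// => y _; rewrite restrict_rect patchE (negbTE xA1).
Qed.

Let restrict_int2 (F : T1 * T2 -> \bar R) :
  \int[m2]_y \int[m1]_x (F \_ (A1 `*` A2)) (x, y) =
  \int[m2]_(y in A2) \int[m1]_(x in A1) F (x, y).
Proof.
rewrite [RHS]integral_mkcond; apply: eq_integral => y _.
rewrite patchE; case: ifPn => yA2.
  rewrite [RHS]integral_mkcond; apply: eq_integral => x _.
  by rewrite restrict_rect !patchE yA2.
rewrite integral0_eq// => x _; rewrite restrict_rect !patchE (negbTE yA2).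
by case: ifP.
Qed.

Lemma tonelli_rect (F : T1 * T2 -> \bar R) : measurable_fun (A1 `*` A2) F ->
  (forall z, (A1 `*` A2) z -> 0 <= F z) ->
  \int[m1 \x m2]_(z in A1 `*` A2) F z = \int[m1]_(x in A1) \int[m2]_(y in A2) F (x, y).
Proof.
move=> mF F0; have mX := measurableX mA1 mA2.
have mFr : measurable_fun setT (F \_ (A1 `*` A2)) by have := (measurable_restrictT F mX).1 mF.
rewrite integral_mkcond fubini_tonelli1//; first exact: restrict_int1.
by move=> z; rewrite patchE; case: ifPn => // /set_mem/F0.
Qed.

Lemma measurable_rect_int (F : T1 * T2 -> \bar R) : measurable_fun (A1 `*` A2) F ->
  (forall z, (A1 `*` A2) z -> 0 <= F z) ->
  measurable_fun A1 (fun x => \int[m2]_(y in A2) F (x, y)).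
Proof.
move=> mF F0; have mX := measurableX mA1 mA2.
have mFr : measurable_fun setT (F \_ (A1 `*` A2)) by have := (measurable_restrictT F mX).1 mF.
have Fr0 z : 0 <= (F \_ (A1 `*` A2)) z by rewrite patchE; case: ifPn => // /set_mem/F0.
have mint : measurable_fun setT (fun x => \int[m2]_y (F \_ (A1 `*` A2)) (x, y)).
  exact: (@measurable_fun_fubini_tonelli_F _ _ _ _ _ m2 (F \_ (A1 `*` A2))).
have := measurable_funTS mint (D := A1).
apply: eq_measurable_fun => x xA1; rewrite [RHS]integral_mkcond; apply: eq_integral => y _.
by rewrite restrict_rect [LHS]patchE xA1.
Qed.

Lemma measurable_rect_section (F : T1 * T2 -> \bar R) x : A1 x ->
  measurable_fun (A1 `*` A2) F -> measurable_fun A2 (fun y => F (x, y)).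
Proof.
move=> A1x mF; have mX := measurableX mA1 mA2.
have mFr : measurable_fun setT (F \_ (A1 `*` A2)) by have := (measurable_restrictT F mX).1 mF.
have := measurable_funTS (measurableT_comp mFr (pair1_measurable x)) (D := A2).
apply: eq_measurable_fun => y yA2 /=.
by rewrite restrict_rect !patchE mem_set// yA2.
Qed.

Lemma fubini_rect1 (F : T1 * T2 -> \bar R) : (m1 \x m2).-integrable (A1 `*` A2) F ->
  \int[m1 \x m2]_(z in A1 `*` A2) F z = \int[m1]_(x in A1) \int[m2]_(y in A2) F (x, y).
Proof.
move=> iF; rewrite integral_mkcond -integral12_prod_meas1; first exact: restrict_int1.
by have := (integrable_mkcond F (measurableX mA1 mA2)).1 iF.
Qed.

Lemma fubini_rect2 (F : T1 * T2 -> \bar R) : (m1 \x m2).-integrable (A1 `*` A2) F ->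
  \int[m1 \x m2]_(z in A1 `*` A2) F z = \int[m2]_(y in A2) \int[m1]_(x in A1) F (x, y).
Proof.
move=> iF; rewrite integral_mkcond -integral21_prod_meas1; first exact: restrict_int2.
by have := (integrable_mkcond F (measurableX mA1 mA2)).1 iF.
Qed.

Lemma measurable_fun_rect_fst d3 (T3 : measurableType d3) (g : T1 -> T3) :
  measurable_fun A1 g -> measurable_fun (A1 `*` A2) (g \o fst).
Proof.
move=> mg; apply: (measurable_comp mA1 _ mg).
  by move=> _ [z [+ _] <-].
exact: measurable_funTS.
Qed.

Lemma measurable_fun_rect_snd d3 (T3 : measurableType d3) (g : T2 -> T3) :
  measurable_fun A2 g -> measurable_fun (A1 `*` A2) (g \o snd).
Proof.
move=> mg; apply: (measurable_comp mA2 _ mg).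
  by move=> _ [z [_ +] <-].
exact: measurable_funTS.
Qed.

Lemma integral_rect_fst (g : T1 -> \bar R) : measurable_fun A1 g ->
  (forall x, A1 x -> 0 <= g x) ->
  \int[m1 \x m2]_(z in A1 `*` A2) g z.1 = m2 A2 * \int[m1]_(x in A1) g x.
Proof.
move=> mg g0; rewrite tonelli_rect//; last 2 first.
- exact: measurable_fun_rect_fst.
- by move=> z [/g0].
rewrite -ge0_integralZl//.
by apply: eq_integral => x /set_mem A1x /=; rewrite integral_cst// muleC.
Qed.

Lemma integral_rect_snd (g : T2 -> \bar R) : measurable_fun A2 g ->
  (forall x, A2 x -> 0 <= g x) ->
  \int[m1 \x m2]_(z in A1 `*` A2) g z.2 = m1 A1 * \int[m2]_(y in A2) g y.
Proof.
move=> mg g0; rewrite tonelli_rect//; last 2 first.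
- exact: measurable_fun_rect_snd.
- by move=> z [_ /g0].
by rewrite (integral_cst m1 mA1 (\int[m2]_(y in A2) g y)) muleC.
Qed.

Lemma ae_rect_fst (P : T1 -> Prop) : {ae m1, forall x, A1 x -> P x} ->
  {ae m1 \x m2, forall z, (A1 `*` A2) z -> P z.1}.
Proof.
move=> [N [mN N0 NP]]; exists (N `*` setT); split.
- exact: measurableX.
- by rewrite product_measure1E// [X in X * _](_ : _ = 0) ?mul0e//; exact: N0.
- move=> [x y] /= nP; split => //; apply: NP => /= xP; apply: nP => -[/= A1x _].
  exact: xP.
Qed.

Lemma ae_rect_snd (P : T2 -> Prop) : {ae m2, forall x, A2 x -> P x} ->
  {ae m1 \x m2, forall z, (A1 `*` A2) z -> P z.2}.
Proof.
move=> [N [mN N0 NP]]; exists (setT `*` N); split.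
- exact: measurableX.
- by rewrite product_measure1E// [X in _ * X](_ : _ = 0) ?mule0//; exact: N0.
- move=> [x y] /= nP; split => //; apply: NP => /= xP; apply: nP => -[/= _ A2y].
  exact: xP.
Qed.

End rectangle.

Lemma in_L2P {R : realType} {n : nat} (A : set 'rV[R]_n) (v : 'rV[R]_n -> R) :
  measurable A -> in_L2 A v <-> L2 (lebesgue_rV n) A v.
Proof.
move=> mA; have sqrE : (fun x => (v \_ A) x ^+ 2) = (fun x => v x ^+ 2) \_ A.
  by apply/funext => x; rewrite !patchE; case: ifP => // _; rewrite expr0n.
have EsqrE : EFin \o (fun x => (v \_ A) x ^+ 2) = (EFin \o (fun x => v x ^+ 2)) \_ A.
  by rewrite sqrE restrict_EFin.
split => [Lv|[mv vi]].
  split.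
    apply/(measurable_restrictT _ mA); move: Lv.
    by rewrite /in_L2 inE => /andP[+ _]; rewrite inE.
  by apply/(integrable_mkcond _ mA); rewrite -EsqrE; exact: Lfun2_integrable_sqr.
rewrite /in_L2 inE/=; apply/andP; split; rewrite inE/=.
  exact/(measurable_restrictT _ mA).
rewrite /finite_norm unlock poweR_lty//.
have := integrable_lty measurableT ((integrable_mkcond _ mA).1 vi).
rewrite -EsqrE; apply: le_lt_trans; rewrite le_eqVlt; apply/orP; left; apply/eqP.
apply: eq_integral => x _ /=; rewrite powR_mulrn ?normr_ge0//.
by rewrite real_normK// num_real.
Qed.

(** * The nonlocal form *)

Section nonlocal_form.
Context {R : realType} {n : nat}.
Local Notation E := 'rV[R]_n.
Local Notation lambda := (lebesgue_rV n).
Local Notation mu2 := (lebesgue_rV n \x lebesgue_rV n)%E.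
Variables (Om : set E) (eps : R) (alpha : E -> E -> E).
Local Notation D := (total_domain Om eps).
Local Notation U := (D `*` D).

Hypotheses (mD : measurable D).
Hypothesis malpha : measurable_fun U (fun z : E * E => alpha z.1 z.2).

Let mU : measurable U. Proof. exact: measurableX. Qed.

Definition gker (z : E * E) : R := dotv (alpha z.1 z.2) (alpha z.1 z.2).

Definition delta (v : E -> R) (z : E * E) : R := (v z.2 - v z.1) * Num.sqrt (gker z).

Lemma gker_ge0 z : 0 <= gker z. Proof. exact: dotv_ge0. Qed.

Lemma deltaM u v z : delta u z * delta v z = (u z.2 - u z.1) * (v z.2 - v z.1) * gker z.
Proof. by rewrite /delta mulrACA -expr2 sqr_sqrtr ?gker_ge0. Qed.

Lemma delta_sqr v z : delta v z ^+ 2 = (v z.2 - v z.1) ^+ 2 * gker z.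
Proof. by rewrite expr2 deltaM expr2. Qed.

Lemma DstarE u v x y : dotv (Dstar alpha u x y) (Dstar alpha v x y) = delta u (x, y) * delta v (x, y).
Proof. by rewrite deltaM /Dstar dotvN dotvZ. Qed.

Lemma delta_comb a u v : delta (a *: u + v) = a *: delta u + delta v.
Proof. by apply/funext => z; rewrite fct_combE /delta !fct_combE; ring. Qed.

Lemma deltaB u v : delta (u - v) = delta u - delta v.
Proof. by have := delta_comb (-1) v u; rewrite !scaleN1r addrC => ->; rewrite addrC. Qed.

Lemma measurable_gker : measurable_fun U gker.
Proof.
rewrite /gker /dotv; apply: measurable_sum => i.
have mi : measurable_fun U (fun z : E * E => alpha z.1 z.2 0 i).
  exact: (measurableT_comp (@measurable_rV_coord R n i) malpha).
exact: measurable_funM.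
Qed.

Lemma measurable_fun_diff (v : E -> R) : measurable_fun D v ->
  measurable_fun U (fun z => v z.2 - v z.1).
Proof.
move=> mv; apply: measurable_funB.
- exact: (measurable_fun_rect_snd mD mv).
- exact: (measurable_fun_rect_fst mD mv).
Qed.

Lemma measurable_delta v : measurable_fun D v -> measurable_fun U (delta v).
Proof.
move=> mv; apply: measurable_funM; first exact: measurable_fun_diff.
have msqrt : measurable_fun setT (@Num.sqrt R).
  by apply: continuous_measurable_fun; exact: sqrt_continuous.
exact: (measurableT_comp msqrt measurable_gker).
Qed.

Lemma energyE v : measurable_fun D v ->
  energy Om eps alpha v = (\int[mu2]_(z in U) (delta v z ^+ 2)%:E)%E.
Proof.
move=> mv; rewrite tonelli_rect//.
- apply: eq_integral => x _; apply: eq_integral => y _.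
  by rewrite DstarE expr2.
- by apply/measurable_EFinP; apply: measurable_funX; exact: measurable_delta.
- by move=> z _; rewrite lee_fin sqr_ge0.
Qed.

Lemma V_P v : V Om eps alpha v <-> L2 lambda D v /\ L2 mu2 U (delta v).
Proof.
split=> [[/(in_L2P _ mD) Lv]|[Lv [mdv dvi]]].
  case: (Lv) => mv _; rewrite energyE// => fin; split => //.
  split; first exact: measurable_delta.
  apply/integrableP; split.
    by apply/measurable_EFinP; apply: measurable_funX; exact: measurable_delta.
  by under eq_integral do rewrite gee0_abs ?lee_fin ?sqr_ge0//.
split; first exact/in_L2P.
by rewrite energyE ?integrable_lty//; case: Lv.
Qed.

Lemma energy_ip v : V Om eps alpha v ->
  energy Om eps alpha v = (ip mu2 U (delta v) (delta v))%:E.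
Proof.
move=> /V_P[[mv _] [_ dvi]]; rewrite energyE// ip_sqr /Rintegral fineK//.
exact: integrable_fin_num.
Qed.

Lemma energy_normE v : V Om eps alpha v ->
  energy_norm Om eps alpha v = snorm (ip mu2 U) (delta v).
Proof. by move=> Vv; rewrite /energy_norm energy_ip. Qed.

Lemma Vc_P v : Vc Om eps alpha v <->
  [/\ L2 lambda D v, L2 mu2 U (delta v) & {ae lambda, forall x, D x -> ~ Om x -> v x = 0}].
Proof.
split=> [[/V_P[Lv Ldv] v0]|[Lv Ldv v0]].
  by split => //; apply: filterS v0 => x v0 [//|Ix] _; exact: v0.
split; first exact/V_P.
apply: filterS v0 => x v0 Ix; apply: v0; first by right.
by case: Ix.
Qed.

Lemma Vc_comb a u v : Vc Om eps alpha u -> Vc Om eps alpha v -> Vc Om eps alpha (a *: u + v).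
Proof.
move=> /Vc_P[Lu Ldu u0] /Vc_P[Lv Ldv v0]; apply/Vc_P; split.
- exact: L2_comb.
- by rewrite delta_comb; exact: L2_comb.
- apply: filterS2 u0 v0 => x u0 v0 Dx nOx.
  by rewrite fct_combE u0// v0// mulr0 addr0.
Qed.

Lemma Vc0 : Vc Om eps alpha 0.
Proof.
apply/Vc_P; split.
- exact: L2_0.
- rewrite (_ : delta 0 = 0); first exact: L2_0.
  by apply/funext => z; rewrite /delta (_ : (0 : E -> R) = cst 0)// subrr mul0r.
- exact: aeW.
Qed.

Definition Bform (th : E * E -> R) (u v : E -> R) : R :=
  ip mu2 U (th \* delta u) (delta v).

(** The integrand may change sign: boundedness of [th] makes it integrable, and Fubini rather than
    Tonelli applies. *)
Lemma BformE (th : E * E -> R) u v M : measurable_fun U th ->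
  {ae mu2, forall z, U z -> `|th z| <= M} ->
  Vc Om eps alpha u -> Vc Om eps alpha v ->
  (\int[lambda]_(x in D) \int[lambda]_(y in D)
     (th (x, y) * dotv (Dstar alpha u x y) (Dstar alpha v x y))%:E)%E = (Bform th u v)%:E.
Proof.
move=> mth thM /Vc_P[_ Ldu _] /Vc_P[_ Ldv _].
have Lthu := L2_bmul mU mth thM Ldu.
have i := L2_mul mU Lthu Ldv.
rewrite /Bform /ip /Rintegral fineK; last exact: integrable_fin_num.
rewrite fubini_rect1//; apply: eq_integral => x _; apply: eq_integral => y _.
by rewrite DstarE mulrA.
Qed.

End nonlocal_form.

(** * Cells and the nonlocal Poincare inequality *)

Section cells.
Context {R : realType} {n : nat}.
Local Notation E := 'rV[R]_n.

(** Half-open, so that distinct cells of a grid are disjoint. *)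
Definition cell (c : 'I_n -> R) (h : R) : set E :=
  [set x | forall i, `[c i, c i + h[%classic (x 0 i)].

Lemma measurable_cell c h : measurable (cell c h).
Proof.
apply: (@measurable_rV_setX R n (fun i => `[c i, c i + h[%classic)) => i.
exact: measurable_itv.
Qed.

Lemma lebesgue_rV_cell c h : 0 < h -> lebesgue_rV n (cell c h) = (h ^+ n)%:E.
Proof.
move=> h0; rewrite (@lebesgue_rV_setX R n (fun i => `[c i, c i + h[%classic)); last first.
  by move=> i; exact: measurable_itv.
rewrite (eq_bigr (fun=> h%:E)) => [|i _].
  by elim: n => [|m IH]; rewrite ?big_ord0// big_ord_recr/= IH exprSr EFinM.
by rewrite lebesgue_measure_itv/= lte_fin ltrDl h0 -EFinB (addrC (c i)) addrK.
Qed.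

Lemma cell_dist c h x y : 0 < h -> cell c h x -> cell c h y ->
  enorm (y - x) <= Num.sqrt n%:R * h.
Proof.
move=> h0 cx cy; apply: enorm_le => [|i]; first exact: ltW.
have := cx i; have := cy i; rewrite /= !in_itv/= !mxE => /andP[? ?] /andP[? ?].
by rewrite ler_norml; apply/andP; split; lra.
Qed.

Lemma cell_dist_next c h x y : 0 < h -> cell c h x -> cell (fun i => c i + h) h y ->
  enorm (y - x) <= Num.sqrt n%:R * (2 * h).
Proof.
move=> h0 cx cy; apply: enorm_le => [|i]; first by rewrite mulr_ge0// ltW.
have := cx i; have := cy i; rewrite /= !in_itv/= !mxE => /andP[? ?] /andP[? ?].
by rewrite ler_norml; apply/andP; split; lra.
Qed.

Lemma cell_cover (M h : R) p : 0 < h -> p%:R * h = 2 * M ->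
  forall x : E, (forall i, `|x 0 i| < M) ->
  exists a : {ffun 'I_n -> 'I_p}, cell (fun i => - M + (a i)%:R * h) h x.
Proof.
move=> h0 ph x xM.
have xM' i : 0 <= (x 0 i + M) / h /\ (x 0 i + M) / h < p%:R.
  have := xM i; rewrite ltr_norml => /andP[x1 x2]; split.
    by rewrite divr_ge0 ?(ltW h0)//; lra.
  by rewrite ltr_pdivrMr// ph; lra.
have tp (i : 'I_n) : (Num.truncn ((x 0 i + M) / h)%R < p)%N.
  have [g0 gp] := xM' i; rewrite -(@ltr_nat R); apply: le_lt_trans gp.
  by have /andP[] := truncn_itv g0.
exists [ffun i => Ordinal (tp i)] => i; rewrite ffunE /= in_itv/=.
have [g0 gp] := xM' i; have /andP[] := truncn_itv g0.
set t := Num.truncn _; rewrite ler_pdivlMr// ltr_pdivrMr//.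
rewrite -[t.+1%:R](natr1 t) mulrDl mul1r => t1 t2.
by apply/andP; split; lra.
Qed.

Lemma cell_inj (M h : R) (p : nat) (a b : {ffun 'I_n -> 'I_p}) (x : E) : 0 < h ->
  cell (fun i => - M + (a i)%:R * h) h x -> cell (fun i => - M + (b i)%:R * h) h x ->
  a = b.
Proof.
move=> h0 ax bx; apply/ffunP => i; apply/val_inj/eqP.
have := ax i; have := bx i; rewrite /= !in_itv/= => /andP[b1 b2] /andP[a1 a2].
have lt (k l : nat) : (k%:R : R) * h < l%:R * h + h -> (k <= l)%N.
  by rewrite -[X in _ + X]mul1r -mulrDl natr1 ltr_pM2r// ltr_nat ltnS.
by rewrite eqn_leq !lt//; lra.
Qed.

End cells.

Section coercive_kernel.
Context {R : realType} {n : nat}.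
Local Notation E := 'rV[R]_n.
Local Notation lambda := (lebesgue_rV n).
Local Notation mu2 := (lebesgue_rV n \x lebesgue_rV n)%E.
Variables (Om : set E) (eps : R) (alpha : E -> E -> E).
Local Notation D := (total_domain Om eps).
Local Notation U := (D `*` D).

Hypotheses (n0 : (0 < n)%N) (eps0 : 0 < eps).
Hypothesis malpha : measurable_fun U (fun z : E * E => alpha z.1 z.2).
Variables (M : R) (c0 : R).
Hypotheses (OmM : forall x i, Om x -> `|x 0 i| < M) (c00 : 0 < c0).
Hypothesis coercive : forall x y, D x -> D y -> x != y -> enorm (y - x) <= eps ->
  c0 <= gker alpha (x, y) * enorm (y - x) ^+ n.

Let mD : measurable D. Proof. exact: measurable_total_domain. Qed.
Let mU : measurable U. Proof. exact: measurableX. Qed.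

Lemma coercive_delta v x y : D x -> D y -> enorm (y - x) <= eps ->
  c0 * (v y - v x) ^+ 2 <= enorm (y - x) ^+ n * delta alpha v (x, y) ^+ 2.
Proof.
move=> Dx Dy xy; have [->|nxy] := eqVneq x y.
  by rewrite subrr expr0n mulr0 mulr_ge0 ?sqr_ge0 ?exprn_ge0 ?enorm_ge0.
rewrite delta_sqr/= [leRHS]mulrCA [leLHS]mulrC ler_wpM2l ?sqr_ge0// [leRHS]mulrC.
exact: coercive.
Qed.

(** The cell and its diagonal neighbour stay within distance [sqrt n * 2h < eps] of the point of
    [Om]. *)
Lemma cell_sub_domain c h : 0 < h -> Num.sqrt n%:R * (2 * h) < eps ->
  cell c h `&` Om !=set0 -> cell c h `<=` D /\ cell (fun i => c i + h) h `<=` D.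
Proof.
move=> h0 he [x [cx Ox]]; split => y cy.
  apply: (total_domain_near eps0 Ox); apply: le_lt_trans he.
  apply: (le_trans (cell_dist h0 cx cy)).
  by rewrite ler_wpM2l ?sqrtr_ge0//; lra.
by apply: (total_domain_near eps0 Ox); apply: le_lt_trans he; exact: cell_dist_next h0 cx cy.
Qed.

Section poincare.
Variables (v : E -> R) (h : R).
Hypotheses (Vv : Vc Om eps alpha v) (h0 : 0 < h) (he : Num.sqrt n%:R * (2 * h) < eps).
Local Notation A Q := (\int[lambda]_(x in Q) (v x ^+ 2)%:E)%E.
Let En : \bar R := (\int[mu2]_(z in U) (delta alpha v z ^+ 2)%:E)%E.
Let K : R := 2 * (eps ^+ n / c0) / h ^+ n.

Let mv : measurable_fun D v.
Proof. by case/(Vc_P mD malpha): Vv => -[]. Qed.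

Let mv2 Q : measurable Q -> Q `<=` D -> measurable_fun Q (fun x => (v x ^+ 2)%:E).
Proof.
move=> mQ QD; apply/measurable_EFinP; apply: measurable_funX.
exact: measurable_funS mv.
Qed.

Let En0 : (0 <= En)%E.
Proof. by apply: integral_ge0 => z _; rewrite lee_fin sqr_ge0. Qed.

Let K0 : 0 <= K.
Proof. by rewrite /K !mulr_ge0 ?invr_ge0 ?exprn_ge0// ltW. Qed.

(** Integrate [v x ^+ 2 <= 2 * (v y - v x) ^+ 2 + 2 * v y ^+ 2] over pairs from the two cells. All
    distances are at most [eps], so coercivity bounds the first term by [2 * (eps ^+ n / c0)] times
    the energy density; dividing by the cell volume [h ^+ n] gives [K]. *)
Lemma poincare_step c : cell c h `<=` D -> cell (fun i => c i + h) h `<=` D ->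
  (A (cell c h) <= K%:E * En + 2%:E * A (cell (fun i => c i + h)%R h))%E.
Proof.
set Q := cell c h; set Q' := cell _ h => QD Q'D.
have mQ : measurable Q by exact: measurable_cell.
have mQ' : measurable Q' by exact: measurable_cell.
have hn : 0 < h ^+ n by rewrite exprn_gt0.
have mdelta : measurable_fun U (fun z => (delta alpha v z ^+ 2)%:E).
  by apply/measurable_EFinP; apply: measurable_funX; exact: measurable_delta.
have QQU : Q `*` Q' `<=` U by move=> z [/QD ? /Q'D ?].
have mQQ : measurable (Q `*` Q') by exact: measurableX.
have mdelta' := measurable_funS mU QQU mdelta.
have mv1 := measurable_fun_rect_fst mQ (mv2 mQ QD) (A2 := Q').
have mv2' := measurable_fun_rect_snd mQ' (mv2 mQ' Q'D) (A1 := Q).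
have A0 (P : set E) : (0 <= A P)%E by apply: integral_ge0 => x _; rewrite lee_fin sqr_ge0.
have v20 (P : set E) x : P x -> (0 <= (v x ^+ 2)%:E)%E by rewrite lee_fin sqr_ge0.
pose K1 : R := 2 * (eps ^+ n / c0).
have K10 : 0 <= K1 by rewrite mulr_ge0// divr_ge0 ?exprn_ge0// ltW.
have hE : (h ^+ n)%:E != 0%E :> \bar R by rewrite eqe gt_eqF.
rewrite -(@lee_pmul2l _ (h ^+ n)%:E)// ?lte_fin//.
have <- : (\int[mu2]_(z in Q `*` Q') (v z.1 ^+ 2)%:E = (h ^+ n)%:E * A Q)%E.
  rewrite (integral_rect_fst lambda lambda mQ mQ' (mv2 mQ QD) (v20 Q)).
  by congr (_ * _)%E; exact: lebesgue_rV_cell.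
apply: (@le_trans _ _ (\int[mu2]_(z in Q `*` Q')
    (K1%:E * (delta alpha v z ^+ 2)%:E + 2%:E * (v z.2 ^+ 2)%:E))%E).
  apply: ge0_le_integral => //.
  - by move=> z _; rewrite lee_fin sqr_ge0.
  - apply: emeasurable_funD; apply: emeasurable_funM => //.
  - move=> [x y] [/= Qx Q'y]; rewrite -!EFinM -EFinD lee_fin.
    have Dx := QD _ Qx; have Dy := Q'D _ Q'y.
    have xy : enorm (y - x) <= eps.
      exact: le_trans (cell_dist_next h0 Qx Q'y) (ltW he).
    have dd : (v y - v x) ^+ 2 <= eps ^+ n / c0 * delta alpha v (x, y) ^+ 2.
      rewrite mulrAC ler_pdivlMr// mulrC.
      apply: (le_trans (coercive_delta v Dx Dy xy)).
      by rewrite ler_wpM2r ?sqr_ge0// ler_pXn2r ?nnegrE ?enorm_ge0// ltW.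
    rewrite /K1 -mulrA; move: dd; set X := eps ^+ n / c0 * _ => dd.
    (* This square is exactly the gap in the elementary inequality between [v x] and [v y]. *)
    have := sqr_ge0 (v x - 2 * v y); nra.
rewrite ge0_integralD//; last 4 first.
- by move=> z _; rewrite mule_ge0// lee_fin ?sqr_ge0.
- by apply: emeasurable_funM.
- by move=> z _; rewrite mule_ge0// lee_fin ?sqr_ge0.
- by apply: emeasurable_funM.
rewrite ge0_integralZl//; last by move=> z _; rewrite lee_fin sqr_ge0.
rewrite ge0_integralZl//; last by move=> z _; rewrite lee_fin sqr_ge0.
have -> : (\int[mu2]_(z in Q `*` Q') (v z.2 ^+ 2)%:E = (h ^+ n)%:E * A Q')%E.
  rewrite (integral_rect_snd lambda lambda mQ mQ' (mv2 mQ' Q'D) (v20 Q')).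
  by congr (_ * _)%E; exact: lebesgue_rV_cell.
rewrite [leRHS]ge0_muleDr ?mule_ge0 ?lee_fin//.
have -> : ((h ^+ n)%:E * (K%:E * En) = K1%:E * En)%E.
  by rewrite muleA -EFinM (_ : h ^+ n * K = K1)// /K /K1 mulrCA divff ?mulr1// gt_eqF.
rewrite [((h ^+ n)%:E * (2%:E * _))%E]muleCA.
apply: leeD2r; apply: lee_wpmul2l; first by rewrite lee_fin.
apply: ge0_subset_integral => //.
by move=> z _; rewrite lee_fin sqr_ge0.
Qed.

Let A0 Q : (0 <= A Q)%E.
Proof. by apply: integral_ge0 => x _; rewrite lee_fin sqr_ge0. Qed.

(** The constant after [m] applications of [poincare_step]; its exponential growth is harmless
    because [m] is fixed by the mesh. *)
Let chain_cst m : R := iter m (fun C => K + 2 * C) 0.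

Let chain_cst_ge0 m : 0 <= chain_cst m.
Proof. by elim: m => //= m IH; rewrite addr_ge0// mulr_ge0. Qed.

(** Induction along the diagonal. The hypothesis says that after [m] shifts some coordinate has
    passed [M], so the cell has left [Om] and [v] vanishes on it. A cell that misses [Om] earlier
    ends the chain at once; one that meets [Om] lies in [D] together with its successor. The
    intersection with [D] covers cells that stick out. *)
Lemma poincare_chain m c : (exists i, M <= c i + m%:R * h) ->
  (A (cell c h `&` D) <= (chain_cst m)%:E * En)%E.
Proof.
elim: m c => [|m IH] c [i ci].
- rewrite mul0e [leLHS](_ : _ = 0%E)//.
  rewrite (@ae_eq_integral _ _ _ _ _ (cst 0%E)) ?integral0//.
  + by apply: measurableI => //; exact: measurable_cell.
  + apply: mv2; first by apply: measurableI => //; exact: measurable_cell.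
    exact: subIsetr.
  case/(Vc_P mD malpha): Vv => _ _; apply: filterS => x v0 [cx Dx].
  rewrite v0 ?expr0n// => Ox; have := OmM i Ox.
  have := cx i; rewrite /= in_itv/= => /andP[cxi _].
  have := ler_norm (x 0 i); rewrite mul0r addr0 in ci; lra.
have [cO|cO] := pselect (cell c h `&` Om !=set0); last first.
  rewrite [leLHS](_ : _ = 0%E); first by rewrite mule_ge0// lee_fin.
  rewrite (@ae_eq_integral _ _ _ _ _ (cst 0%E)) ?integral0//.
  + by apply: measurableI => //; exact: measurable_cell.
  + apply: mv2; first by apply: measurableI => //; exact: measurable_cell.
    exact: subIsetr.
  case/(Vc_P mD malpha): Vv => _ _; apply: filterS => x v0 [cx Dx].
  by rewrite v0 ?expr0n// => Ox; apply: cO; exists x.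
have [cD c'D] := cell_sub_domain h0 he cO.
rewrite setIidl//; apply: (le_trans (poincare_step cD c'D)).
have := IH (fun i => c i + h); rewrite setIidl// => {}IH.
have -> : ((chain_cst m.+1)%:E * En = K%:E * En + 2%:E * ((chain_cst m)%:E * En))%E.
  rewrite (_ : chain_cst m.+1 = K + 2 * chain_cst m)// EFinD.
  have c20 : 0 <= 2 * chain_cst m by rewrite mulr_ge0.
  by rewrite [LHS]ge0_muleDl ?lee_fin// (EFinM 2) muleA.
apply: leeD2l; apply: lee_wpmul2l => //.
apply: IH; exists i; apply: (le_trans ci).
by rewrite -natr1 mulrDl mul1r addrA addrAC.
Qed.

(** Every corner is at least [- M] in each coordinate and [p%:R * h = 2 * M], so [p] shifts suffice
    for all cells; the factor is their number. *)
Lemma poincare_cover p : p%:R * h = 2 * M ->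
  (A D <= (chain_cst p *+ #|{ffun 'I_n -> 'I_p}|)%:E * En)%E.
Proof.
move=> ph; pose Q (a : {ffun 'I_n -> 'I_p}) := cell (fun i => - M + (a i)%:R * h) h.
have mQ a : measurable (Q a) by exact: measurable_cell.
have mQv a : measurable_fun D ((fun x => (v x ^+ 2)%:E) \_ (Q a)).
  apply/(measurable_restrict _ (mQ a) mD); apply: mv2; last exact: subIsetl.
  exact: measurableI.
have Qv0 a x : (0 <= ((fun x => (v x ^+ 2)%:E) \_ (Q a)) x)%E.
  by rewrite patchE; case: ifP => // _; rewrite lee_fin sqr_ge0.
apply: (@le_trans _ _ (\int[lambda]_(x in D)
    \sum_(a : {ffun 'I_n -> 'I_p}) ((fun x => (v x ^+ 2)%:E) \_ (Q a)) x)%E).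
  apply: ae_ge0_le_integral => //.
  - by move=> x _; rewrite lee_fin sqr_ge0.
  - by apply: mv2.
  - by move=> x _; exact: sume_ge0.
  - by apply: emeasurable_sum.
  case/(Vc_P mD malpha): Vv => _ _; apply: filterS => x v0 Dx.
  have [Ox|nOx] := pselect (Om x); last first.
    by rewrite v0// expr0n sume_ge0.
  have [a ax] := cell_cover h0 ph (fun i => OmM i Ox).
  rewrite (bigD1 a)//= patchE mem_set//.
  by rewrite leeDl// sume_ge0.
rewrite ge0_integral_sum//.
apply: (@le_trans _ _ (\sum_(a : {ffun 'I_n -> 'I_p}) (chain_cst p)%:E * En)%E).
  apply: lee_sum => a _; rewrite -integral_mkcondr setIC.
  apply: poincare_chain; exists (Ordinal n0); rewrite ph.
  have : 0 <= (a (Ordinal n0))%:R * h by rewrite mulr_ge0// ltW.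
  lra.
rewrite -ge0_sume_distrl; last by move=> a _; rewrite lee_fin.
by rewrite sumEFin sumr_const.
Qed.

End poincare.
End coercive_kernel.

(** * Finite rank approximation by dyadic averages *)

(** Doubling makes the sum of all earlier [q j] at most the current one. At the last level with
    [k j != 0] both are at most 1, whence the bound 2. *)
Lemma geometric_cutoff {R : realType} (q k : nat -> R) :
  (forall j, 0 <= q j) -> (forall j, 2 * q j <= q j.+1) -> (forall j, 0 <= k j <= 1) ->
  (forall j, k j != 0 -> q j <= 1) ->
  forall J, \sum_(j < J) k j * q j <= 2.
Proof.
move=> q0 q2 k01 kq; have qs J : \sum_(j < J) q j <= q J.
  elim: J => [|J IH]; first by rewrite big_ord0.
  by rewrite big_ord_recr/=; have := q2 J; lra.
have kqle J : \sum_(j < J) k j * q j <= \sum_(j < J) q j.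
  by apply: ler_sum => j _; have /andP[_ k1] := k01 j; rewrite ler_piMl.
elim => [|J IH]; first by rewrite big_ord0.
rewrite big_ord_recr/=; have [->|/kq qJ] := eqVneq (k J) 0; first by rewrite mul0r addr0.
have := kqle J.+1; rewrite !big_ord_recr/=; have := qs J; lra.
Qed.

Section finite_rank.
Context {R : realType} {n : nat}.
Local Notation E := 'rV[R]_n.
Local Notation lambda := (lebesgue_rV n).
Local Notation mu2 := (lebesgue_rV n \x lebesgue_rV n)%E.
Variables (Om : set E) (eps : R) (alpha : E -> E -> E).
Local Notation D := (total_domain Om eps).
Local Notation U := (D `*` D).

Hypotheses (n0 : (0 < n)%N) (eps0 : 0 < eps).
Hypothesis malpha : measurable_fun U (fun z : E * E => alpha z.1 z.2).
Hypothesis Dfin : (lambda D < +oo)%E.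
Variables (M : R) (c0 : R).
Hypotheses (M0 : 0 < M) (OmM : forall x i, Om x -> `|x 0 i| < M) (c00 : 0 < c0).
Hypothesis coercive : forall x y, D x -> D y -> x != y -> enorm (y - x) <= eps ->
  c0 <= gker alpha (x, y) * enorm (y - x) ^+ n.

Let mD : measurable D. Proof. exact: measurable_total_domain. Qed.
Let mU : measurable U. Proof. exact: measurableX. Qed.

Lemma fine_mesh : exists2 p, (0 < p)%N & Num.sqrt n%:R * (2 * (2 * M / p%:R)) < eps.
Proof.
pose t := Num.sqrt n%:R * (4 * M) / eps.
have t0 : 0 <= t by rewrite /t !mulr_ge0 ?sqrtr_ge0 ?invr_ge0// ltW.
exists (Num.truncn t).+1 => //.
have := truncnS_gt t; rewrite {1}/t ltr_pdivrMr// => h.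
have p0 : 0 < (Num.truncn t).+1%:R :> R by rewrite ltr0n.
rewrite (_ : _ * _ = Num.sqrt n%:R * (4 * M) / (Num.truncn t).+1%:R); last first.
  by field; rewrite gt_eqF.
by rewrite ltr_pdivrMr// [ltRHS]mulrC.
Qed.

Theorem nonlocal_poincare : exists2 C : R, 0 <= C &
  forall v, Vc Om eps alpha v ->
    snorm (ip lambda D) v <= C * snorm (ip mu2 U) (delta alpha v).
Proof.
have [p p0 hp] := fine_mesh.
set h := 2 * M / p%:R in hp.
have pR : 0 < p%:R :> R by rewrite ltr0n.
have h0 : 0 < h by rewrite divr_gt0// mulr_gt0.
have ph : p%:R * h = 2 * M by rewrite /h mulrC divfK// gt_eqF.
pose K := 2 * (eps ^+ n / c0) / h ^+ n.
pose C := iter p (fun C => K + 2 * C) 0 *+ #|{ffun 'I_n -> 'I_p}|.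
have K0 : 0 <= K by rewrite /K !mulr_ge0 ?invr_ge0 ?exprn_ge0// ltW.
have it0 m : 0 <= iter m (fun C => K + 2 * C) 0.
  by elim: m => //= m IH; rewrite addr_ge0// mulr_ge0.
have C0 : 0 <= C by rewrite /C mulrn_wge0.
exists (Num.sqrt C); first exact: sqrtr_ge0.
move=> v Vv; have [Lv Ldv v0] := (Vc_P mD malpha v).1 Vv.
rewrite /snorm -sqrtrM// ler_wsqrtr// -lee_fin.
have := poincare_cover n0 eps0 malpha OmM c00 coercive Vv h0 hp ph.
rewrite !ip_sqr EFinM /Rintegral !fineK//.
- by apply: integrable_fin_num => //; case: Ldv.
- by apply: integrable_fin_num => //; case: Lv.
Qed.

Section mesh.
Variables (p0 : nat) (J : nat).
Hypotheses (p00 : (0 < p0)%N) (J0 : (0 < J)%N).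
Hypothesis hp0 : Num.sqrt n%:R * (2 * (2 * M / p0%:R)) < eps.

Let h (j : nat) : R := 2 * M / p0%:R / 2 ^+ j.
(** One index range for all levels. At level [j] the indices from [p0 * 2 ^ j] on give cells beyond
    [M], which miss [Om] and are emptied. *)
Let P : nat := (p0 * 2 ^ J)%N.
Let rn : R := Num.sqrt n%:R.

Let p0R : 0 < p0%:R :> R. Proof. by rewrite ltr0n. Qed.

Let h0 j : 0 < h j.
Proof. by rewrite !divr_gt0// ?mulr_gt0// exprn_gt0. Qed.

Let rn0 : 0 < rn. Proof. by rewrite sqrtr_gt0 ltr0n. Qed.

Let h_le j : h j <= 2 * M / p0%:R.
Proof.
rewrite /h ler_pdivrMr ?exprn_gt0// ler_peMr ?divr_ge0 ?mulr_ge0 ?(ltW M0)// ?(ltW p0R)//.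
by rewrite exprn_ege1// ler1n.
Qed.

Let h_eps j : rn * (2 * h j) < eps.
Proof.
apply: le_lt_trans hp0; rewrite ler_pM2l//.
by rewrite ler_pM2l.
Qed.

Let mesh_cell (i : 'I_J * {ffun 'I_n -> 'I_P}) : set E :=
  cell (fun k => - M + (i.2 k)%:R * h i.1) (h i.1).

(* Cells that miss [Om] are emptied, so that every mesh set is contained in [D]. *)
Definition mesh_set i : set E :=
  if `[< mesh_cell i `&` Om !=set0 >] then mesh_cell i else set0.

(** Dividing by the volume [h ^+ n] makes a cell mean, dividing by [J] averages over the levels. *)
Definition mesh_weight (i : 'I_J * {ffun 'I_n -> 'I_P}) : R := (J%:R * h i.1 ^+ n)^-1.

Lemma measurable_mesh_set i : measurable (mesh_set i).
Proof. by rewrite /mesh_set; case: ifP => // _; exact: measurable_cell. Qed.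

Let mesh_setD i : mesh_set i `<=` D.
Proof.
rewrite /mesh_set; case: ifPn => [/asboolP ne|_]; last exact: sub0set.
by have [] := cell_sub_domain eps0 (h0 _) (h_eps _) ne.
Qed.

Let mesh_set_cell i x : mesh_set i x -> mesh_cell i x.
Proof. by rewrite /mesh_set; case: ifPn. Qed.

Let w0 i : 0 < mesh_weight i.
Proof. by rewrite invr_gt0 mulr_gt0 ?ltr0n// exprn_gt0. Qed.

(** Counts the mesh sets of level [j] that contain [x]: 1 on [Om], and 0 or 1 elsewhere. *)
Let level j x : R := \sum_(a : {ffun 'I_n -> 'I_P}) \1_(mesh_set (j, a)) x.

Let ind01 (A : set E) x : 0 <= (\1_A x : R) <= 1.
Proof. by rewrite indicE; case: (_ \in _) => /=; rewrite ?lexx ?ler01. Qed.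

Let ind_neq0 (A : set E) x : \1_A x != 0 :> R -> A x.
Proof. by rewrite indicE; case: (boolP (_ \in _)) => [/set_mem//|_]; rewrite eqxx. Qed.

Let level_le1 j x : level j x <= 1.
Proof.
have [[a xa]|na] := pselect (exists a, mesh_set (j, a) x); last first.
  rewrite /level big1// => a _; apply/eqP/negPn/negP => /ind_neq0 xa.
  by apply: na; exists a.
rewrite /level (bigD1 a)//= big1 ?addr0; first by have /andP[] := ind01 (mesh_set (j, a)) x.
move=> b ba; apply/eqP/negPn/negP => /ind_neq0 xb.
move/eqP: ba; apply; apply: (cell_inj (h0 j) (mesh_set_cell xb) (mesh_set_cell xa)).
Qed.

Let level_Om (j : 'I_J) x : Om x -> level j x = 1.
Proof.
move=> Ox; apply/eqP; rewrite eq_le level_le1/=.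
pose q := (p0 * 2 ^ j)%N.
have qh : q%:R * h j = 2 * M.
  rewrite /q natrM natrX /h mulrCA; field.
  by rewrite !gt_eqF ?exprn_gt0.
have [a xa] := cell_cover (h0 j) qh (fun i => OmM i Ox).
have qP : (q <= P)%N by rewrite leq_mul2l leq_exp2l// (ltnW (ltn_ord j)) orbT.
pose b := [ffun k => widen_ord qP (a k)].
have xb : mesh_cell (j, b) x by move=> k; rewrite /= ffunE/=; exact: xa.
rewrite /level (bigD1 b)//= {1}indicE mem_set; last first.
  by rewrite /mesh_set asboolT//; exists x.
by rewrite lerDl sumr_ge0// => k _; have /andP[] := ind01 (mesh_set (j, k)) x.
Qed.

(** The integral kernel of [mesh_average], of finite rank. *)
Definition mesh_kernel x y : R := \sum_i mesh_weight i * \1_(mesh_set i) x * \1_(mesh_set i) y.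

Let mesh_kernel_ge0 x y : 0 <= mesh_kernel x y.
Proof.
apply: sumr_ge0 => i _; have /andP[x1 _] := ind01 (mesh_set i) x.
by have /andP[y1 _] := ind01 (mesh_set i) y; rewrite !mulr_ge0// ltW.
Qed.

Let mesh_kernel_le x y : mesh_kernel x y <= \sum_i mesh_weight i.
Proof.
apply: ler_sum => i _; have /andP[x0 x1] := ind01 (mesh_set i) x.
have /andP[y0 y1] := ind01 (mesh_set i) y.
by rewrite -mulrA ler_piMr ?(ltW (w0 _))// mulr_ile1.
Qed.

Let mesh_dist i x y : mesh_set i x -> mesh_set i y -> enorm (y - x) <= rn * h i.1.
Proof. by move=> /mesh_set_cell xi /mesh_set_cell yi; exact: cell_dist xi yi. Qed.

Let mesh_kernel_neq0 x y : mesh_kernel x y != 0 -> enorm (y - x) <= eps.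
Proof.
move=> k0; have [|nxy] := leP (enorm (y - x)) eps => //; exfalso; move/eqP: k0; apply.
apply: big1 => i _; have [-> |/ind_neq0 xi] := eqVneq (\1_(mesh_set i) x : R) 0.
  by rewrite mulr0 mul0r.
have [-> |/ind_neq0 yi] := eqVneq (\1_(mesh_set i) y : R) 0; first by rewrite mulr0.
have := mesh_dist xi yi; have := h_eps i.1; have : 0 < rn * h i.1 by rewrite mulr_gt0.
by move=> *; exfalso; lra.
Qed.

(* A pair [x, y] shares a cell only at the levels with [h j >= |x - y| / sqrt n], over which
   the weights [h j ^- n] add up to a multiple of the last one: averaging over [J] levels
   thus gains the factor [1 / J] over the borderline kernel [|x - y| ^- n]. *)
Let mesh_kernel_bound x y :
  mesh_kernel x y * enorm (y - x) ^+ n <= 2 * rn ^+ n / J%:R.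
Proof.
set r := enorm (y - x); have r0 : 0 <= r by exact: enorm_ge0.
pose kk (j : 'I_J) : R :=
  \sum_(a : {ffun 'I_n -> 'I_P}) \1_(mesh_set (j, a)) x * \1_(mesh_set (j, a)) y.
(* [kk] lives on ['I_J]; extension by 0 gives the sequence that [geometric_cutoff] expects. *)
pose k (j : nat) : R := oapp kk 0 (insub j).
(* Two points at distance [r] can share a cell of level [j] only if [q j <= 1]. Halving [h]
   multiplies [q] by [2 ^+ n], at least 2 since [n] is positive. *)
pose q (j : nat) : R := (r / (rn * h j)) ^+ n.
have kk01 j : 0 <= kk j <= 1.
  apply/andP; split.
    apply: sumr_ge0 => a _; have /andP[x1 _] := ind01 (mesh_set (j, a)) x.
    by have /andP[y1 _] := ind01 (mesh_set (j, a)) y; rewrite mulr_ge0.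
  apply: le_trans (level_le1 j x); apply: ler_sum => a _.
  have /andP[x1 _] := ind01 (mesh_set (j, a)) x.
  by have /andP[_ y1] := ind01 (mesh_set (j, a)) y; rewrite ler_piMr.
have kkq j : kk j != 0 -> q j <= 1.
  move=> kk0; have rh : r <= rn * h j.
    rewrite leNgt; apply/negP => rh; move/eqP: kk0; apply; apply: big1 => a _.
    have [-> |/ind_neq0 xi] := eqVneq (\1_(mesh_set (j, a)) x : R) 0; first by rewrite mul0r.
    have [-> |/ind_neq0 yi] := eqVneq (\1_(mesh_set (j, a)) y : R) 0; first by rewrite mulr0.
    by have := mesh_dist xi yi; rewrite leNgt rh.
  apply: exprn_ile1; last by rewrite ler_pdivrMr ?mul1r// mulr_gt0.
  by rewrite divr_ge0// mulr_ge0// ltW.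
have cut : \sum_(j < J) k j * q j <= 2.
  apply: geometric_cutoff.
  - by move=> j; rewrite exprn_ge0// divr_ge0// mulr_ge0// ltW.
  - move=> j; rewrite /q.
    have -> : r / (rn * h j.+1) = 2 * (r / (rn * h j)).
      rewrite /h exprS; field.
      by rewrite !gt_eqF// ?exprn_gt0.
    rewrite [leRHS]exprMn; apply: ler_wpM2r.
      by rewrite exprn_ge0// divr_ge0// mulr_ge0// ltW.
    by rewrite -[leLHS]expr1 ler_eXn2l// ltr1n.
  - by move=> j; rewrite /k; case: insubP => [j' _ _|_] /=; rewrite ?lexx ?ler01.
  - move=> j; rewrite /k; case: insubP => [j' _ <-|_] /=; first exact: kkq.
    by rewrite eqxx.
have -> : mesh_kernel x y * r ^+ n = rn ^+ n / J%:R * \sum_(j < J) k j * q j.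
  rewrite /mesh_kernel -(pair_bigA _ (fun j a => mesh_weight (j, a) *
    \1_(mesh_set (j, a)) x * \1_(mesh_set (j, a)) y))/= mulr_suml mulr_sumr.
  apply: eq_bigr => j _; rewrite /k valK/= /kk !mulr_suml mulr_sumr.
  apply: eq_bigr => a _; rewrite /mesh_weight.
  have -> : q j = r ^+ n / (rn ^+ n * h j ^+ n) by rewrite /q [LHS]expr_div_n exprMn.
  rewrite [(j, a).1]/=.
  have hn : h j ^+ n != 0 by rewrite gt_eqF ?exprn_gt0.
  have rnn : rn ^+ n != 0 by rewrite gt_eqF ?exprn_gt0.
  have JR : J%:R != 0 :> R by rewrite pnatr_eq0 -lt0n.
  move: hn rnn JR; move: (h j ^+ n) (rn ^+ n) (r ^+ n) (J%:R : R) => a1 a2 a3 a4.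
  by move: (\1_ _ x : R) (\1_ _ y : R) => b1 b2 *; field; apply/and3P.
rewrite -[leRHS]mulrA [leRHS]mulrC; apply: ler_wpM2l => //.
by rewrite divr_ge0 ?exprn_ge0// ltW.
Qed.

Let L2_mesh_set i : L2 lambda D \1_(mesh_set i).
Proof. exact: L2_indic (measurable_mesh_set i). Qed.

Let mesh_kernel_ip x g : L2 lambda D g -> L2 lambda D (mesh_kernel x) /\
  ip lambda D (mesh_kernel x) g =
  \sum_i mesh_weight i * \1_(mesh_set i) x * ip lambda D \1_(mesh_set i) g.
Proof. by move=> Lg; apply: ip_sum. Qed.

Let mesh_set_mass i x :
  mesh_weight i * \1_(mesh_set i) x * ip lambda D \1_(mesh_set i) (cst 1) =
  J%:R^-1 * \1_(mesh_set i) x.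
Proof.
have [->|/ind_neq0 xi] := eqVneq (\1_(mesh_set i) x : R) 0; first by rewrite !mulr0 mul0r.
rewrite indicE mem_set// !mulr1 /ip.
under eq_Rintegral do rewrite mulr1.
rewrite /Rintegral integral_indic//; last exact: measurable_mesh_set.
rewrite setIidl; last exact: mesh_setD.
have -> : mesh_set i = mesh_cell i by move: xi; rewrite /mesh_set; case: ifP.
rewrite [X in fine X](_ : _ = (h i.1 ^+ n)%:E); last exact: lebesgue_rV_cell.
rewrite /mesh_weight/= invfM -mulrA mulVf ?mulr1//.
by rewrite gt_eqF// exprn_gt0.
Qed.

(** Mass 1 on [Om] makes [v x - mesh_average v x] an average of the differences [v x - v y];
    elsewhere mass at most 1 suffices, since there [v x = 0]. *)
Let mesh_kernel_mass x : ip lambda D (mesh_kernel x) (cst 1) <= 1 /\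
  (Om x -> ip lambda D (mesh_kernel x) (cst 1) = 1).
Proof.
have [_ ->] := mesh_kernel_ip x (L2_cst mD Dfin 1).
rewrite (eq_bigr (fun i => J%:R^-1 * \1_(mesh_set i) x)) => [|i _]; last exact: mesh_set_mass.
have JR : 0 < J%:R :> R by rewrite ltr0n.
rewrite -mulr_sumr -(pair_bigA _ (fun j a => \1_(mesh_set (j, a)) x))/=.
split=> [|Ox].
  rewrite mulrC ler_pdivrMr// mul1r.
  apply: (@le_trans _ _ (\sum_(j < J) 1)); last by rewrite sumr_const card_ord.
  by apply: ler_sum => j _; exact: level_le1.
rewrite (eq_bigr (fun=> 1)) => [|j _]; last exact: level_Om.
by rewrite sumr_const card_ord mulVf// gt_eqF.
Qed.

Definition mesh_average (v : E -> R) (x : E) : R :=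
  \sum_i mesh_weight i * ip lambda D \1_(mesh_set i) v * \1_(mesh_set i) x.

Lemma L2_mesh_average v : L2 lambda D (mesh_average v).
Proof. by have [] := ip_sum mD (index_enum _) (fun i => mesh_weight i *
  ip lambda D \1_(mesh_set i) v) L2_mesh_set (L2_0 lambda D). Qed.

Let mesh_averageE v x : L2 lambda D v -> mesh_average v x = ip lambda D (mesh_kernel x) v.
Proof.
by move=> Lv; have [_ ->] := mesh_kernel_ip x Lv; apply: eq_bigr => i _; rewrite mulrAC.
Qed.

Let cst_mesh : R := 2 * rn ^+ n / c0 / J%:R.

(** The error is the integral of [k y * (v x - v y)]. Cauchy-Schwarz with [k = sk * sk] and mass at
    most 1 bounds its square by the integral of [k y * (v y - v x) ^+ 2]; [mesh_kernel_bound] and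
    coercivity then compare this with the energy density. *)
Let mesh_average_pointwise v x : L2 lambda D v -> D x -> (Om x \/ v x = 0) ->
  (((v x - mesh_average v x) ^+ 2)%:E <=
   cst_mesh%:E * \int[lambda]_(y in D) (delta alpha v (x, y) ^+ 2)%:E)%E.
Proof.
move=> Lv Dx xv; have L1 := L2_cst mD Dfin 1.
have Lw : L2 lambda D (v x *: cst 1 - v) by apply: L2B => //; exact: L2Z.
have Lk : L2 lambda D (mesh_kernel x) by have [] := mesh_kernel_ip x L1.
set k := mesh_kernel x in Lk *; set w := _ - v in Lw.
pose sk y := Num.sqrt (k y).
have sk2 y : sk y * sk y = k y by rewrite -expr2 sqr_sqrtr// mesh_kernel_ge0.
have msk : measurable_fun D sk.
  have msqrt : measurable_fun setT (@Num.sqrt R).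
    by apply: continuous_measurable_fun; exact: sqrt_continuous.
  by apply: (measurableT_comp msqrt); case: Lk.
pose W : R := Num.sqrt (\sum_i mesh_weight i).
have skW : {ae lambda, forall y, D y -> `|sk y| <= W}.
  by apply: aeW => y _; rewrite ger0_norm ?sqrtr_ge0// ler_wsqrtr// mesh_kernel_le.
have Lsk : L2 lambda D sk by exact: (L2_bounded mD Dfin msk skW).
have Lskw : L2 lambda D (sk \* w) by exact: (L2_bmul mD msk skW Lw).
have diffE : v x - mesh_average v x = ip lambda D sk (sk \* w).
  have -> : ip lambda D sk (sk \* w) = ip lambda D w k.
    by apply: eq_Rintegral => y _; rewrite /= mulrA sk2 mulrC.
  rewrite mesh_averageE// -/k [ip _ _ k v]ipC.
  have ipw : ip lambda D w k = v x * ip lambda D (cst 1) k - ip lambda D v k.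
    rewrite /w addrC -scaleN1r.
    have [_ _ lin _] := L2_semi_inner lambda mD.
    rewrite lin//; last exact: L2Z.
    rewrite -[v x *: cst 1]addr0 lin//; last exact: L2_0.
    rewrite [ip _ _ 0 k](_ : _ = 0); first by rewrite addr0 mulN1r addrC.
    by have := snorm_CS (L2_semi_inner lambda mD) (L2_0 lambda D) Lk;
      rewrite /snorm [ip _ _ 0 0](_ : _ = 0) ?sqrtr0 ?mul0r ?normr_le0 => [/eqP|];
      rewrite // /ip; under eq_Rintegral do rewrite mul0r; rewrite Rintegral_cst ?mul0r.
  rewrite ipw; congr (_ - _); case: xv => [Ox|->]; last by rewrite mul0r.
  by rewrite ipC (mesh_kernel_mass x).2// mulr1.
have step : (v x - mesh_average v x) ^+ 2 <= ip lambda D (sk \* w) (sk \* w).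
  rewrite diffE; apply: (le_trans (semi_inner_CS (L2_semi_inner lambda mD) Lsk Lskw)).
  rewrite ler_piMl ?ip_ge0// [leLHS](_ : _ = ip lambda D k (cst 1)).
    exact: (mesh_kernel_mass x).1.
  by apply: eq_Rintegral => y _; rewrite /= mulr1 sk2.
have cm0 : 0 <= cst_mesh by rewrite /cst_mesh !mulr_ge0 ?invr_ge0 ?exprn_ge0 ?ltW// ltr0n.
have mdx : measurable_fun D (fun y => (delta alpha v (x, y) ^+ 2)%:E).
  apply: (measurable_rect_section mD mD Dx (F := fun z => (delta alpha v z ^+ 2)%:E)).
  apply/measurable_EFinP; apply: measurable_funX; apply: measurable_delta => //.
  by case: Lv.
apply: (@le_trans _ _ (ip lambda D (sk \* w) (sk \* w))%:E); first by rewrite lee_fin.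
rewrite ip_sqr /Rintegral fineK; last by apply: integrable_fin_num => //; case: Lskw.
rewrite -ge0_integralZl//; last by move=> y _; rewrite lee_fin sqr_ge0.
apply: ge0_le_integral => //.
- by move=> y _; rewrite lee_fin sqr_ge0.
- by apply/measurable_EFinP; apply: measurable_funX; case: Lskw.
- by apply: emeasurable_funM.
move=> y Dy; rewrite -EFinM lee_fin.
rewrite (_ : ((sk \* w) y) ^+ 2 = k y * (v y - v x) ^+ 2); last first.
  by rewrite -sk2 (_ : (sk \* w) y = sk y * (v x * 1 - v y))//; ring.
have [->|k0] := eqVneq (k y) 0; first by rewrite mul0r mulr_ge0 ?sqr_ge0.
have c1 : c0 * (v y - v x) ^+ 2 <= enorm (y - x) ^+ n * delta alpha v (x, y) ^+ 2.
  by apply: (coercive_delta coercive) => //; exact: mesh_kernel_neq0.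
have c2 := mesh_kernel_bound x y.
have -> : cst_mesh * delta alpha v (x, y) ^+ 2 =
    2 * rn ^+ n / J%:R * delta alpha v (x, y) ^+ 2 / c0.
  by rewrite /cst_mesh [2 * rn ^+ n / c0 / J%:R]mulrAC [LHS]mulrAC.
rewrite ler_pdivlMr//.
apply: (@le_trans _ _ (k y * (enorm (y - x) ^+ n * delta alpha v (x, y) ^+ 2))).
  by rewrite -mulrA [_ * c0]mulrC ler_wpM2l// mesh_kernel_ge0.
by rewrite mulrA ler_wpM2r ?sqr_ge0.
Qed.

Lemma mesh_average_approx v : Vc Om eps alpha v ->
  ip lambda D (v - mesh_average v) (v - mesh_average v) <=
  2 * rn ^+ n / c0 / J%:R * ip mu2 U (delta alpha v) (delta alpha v).
Proof.
move=> Vv; have [Lv Ldv v0] := (Vc_P mD malpha v).1 Vv.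
have Ld : L2 lambda D (v - mesh_average v) by apply: L2B => //; exact: L2_mesh_average.
have cm0 : 0 <= cst_mesh by rewrite /cst_mesh !mulr_ge0 ?invr_ge0 ?exprn_ge0 ?ltW// ltr0n.
rewrite -/cst_mesh -lee_fin EFinM !ip_sqr /Rintegral !fineK; last 2 first.
- by apply: integrable_fin_num => //; case: Ldv.
- by apply: integrable_fin_num => //; case: Ld.
have mdelta : measurable_fun U (fun z => (delta alpha v z ^+ 2)%:E).
  by apply/measurable_EFinP; apply: measurable_funX; case: Ldv.
have delta0 z : U z -> (0 <= (delta alpha v z ^+ 2)%:E)%E by rewrite lee_fin sqr_ge0.
have mint := measurable_rect_int lambda mD mD mdelta delta0.
have int0 x : D x -> (0 <= \int[lambda]_(y in D) (delta alpha v (x, y) ^+ 2)%:E)%E.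
  by move=> Dx; apply: integral_ge0 => y _; rewrite lee_fin sqr_ge0.
rewrite tonelli_rect// -ge0_integralZl//; apply: ae_ge0_le_integral => //.
- by move=> x _; rewrite lee_fin sqr_ge0.
- by apply/measurable_EFinP; apply: measurable_funX; case: Ld.
- by move=> x Dx; rewrite mule_ge0// ?lee_fin// int0.
- by apply: emeasurable_funM.
apply: filterS v0 => x v0 Dx; apply: mesh_average_pointwise => //.
by have [Ox|nOx] := pselect (Om x); [left|right; exact: v0].
Qed.

End mesh.

(* Quantitative form of the compactness of the embedding of [Vc] in [L2]. *)
Theorem finite_rank_approximation e : 0 < e ->
  exists (I : finType) (w : I -> R) (Q : I -> set E), (forall i, measurable (Q i)) /\
  forall v, Vc Om eps alpha v ->
    snorm (ip lambda D) (v - fun x => \sum_i w i * ip lambda D \1_(Q i) v * \1_(Q i) x) <=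
    e * snorm (ip mu2 U) (delta alpha v).
Proof.
move=> e0; have [p0 p00 hp0] := fine_mesh.
pose c := 2 * Num.sqrt n%:R ^+ n / c0 : R.
have c0' : 0 <= c by rewrite /c !mulr_ge0 ?invr_ge0 ?exprn_ge0 ?sqrtr_ge0// ltW.
(* Chosen so that the squared error factor [c / J%:R] is at most [e ^+ 2]. *)
pose J := (Num.truncn (c / e ^+ 2)).+1.
have JR : 0 < J%:R :> R by rewrite ltr0n.
exists ('I_J * {ffun 'I_n -> 'I_(p0 * 2 ^ J)})%type, (@mesh_weight p0 J), (@mesh_set p0 J).
split; first exact: measurable_mesh_set.
move=> v Vv; have := mesh_average_approx p00 (ltn0Sn _ : (0 < J)%N) hp0 Vv.
have [Lv Ldv v0] := (Vc_P mD malpha v).1 Vv.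
move=> h; rewrite -(@ler_pXn2r _ 2)// ?nnegrE ?mulr_ge0 ?snorm_ge0 ?(ltW e0)//.
rewrite exprMn !sqr_snorm_ip//; last by apply: L2B => //; exact: L2_mesh_average.
apply: (le_trans h); rewrite ler_wpM2r ?ip_ge0// -/c.
rewrite ler_pdivrMr// mulrC -ler_pdivrMr ?exprn_gt0//.
exact/ltW/truncnS_gt.
Qed.

End finite_rank.

(** * The state equation *)

(** Transports completeness from the energy form to the form weighted by a parameter, to which Riesz
    is applied. *)
Lemma semi_complete_equiv {R : realType} {V : lmodType R} (S : V -> Prop)
    (B1 B2 : V -> V -> R) (a b : R) :
  semi_inner S B1 -> 0 < a -> 0 < b ->
  (forall u, S u -> a * snorm B1 u <= snorm B2 u <= b * snorm B1 u) ->
  semi_complete S B1 -> semi_complete S B2.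
Proof.
move=> S1 a0 b0 equiv cpl x Sx cauchy.
have [|y Sy xy] := cpl x Sx.
  move=> e e0; have [|N NP] := cauchy (a * e); first by rewrite mulr_gt0.
  exists N => k l Nk Nl; have := NP k l Nk Nl.
  have /andP[h _] := equiv _ (semi_innerB S1 (Sx k) (Sx l)).
  by move/(le_trans h); rewrite ler_pM2l.
exists y => // e e0; have [|N NP] := xy (e / b); first by rewrite divr_gt0.
exists N => k Nk; have /andP[_ h] := equiv _ (semi_innerB S1 (Sx k) Sy).
by apply: (le_trans h); rewrite mulrC -ler_pdivlMr// NP.
Qed.

Section kernel_cases.
Context {R : realType} {n : nat}.
Local Notation E := 'rV[R]_n.
Variables (Om : set E) (eps : R) (gamma : E -> E -> R).
Local Notation D := (total_domain Om eps).
Hypothesis eps0 : 0 < eps.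

Let powN (e : R) : 0 < e -> e `^ (- n%:R) * e ^+ n = 1.
Proof.
move=> e0; rewrite powRN powR_mulrn; last exact: ltW.
by rewrite mulVf// gt_eqF// exprn_gt0.
Qed.

(** Within the horizon [|y - x|^(-2s) >= eps^(-2s)], so the lower bound of case 1 implies one of the
    type of case 2, with constant [c1 / eps^(2s)]. *)
Lemma kernel_cases_coercive :
  kernel_case1 Om eps gamma \/ kernel_case2 Om eps gamma ->
  exists2 c0 : R, 0 < c0 & forall x y, D x -> D y -> x != y -> enorm (y - x) <= eps ->
    c0 <= gamma x y * enorm (y - x) ^+ n.
Proof.
case=> [[s [c1 [c2 [/andP[s0 _] c10 _ bnd]]]]|[c1 [c2 [c10 _ bnd]]]].
  exists (c1 * (eps `^ (2 * s))^-1); first by rewrite mulr_gt0// invr_gt0 powR_gt0.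
  move=> x y Dx Dy xy e_eps; have e0 := enorm_gt0 xy.
  have /andP[h _] := bnd x y Dx Dy xy e_eps.
  apply: (@le_trans _ _ (c1 * enorm (y - x) `^ (- (n%:R + 2 * s)) * enorm (y - x) ^+ n)).
    rewrite -mulrA ler_wpM2l ?(ltW c10)// opprD powRD; last by apply/implyP => _; rewrite gt_eqF.
    rewrite mulrAC powN// mul1r powRN lef_pV2 ?posrE ?powR_gt0//.
    by rewrite ge0_ler_powR ?nnegrE ?mulr_ge0 ?(ltW s0) ?(ltW e0) ?(ltW eps0).
  by rewrite ler_wpM2r// exprn_ge0// ltW.
exists c1 => // x y Dx Dy xy e_eps; have e0 := enorm_gt0 xy.
have /andP[h _] := bnd x y Dx Dy xy e_eps.
apply: (@le_trans _ _ (c1 * enorm (y - x) `^ (- n%:R) * enorm (y - x) ^+ n)).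
  by rewrite -mulrA powN// mulr1.
by rewrite ler_wpM2r// exprn_ge0// ltW.
Qed.

End kernel_cases.

Section state_equation.
Context {R : realType} {n : nat}.
Local Notation E := 'rV[R]_n.
Local Notation lambda := (lebesgue_rV n).
Local Notation mu2 := (lebesgue_rV n \x lebesgue_rV n)%E.
Variables (Om : set E) (eps : R) (alpha : E -> E -> E).
Local Notation D := (total_domain Om eps).
Local Notation U := (D `*` D).
Local Notation Vc := (Vc Om eps alpha).
Local Notation dip := (fun u v => ip mu2 U (delta alpha u) (delta alpha v)).

Hypothesis mD : measurable D.
Hypothesis malpha : measurable_fun U (fun z : E * E => alpha z.1 z.2).
Hypothesis Dfin : (lambda D < +oo)%E.
Variable Cp : R.
Hypothesis Cp0 : 0 <= Cp.
Hypothesis poincare : forall v, Vc v -> snorm (ip lambda D) v <= Cp * snorm dip v.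

Let mU : measurable U. Proof. exact: measurableX. Qed.

Let VcL2 v : Vc v -> L2 lambda D v.
Proof. by case/(Vc_P mD malpha). Qed.

Let VcL2d v : Vc v -> L2 mu2 U (delta alpha v).
Proof. by case/(Vc_P mD malpha). Qed.

Lemma Vc_semi_inner : semi_inner Vc dip.
Proof.
have [_ _ lin pos] := L2_semi_inner mu2 mU.
split.
- by move=> a u v Vu Vv; exact: Vc_comb.
- by move=> u v _ _; rewrite ipC.
- by move=> a u v w /VcL2d Lu /VcL2d Lv /VcL2d Lw; rewrite delta_comb lin.
- by move=> u _; exact: ip_ge0.
Qed.

Lemma VcB u v : Vc u -> Vc v -> Vc (u - v).
Proof. exact: (semi_innerB Vc_semi_inner). Qed.

(** A limit of the [delta (x k)] in L^2 of the product must still be recognised as the [delta] of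
    some function. Poincare makes [x] Cauchy in L^2, an a.e. convergent subsequence supplies that
    function [f], and Fatou on the product carries over the energy bounds. *)
Lemma Vc_complete : semi_complete Vc dip.
Proof.
move=> x Vx cauchy.
have cauchyL e : 0 < e -> exists N, forall k l, (N <= k)%N -> (N <= l)%N ->
    snorm (ip lambda D) (x k - x l) <= e.
  move=> e0; have [|N NP] := cauchy (e / (Cp + 1)); first by rewrite divr_gt0// ltr_wpDl.
  exists N => k l Nk Nl; apply: (le_trans (poincare (VcB (Vx k) (Vx l)))).
  apply: (@le_trans _ _ ((Cp + 1) * snorm dip (x k - x l))).
    by rewrite ler_wpM2r ?snorm_ge0// lerDl.
  by rewrite mulrC -ler_pdivlMr ?ltr_wpDl// NP.
have [s [ks [f mf xf]]] := L2_cauchy_subsequence mD Dfin (fun k => VcL2 (Vx k)) cauchyL.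
have xfd : {ae mu2, forall z, U z ->
    (fun k => delta alpha (x (s k)) z) @ \oo --> delta alpha f z}.
  have xf1 := ae_rect_fst lambda D xf.
  have xf2 := ae_rect_snd lambda D xf.
  apply: filterS2 xf1 xf2 => z x1 x2 Uz.
  apply: cvgM; last exact: cvg_cst.
  by apply: cvgB; [exact: x2|exact: x1].
have shift (u_ : nat -> R) N (l : R) : u_ @ \oo --> l -> (fun j => u_ (j + N)%N) @ \oo --> l.
  by rewrite -(cvg_shiftn N).
have sN N j : (N <= s (j + N))%N by apply: (leq_trans _ (ks _)); rewrite leq_addl.
have keyd e : 0 < e -> exists N, forall k, (N <= k)%N ->
    L2 mu2 U (delta alpha (x k - f)) /\ snorm dip (x k - f) <= e.
  move=> e0; have [N NP] := cauchy e e0; exists N => k Nk.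
  have [] := @L2_fatou _ _ _ mu2 U mU (fun j => delta alpha (x k - x (s (j + N)%N)))
    (delta alpha (x k - f)) (e ^+ 2).
  - by move=> j; apply: VcL2d; exact: VcB.
  - apply: measurable_delta => //; apply: measurable_funB => //.
    by case: (VcL2 (Vx k)).
  - apply: filterS xfd => z xfd Uz; rewrite deltaB.
    under eq_fun do rewrite deltaB.
    apply: cvgB; first exact: cvg_cst.
    exact: (shift (fun j => delta alpha (x (s j)) z) N _ (xfd Uz)).
  - move=> j; have Vd := VcB (Vx k) (Vx (s (j + N)%N)).
    rewrite -[leLHS](sqr_snorm Vc_semi_inner Vd).
    by rewrite ler_pXn2r ?nnegrE ?snorm_ge0 ?(ltW e0)//; exact: NP.
  move=> Ld le; split => //.
  rewrite -(@ler_pXn2r _ 2)// ?nnegrE ?snorm_ge0 ?(ltW e0)//.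
  by rewrite [leLHS]sqr_sqrtr ?ip_ge0.
have Lf : L2 lambda D f.
  have [N NP] := cauchyL 1 ltr01.
  have [] := @L2_fatou _ _ _ lambda D mD (fun j => x N - x (s (j + N)%N)) (x N - f) (1 ^+ 2).
  - by move=> j; apply: VcL2; exact: VcB.
  - by apply: measurable_funB => //; case: (VcL2 (Vx N)).
  - apply: filterS xf => z xf Dz; apply: cvgB; first exact: cvg_cst.
    exact: (shift (fun j => x (s j) z) N _ (xf Dz)).
  - move=> j; have Ld := VcL2 (VcB (Vx N) (Vx (s (j + N)%N))).
    rewrite -sqr_snorm_ip// ler_pXn2r ?nnegrE ?snorm_ge0//; exact: NP.
  by move=> Ld _; rewrite -[f](subKr (x N)); apply: L2B => //; exact: VcL2.
have Ldf : L2 mu2 U (delta alpha f).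
  have [N NP] := keyd 1 ltr01; have [Ld _] := NP N (leqnn _).
  by rewrite -[f](subKr (x N)) deltaB; apply: L2B => //; exact: VcL2d.
exists f; last by move=> e /keyd[N NP]; exists N => k /NP[].
apply/(Vc_P mD malpha); split => //.
have x0 : {ae lambda, forall y k, D y -> ~ Om y -> x k y = 0}.
  apply/ae_foralln => k; by case/(Vc_P mD malpha): (Vx k).
apply: filterS2 x0 xf => y x0 xf Dy nOy.
have := xf Dy; under eq_fun do rewrite x0//.
by move/cvg_lim => <-//; rewrite lim_cst.
Qed.

(** The dual norm is a supremum without absolute value over quotients; testing with [-1 *: v]
    restores the absolute value, and Poincare excludes a zero denominator when [v] is not a.e.
    zero. *)
Lemma Vc_dual_bound f : Vc_dual Om eps alpha f ->
  exists2 Mf : R, 0 <= Mf & forall v, Vc v -> `|f v| <= Mf * snorm dip v.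
Proof.
move=> [fae flin ffin].
have V0 := Vc0 mD malpha.
have f0 : f 0 = 0.
  have := flin (-1) 0 0 V0 V0; rewrite (_ : (fun x => _) = 0); last first.
    by apply/funext => x; rewrite mulr0 addr0.
  by move=> ->; rewrite mulN1r addNr.
have fZ a v : Vc v -> f (a *: v) = a * f v.
  move=> Vv; have := flin a v 0 Vv V0; rewrite f0 addr0 => <-; congr f.
  by apply/funext => x; rewrite /= addr0.
(* If every element of [Vc] vanished a.e., the supremum would be over the empty set, hence -oo. *)
pose m := maxe 0%E (Vc_dual_norm Om eps alpha f).
have m0 : (0 <= m)%E by rewrite le_max lexx.
have mfin : m \is a fin_num by rewrite ge0_fin_numE// gt_max ltry.
have upper v : Vc v -> f v <= fine m * snorm dip v.
  move=> Vv; have [v0|nv0] := pselect (ae_eq lambda D v (cst 0)).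
    by rewrite (fae v 0)// f0 mulr_ge0 ?snorm_ge0 ?fine_ge0.
  have nv : 0 < snorm dip v.
    rewrite lt_neqAle snorm_ge0 andbT eq_sym; apply/negP => /eqP sv; apply: nv0.
    have := poincare Vv; rewrite sv mulr0 => sv0.
    apply: (ip_eq0_ae mD (VcL2 Vv)); rewrite -sqr_snorm_ip//; last exact: VcL2.
    by rewrite (_ : snorm _ v = 0) ?expr0n//; apply/eqP; rewrite eq_le sv0 snorm_ge0.
  rewrite -ler_pdivrMr// -lee_fin fineK// /m le_max; apply/orP; right.
  apply: ereal_sup_ubound; exists v; first by split.
  by rewrite (energy_normE mD malpha)//; case: Vv.
exists (fine m); first exact: fine_ge0.
move=> v Vv; rewrite ler_norml; apply/andP; split; last exact: upper.
have VN : Vc (-1 *: v) by apply: (semi_innerZ Vc_semi_inner).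
have := upper _ VN; rewrite fZ// (snormZ Vc_semi_inner)// normrN normr1 mul1r mulN1r.
by rewrite lerNl.
Qed.

Section parameter.
Variables (th : E * E -> R) (th0 th1 : R).
Hypotheses (mth : measurable_fun U th) (th00 : 0 < th0).
Hypothesis thb : {ae mu2, forall z, U z -> th0 <= th z <= th1}.

Let th10 : 0 < `|th1| + 1. Proof. by rewrite ltr_wpDl. Qed.

(** Taking [|th1| + 1] provides a positive bound whatever the sign of [th1]. *)
Lemma parameter_norm : {ae mu2, forall z, U z -> `|th z| <= `|th1| + 1}.
Proof.
apply: filterS thb => z h Uz; have /andP[h0 h1] := h Uz.
have t0 := lt_le_trans th00 h0; rewrite (gtr0_norm t0).
by apply: (le_trans h1); rewrite (le_trans (ler_norm _))// lerDl.
Qed.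

Let Lth v : Vc v -> L2 mu2 U (th \* delta alpha v).
Proof. by move=> /VcL2d; exact: (L2_bmul mU mth parameter_norm). Qed.

Local Notation B := (Bform Om eps alpha th).

Lemma Bform_coercive v : Vc v -> th0 * dip v v <= B v v <= (`|th1| + 1) * dip v v.
Proof.
move=> Vv; have Lv := VcL2d Vv; have i1 := L2_mul mU (Lth Vv) Lv.
have i2 := L2_mul mU Lv Lv.
have iZ a : mu2.-integrable U (EFin \o (fun z => a * (delta alpha v z * delta alpha v z))).
  by have := integrableZl mU a i2.
rewrite /Bform /ip -!RintegralZl//; apply/andP; split; apply: ae_le_Rintegral => //.
  apply: filterS thb => z h Uz; have /andP[h0 _] := h Uz.
  by rewrite /= -mulrA ler_wpM2r// -expr2 sqr_ge0.
apply: filterS parameter_norm => z h Uz.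
rewrite /= -mulrA ler_wpM2r ?(le_trans (ler_norm _) (h Uz))// -expr2 sqr_ge0//.
Qed.

Lemma Bform_semi_inner : semi_inner Vc B.
Proof.
have [_ _ lin _] := L2_semi_inner mu2 mU.
split.
- by move=> a u v Vu Vv; exact: Vc_comb.
- by move=> u v _ _; apply: eq_Rintegral => z _; rewrite /= mulrAC.
- move=> a u v w Vu Vv Vw; rewrite /Bform delta_comb.
  rewrite -lin//; [|exact: Lth|exact: Lth|exact: VcL2d].
  by apply: eq_Rintegral => z _; rewrite !fct_combE /= fct_combE; ring.
- move=> v Vv; have /andP[h _] := Bform_coercive Vv; apply: le_trans h.
  by rewrite mulr_ge0 ?ip_ge0// ltW.
Qed.

Lemma Bform_norm v : Vc v ->
  Num.sqrt th0 * snorm dip v <= snorm B v <= Num.sqrt (`|th1| + 1) * snorm dip v.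
Proof.
move=> Vv; have /andP[h1 h2] := Bform_coercive Vv.
have Bv : 0 <= B v v by case: Bform_semi_inner => _ _ _; apply.
rewrite /snorm -!sqrtrM ?(ltW th00) ?(ltW th10)//.
by apply/andP; split; rewrite ler_wsqrtr.
Qed.

(** The weighted form is symmetric, so Riesz applies to it directly; coercivity turns the bound [Mf]
    into [Mf / sqrt th0] for the weighted seminorm. *)
Lemma weak_form_solvable f : Vc_dual Om eps alpha f ->
  exists2 u, Vc u & forall v, Vc v -> B u v = f v.
Proof.
move=> df; have [Mf Mf0 fM] := Vc_dual_bound df.
apply: (@riesz_representation _ _ _ _ Bform_semi_inner f (Mf / Num.sqrt th0)).
- by exists 0; exact: Vc0.
- apply: (semi_complete_equiv Vc_semi_inner _ _ Bform_norm Vc_complete).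
  + by rewrite sqrtr_gt0.
  + by rewrite sqrtr_gt0.
- by case: df => _ flin _ a u v Vu Vv; rewrite -flin.
- move=> v Vv; apply: (le_trans (fM v Vv)); rewrite -mulrA ler_wpM2l//.
  by rewrite mulrC ler_pdivlMr ?sqrtr_gt0// mulrC; have /andP[] := Bform_norm Vv.
Qed.

Lemma weak_form_unique u u' : Vc u -> Vc u' ->
  (forall v, Vc v -> B u v = B u' v) -> ae_eq lambda D u' u.
Proof.
move=> Vu Vu' BB; have Vd := VcB Vu' Vu.
have B0 : B (u' - u) (u' - u) = 0.
  rewrite addrC -scaleN1r; have [_ _ lin _] := Bform_semi_inner.
  by rewrite lin// ?BB ?mulN1r ?addNr// scaleN1r addrC.
have /andP[h _] := Bform_norm Vd.
have d0 : snorm dip (u' - u) <= 0.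
  by move: h; rewrite /snorm B0 sqrtr0 pmulr_rle0 ?sqrtr_gt0.
have L0 : snorm (ip lambda D) (u' - u) = 0.
  apply/eqP; rewrite eq_le snorm_ge0 andbT; apply: (le_trans (poincare Vd)).
  by rewrite mulr_ge0_le0.
have := ip_eq0_ae mD (VcL2 Vd); rewrite -sqr_snorm_ip ?L0 ?expr0n//; last exact: VcL2.
move=> /(_ (lexx _)); apply: filterS => x ux Dx; apply/eqP; rewrite -subr_eq0.
by apply/eqP; exact: ux.
Qed.

End parameter.
End state_equation.

(** * Tails, essential bounds and increments *)

Section L2_tail.
Context d (T : measurableType d) (R : realType).
Variables (mu : {measure set T -> \bar R}) (A : set T).
Hypothesis mA : measurable A.

Lemma measurable_lt_indicator (g : T -> R) (a : R) : measurable_fun A g ->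
  measurable_fun A (fun x => (a < g x)%R%:R : R).
Proof.
move=> mg; have mi : measurable_fun setT (fun b : bool => b%:R : R).
  rewrite (_ : (fun b => _) = \1_[set true]); first exact: measurable_indic.
  by apply/funext => -[]; rewrite indicE; [rewrite mem_set|rewrite memNset].
have mb : measurable_fun A (fun x => a < g x : bool).
  by apply: (@measurable_fun_ltr _ _ _ _ (cst a)) => //; exact: measurable_cst.
exact: (measurableT_comp mi mb).
Qed.

Lemma L2_truncation (g : T -> R) (h : T -> R) : measurable_fun A g -> L2 mu A h ->
  forall e, 0 < e -> exists m : nat,
    snorm (ip mu A) ((fun x => (m%:R < g x)%R%:R) \* h) <= e.
Proof.
move=> mg Lh e e0; pose t (m : nat) x : R := (m%:R < g x)%R%:R.
have t01 m x : 0 <= t m x <= 1 by rewrite /t; case: (_ < _) => /=; rewrite ?lexx ?ler01.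
have mt m : measurable_fun A (t m).
  exact: measurable_lt_indicator.
have tb m : {ae mu, forall x, A x -> `|t m x| <= 1}.
  by apply: aeW => x _; have /andP[h0 h1] := t01 m x; rewrite ger0_norm.
have Lt m : L2 mu A (t m \* h) by exact: (L2_bmul mA (mt m) (tb m) Lh).
have [|||||_ _] := @dominated_convergence _ _ R mu A mA
  (fun m x => ((t m x * h x) ^+ 2)%:E) (cst 0%E) (fun x => (h x ^+ 2)%:E).
- by move=> m; apply/measurable_EFinP; apply: measurable_funX; case: (Lt m).
- exact: measurable_cst.
- apply: aeW => x _; apply: cvg_near_cst; near=> m.
  rewrite /t (_ : m%:R < g x = false) ?mul0r ?expr0n//.
  apply/negbTE; rewrite -leNgt.
  apply: (@le_trans _ _ (Num.truncn `|g x|).+1%:R).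
    by apply: (le_trans (ler_norm _)); exact/ltW/truncnS_gt.
  by rewrite ler_nat; near: m; exact: nbhs_infty_ge.
- by case: Lh.
- apply: aeW => x m _; rewrite abse_EFin lee_fin ger0_norm ?sqr_ge0// exprMn.
  by have /andP[h0 h1] := t01 m x; rewrite ler_piMl ?sqr_ge0// exprn_ile1.
rewrite integral0 => /fine_cvgP[_ cvg].
have /cvgr0_norm_le : (fun m => ip mu A (t m \* h) (t m \* h)) @ \oo --> (0 : R).
  rewrite (_ : (fun m => _) = fine \o (fun m => (\int[mu]_(x in A) ((t m x * h x) ^+ 2)%:E)%E)).
    exact: cvg.
  by apply/funext => m; rewrite ip_sqr.
move=> /(_ (e ^+ 2)); rewrite exprn_gt0// => /(_ isT)/filter_ex[m hm].
exists m; rewrite -(@ler_pXn2r _ 2)// ?nnegrE ?snorm_ge0 ?(ltW e0)//.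
by rewrite [leLHS](sqr_snorm_ip mA (Lt m)); apply: le_trans hm; exact: ler_norm.
Unshelve. all: by end_near. Qed.

End L2_tail.

Section essential_bounds.
Context {R : realType} {n : nat}.
Local Notation E := ('rV[R]_n * 'rV[R]_n)%type.
Local Notation mu2 := (lebesgue_rV n \x lebesgue_rV n)%E.

Lemma Loo_norm_leP (U : set E) (f : E -> R) (c : R) : 0 <= c ->
  (Loo_norm U f <= c%:E)%E <-> {ae mu2, forall z, U z -> `|f z| <= c}.
Proof.
move=> c0; have fE : {ae mu2, forall z, U z -> `|f z| <= c} <->
    {ae mu2, forall z, (abse ((EFin \o (f \_ U)) z) <= c%:E)%E}.
  split; apply: filterS => z /=; rewrite lee_fin patchE.
    by move=> h; case: ifPn => [/set_mem/h//|_]; rewrite normr0.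
  by move=> h Uz; rewrite mem_set in h.
rewrite fE /Loo_norm unlock; case: ifPn => [_|/negP h].
  by split => /ess_supP.
(* On a null space the norm is 0 by convention, and every a.e. statement holds. *)
split => [_|_]; last by rewrite lee_fin.
apply: measure0_ae; apply/eqP; rewrite eq_le measure_ge0 andbT leNgt; exact/negP.
Qed.

End essential_bounds.

Section swap.
Context d (T : measurableType d) (R : realType) (m : {sigma_finite_measure set T -> \bar R}).
Variable A : set T.
Hypothesis mA : measurable A.
Local Notation U := (A `*` A).

Let mU : measurable U. Proof. exact: measurableX. Qed.

Let sw (z : T * T) := (z.2, z.1).

Lemma measurable_fun_swap d' (T' : measurableType d') (f : T * T -> T') :
  measurable_fun U f -> measurable_fun U (fun z => f (z.2, z.1)).
Proof.
move=> mf; apply: (measurable_comp mU (g := sw) _ mf); first by move=> _ [z [? ?] <-].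
apply: measurable_funTS; apply/measurable_fun_pairP; split.
- exact: measurable_snd.
- exact: measurable_fst.
Qed.

Lemma L2_swap (f : T * T -> R) : L2 (m \x m)%E U f -> L2 (m \x m)%E U (fun z => f (z.2, z.1)).
Proof.
move=> [mf fi]; have mfs := measurable_fun_swap mf; split => //.
have mfs2 : measurable_fun U (fun z => (f (z.2, z.1) ^+ 2)%:E).
  by apply/measurable_EFinP; exact: measurable_funX.
apply/integrableP; split => //.
under eq_integral do rewrite gee0_abs ?lee_fin ?sqr_ge0//.
rewrite tonelli_rect//; last by move=> z _; rewrite lee_fin sqr_ge0.
have := integrable_lty mU fi; rewrite fubini_rect2//.
Qed.

(** Moves the exchange of variables onto the test function, so that it commutes with weak limits. *)
Lemma ip_swap (f g : T * T -> R) : L2 (m \x m)%E U f -> L2 (m \x m)%E U g ->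
  ip (m \x m)%E U (fun z => f (z.2, z.1)) g = ip (m \x m)%E U f (fun z => g (z.2, z.1)).
Proof.
move=> Lf Lg; have i1 := L2_mul mU (L2_swap Lf) Lg; have i2 := L2_mul mU Lf (L2_swap Lg).
rewrite /ip /Rintegral; congr fine.
by rewrite [LHS]fubini_rect1// [RHS]fubini_rect2.
Qed.

End swap.

Section bounded_domain.
Context {R : realType} {n : nat}.
Local Notation E := 'rV[R]_n.
Local Notation lambda := (lebesgue_rV n).
Local Notation mu2 := (lebesgue_rV n \x lebesgue_rV n)%E.
Variable D : set E.
Hypotheses (mD : measurable D) (bD : bounded_set D).
Local Notation U := (D `*` D).

Let Dfin : (lambda D < +oo)%E. Proof. exact: lebesgue_rV_bounded. Qed.

Let mU : measurable U. Proof. exact: measurableX. Qed.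

Lemma lebesgue_square_fin : (mu2 U < +oo)%E.
Proof.
by rewrite product_measure1E// lte_mul_pinfty// ge0_fin_numE.
Qed.

(** Makes test functions and their derivatives admissible in weak convergence: they are bounded on a
    compact box containing the domain. *)
Lemma L2_continuous (F : E * E -> R) : continuous F -> L2 mu2 U F.
Proof.
move=> cF; have [M M0 DM] := bounded_set_rV bD.
pose K := [set x : E | forall i, `[- M, M]%classic (x ord0 i)].
have cK : compact (K `*` K).
  by apply: compact_setX; apply: (@rV_compact R n (fun=> `[- M, M]%classic)) => i;
    exact: segment_compact.
have DK x : D x -> K x by move=> Dx i; rewrite /= in_itv/= -ler_norml ltW// DM.
have : bounded_set (F @` (K `*` K)).
  by apply: compact_bounded; apply: continuous_compact => //; exact: continuous_subspaceT.
move=> [B [_ BF]]; apply: (@L2_bounded _ _ _ mu2 U mU lebesgue_square_fin (`|B| + 1)).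
  by apply: measurable_funTS; exact: continuous_measurable_rV_prod.
apply: aeW => z [Dz1 Dz2]; apply: BF; first by rewrite ltr_pwDr// ler_norm.
by exists z => //; split; exact: DK.
Qed.

(** [delta] without its kernel factor; its norm is controlled by the L^2 norm of [v] alone. *)
Definition increment (v : E -> R) (z : E * E) : R := v z.2 - v z.1.

Lemma L2_fst_snd (v : E -> R) : L2 lambda D v ->
  [/\ L2 mu2 U (v \o fst), L2 mu2 U (v \o snd),
      snorm (ip mu2 U) (v \o fst) = Num.sqrt (fine (lambda D)) * snorm (ip lambda D) v &
      snorm (ip mu2 U) (v \o snd) = Num.sqrt (fine (lambda D)) * snorm (ip lambda D) v].
Proof.
move=> Lv; case: (Lv) => mv vi.
have mv2 : measurable_fun D (fun x => (v x ^+ 2)%:E).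
  by apply/measurable_EFinP; exact: measurable_funX.
have v20 x : D x -> (0 <= (v x ^+ 2)%:E)%E by rewrite lee_fin sqr_ge0.
have i1 := integral_rect_fst lambda lambda mD mD mv2 v20.
have i2 := integral_rect_snd lambda lambda mD mD mv2 v20.
have vE : (\int[lambda]_(x in D) (v x ^+ 2)%:E = (ip lambda D v v)%:E)%E.
  by rewrite ip_sqr /Rintegral fineK//; exact: integrable_fin_num.
have DE : lambda D = (fine (lambda D))%:E by rewrite fineK// ge0_fin_numE.
have sq (f : E * E -> R) : measurable_fun U f ->
    (\int[mu2]_(z in U) (f z ^+ 2)%:E = lambda D * \int[lambda]_(x in D) (v x ^+ 2)%:E)%E ->
    L2 mu2 U f /\ snorm (ip mu2 U) f = Num.sqrt (fine (lambda D)) * snorm (ip lambda D) v.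
  move=> mf; rewrite vE DE -EFinM => fE.
  have Lf : L2 mu2 U f.
    split => //; apply/integrableP; split.
      by apply/measurable_EFinP; exact: measurable_funX.
    under eq_integral do rewrite gee0_abs ?lee_fin ?sqr_ge0//.
    by rewrite [X in (X < _)%E]fE ltry.
  have D0 : 0 <= fine (lambda D) by apply: fine_ge0; exact: measure_ge0.
  split => //; rewrite /snorm -sqrtrM//; congr (Num.sqrt _).
  by rewrite ip_sqr /Rintegral fE.
have [L1 s1] := sq _ (measurable_fun_rect_fst mD mv) i1.
by have [L2' s2] := sq _ (measurable_fun_rect_snd mD mv) i2; split.
Qed.

Lemma L2_increment (v : E -> R) : L2 lambda D v -> L2 mu2 U (increment v) /\
  snorm (ip mu2 U) (increment v) <= 2 * Num.sqrt (fine (lambda D)) * snorm (ip lambda D) v.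
Proof.
move=> /L2_fst_snd[L1 L2' s1 s2].
rewrite (_ : increment v = (fun z : E * E => v z.2) - (fun z : E * E => v z.1))//; split; first exact: L2B.
apply: (le_trans (snormB (L2_semi_inner mu2 mU) L2' L1)).
by rewrite s1 s2 -mulrA mulr_natl mulr2n.
Qed.

End bounded_domain.

(** * Passing to the limit in the parameter *)

Section strong_convergence.
Context {R : realType} {n : nat}.
Local Notation E := 'rV[R]_n.
Local Notation lambda := (lebesgue_rV n).
Local Notation mu2 := (lebesgue_rV n \x lebesgue_rV n)%E.
Variables (Om : set E) (eps : R) (alpha : E -> E -> E).
Local Notation D := (total_domain Om eps).
Local Notation U := (D `*` D).
Local Notation Vc := (Vc Om eps alpha).
Local Notation dip := (fun u v => ip mu2 U (delta alpha u) (delta alpha v)).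

Hypotheses (mD : measurable D) (bD : bounded_set D).
Hypothesis malpha : measurable_fun U (fun z : E * E => alpha z.1 z.2).
Variable Cp : R.
Hypothesis Cp0 : 0 <= Cp.
Hypothesis poincare : forall v, Vc v -> snorm (ip lambda D) v <= Cp * snorm dip v.
Hypothesis approx : forall e, 0 < e ->
  exists (I : finType) (w : I -> R) (Q : I -> set E), (forall i, measurable (Q i)) /\
  forall v, Vc v ->
    snorm (ip lambda D) (v - fun x => \sum_i w i * ip lambda D \1_(Q i) v * \1_(Q i) x) <=
    e * snorm dip v.

Let mU : measurable U. Proof. exact: measurableX. Qed.
Let Dfin : (lambda D < +oo)%E. Proof. exact: lebesgue_rV_bounded. Qed.
Let Ufin : (mu2 U < +oo)%E. Proof. exact: lebesgue_square_fin. Qed.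

Variables (Ul : set_system nat) (UU : UltraFilter Ul).
Let UP : ProperFilter Ul := ultra_proper.

Let Dc : R := 2 * Num.sqrt (fine (lambda D)).

(* The form [u |-> <G k (delta u), delta (w k)>] is split along a large level set of the
   kernel, where [u] has little energy; where the kernel is bounded, [w k] may be replaced
   by its finite rank approximation, for which the weak convergence of [G] suffices. *)
Lemma weak_strong_product (G : nat -> E * E -> R) (w : nat -> E -> R) (u : E -> R) (T B : R) :
  0 <= T -> 0 <= B ->
  (forall k, measurable_fun U (G k)) -> (forall k, {ae mu2, forall z, U z -> `|G k z| <= T}) ->
  weakly_to mu2 U Ul G 0 ->
  Vc u -> (forall k, Vc (w k)) -> (forall k, snorm dip (w k) <= B) ->
  forall e, 0 < e ->
    \forall k \near Ul, `|ip mu2 U (G k \* delta alpha u) (delta alpha (w k))| <= e.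
Proof.
move=> T0 B0 mG GT G0 Vu Vw wB e e0.
have SI := L2_semi_inner mu2 mU.
have [Lu Ldu _] := (Vc_P mD malpha u).1 Vu.
have Lw k : L2 lambda D (w k) by case/(Vc_P mD malpha): (Vw k).
have Ldw k : L2 mu2 U (delta alpha (w k)) by case/(Vc_P mD malpha): (Vw k).
have e30 : 0 < e / 3 by rewrite divr_gt0.
(* The tolerance is such that the far part, with [G] bounded by [T] and the energy of [w] by [B],
   contributes at most [e / 3]. *)
have [|m um] := L2_truncation mU (measurable_gker malpha) Ldu (e := e / 3 / (T * B + 1)).
  by rewrite divr_gt0// ltr_wpDl// mulr_ge0.
pose far z : R := (m%:R < gker alpha z)%R%:R.
(* A full kernel factor is kept on the side of [u], bounded by [m] off the far set, so the other
   side is the plain increment of [w k]. *)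
pose H z : R := (1 - far z) * gker alpha z * increment u z.
have mfar : measurable_fun U far.
  by apply: measurable_lt_indicator; exact: measurable_gker.
have far01 z : 0 <= far z <= 1 by rewrite /far; case: (_ < _) => /=; rewrite ?lexx ?ler01.
have farb : {ae mu2, forall z, U z -> `|far z| <= 1}.
  by apply: aeW => z _; have /andP[h0 h1] := far01 z; rewrite ger0_norm.
have Lfu : L2 mu2 U (far \* delta alpha u) by exact: (L2_bmul mU mfar farb Ldu).
have [Ldiff _] := L2_increment mD bD Lu.
have mnear : measurable_fun U (fun z => (1 - far z) * gker alpha z).
  apply: measurable_funM; last exact: measurable_gker.
  by apply: measurable_funB => //; exact: measurable_cst.
have nearb : {ae mu2, forall z, U z -> `|(1 - far z) * gker alpha z| <= m%:R}.
  apply: aeW => z _; rewrite /far; case: ltP => /= gm; first by rewrite subrr mul0r normr0.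
  by rewrite subr0 mul1r ger0_norm// gker_ge0.
have LH : L2 mu2 U H by exact: (L2_bmul mU mnear nearb Ldiff).
have Dc0 : 0 <= Dc by rewrite /Dc mulr_ge0 ?sqrtr_ge0.
pose S := T * snorm (ip mu2 U) H * Dc * B.
have S0 : 0 <= S by rewrite /S !mulr_ge0 ?snorm_ge0.
(* [S] collects all factors multiplying the approximation error, which therefore costs at most
   [e / 3]. *)
have [|I [c [Q [mQ Aw]]]] := approx (e := e / 3 / (S + 1)).
  by rewrite divr_gt0// ltr_wpDl.
pose A k x : R := \sum_i c i * ip lambda D \1_(Q i) (w k) * \1_(Q i) x.
have LQ i : L2 lambda D \1_(Q i) by exact: L2_indic.
have LA k : L2 lambda D (A k).
  by have [] := ip_sum mD (index_enum I) (fun i => c i * ip lambda D \1_(Q i) (w k))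
    LQ (L2_0 lambda D).
have LGH k : L2 mu2 U (G k \* H) by exact: (L2_bmul mU (mG k) (GT k) LH).
have LHQ i : L2 mu2 U (H \* increment \1_(Q i)).
  rewrite (_ : H \* _ = increment \1_(Q i) \* H); last by apply/funext => z /=; rewrite mulrC.
  have [[mdQ _] _] := L2_increment mD bD (LQ i).
  apply: (L2_bmul (M := 1) mU mdQ _ LH); apply: aeW => z _.
  rewrite /increment !indicE; case: (_ \in _); case: (_ \in _);
    by rewrite /= ?subrr ?subr0 ?sub0r ?normrN ?normr1 ?normr0.
(* Far part, near part against the approximation error, near part against the approximation; in the
   last, [G k] is paired with finitely many functions independent of [k]. *)
have split3 k : ip mu2 U (G k \* delta alpha u) (delta alpha (w k)) =
    ip mu2 U (G k \* (far \* delta alpha u)) (delta alpha (w k)) +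
    (ip mu2 U (G k \* H) (increment (w k - A k)) +
     \sum_i c i * ip lambda D \1_(Q i) (w k) * ip mu2 U (G k) (H \* increment \1_(Q i))).
  have LdA : L2 mu2 U (increment (A k)) by have [] := L2_increment mD bD (LA k).
  have LdwA : L2 mu2 U (increment (w k - A k)) by have [] := L2_increment mD bD (L2B mD (Lw k) (LA k)).
  have LGf : L2 mu2 U (G k \* (far \* delta alpha u)) by exact: (L2_bmul mU (mG k) (GT k) Lfu).
  have LdQ i : L2 mu2 U (increment \1_(Q i)) by have [] := L2_increment mD bD (LQ i).
  have -> : \sum_i c i * ip lambda D \1_(Q i) (w k) * ip mu2 U (G k) (H \* increment \1_(Q i)) =
      ip mu2 U (increment (A k)) (G k \* H).
    have [_ h] := ip_sum mU (index_enum I) (fun i => c i * ip lambda D \1_(Q i) (w k))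
      LdQ (LGH k).
    rewrite [RHS](_ : _ = \sum_i c i * ip lambda D \1_(Q i) (w k) *
      ip mu2 U (increment \1_(Q i)) (G k \* H)).
      apply: eq_bigr => i _; congr (_ * _).
      by apply: eq_Rintegral => z _ /=; ring.
    rewrite -h; apply: eq_Rintegral => z _; congr (_ * _).
    by rewrite /increment /A -sumrB; apply: eq_bigr => i _; rewrite -mulrBr.
  rewrite (ipC _ _ (increment (A k))) /ip -RintegralD//; [|exact: L2_mul|exact: L2_mul].
  rewrite -RintegralD//; [|exact: L2_mul|]; last first.
    have := L2_mul mU (LGH k) (L2D mU LdwA LdA); apply: eq_integrable => // z _ /=.
    by rewrite -mulrDr.
  apply: eq_Rintegral => z _ /=.
  rewrite -mulrDr (_ : increment (w k - A k) z + increment (A k) z = increment (w k) z); last first.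
    by rewrite /increment (_ : (w k - A k) z.2 = w k z.2 - A k z.2)//
      (_ : (w k - A k) z.1 = w k z.1 - A k z.1)//; ring.
  have dd := deltaM alpha u (w k) z.
  rewrite -[G k z * H z * _]mulrA (_ : H z * increment (w k) z = (1 - far z) * (delta alpha u z * delta alpha (w k) z)).
    by ring.
  by rewrite dd /H /increment; ring.
have part1 k : `|ip mu2 U (G k \* (far \* delta alpha u)) (delta alpha (w k))| <= e / 3.
  have LGf : L2 mu2 U (G k \* (far \* delta alpha u)) by exact: (L2_bmul mU (mG k) (GT k) Lfu).
  apply: (le_trans (snorm_CS SI LGf (Ldw k))).
  apply: (@le_trans _ _ (T * (e / 3 / (T * B + 1)) * B)).
    apply: ler_pM; rewrite ?snorm_ge0 ?wB//.
    apply: (le_trans (snorm_bmul mU T0 (mG k) (GT k) Lfu)).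
    by rewrite ler_wpM2l.
  have TB : 0 <= T * B by rewrite mulr_ge0.
  rewrite (_ : _ * B = e / 3 * (T * B / (T * B + 1))); last by field; rewrite gt_eqF// ltr_wpDl.
  by rewrite ler_piMr ?(ltW e30)// ler_pdivrMr ?ltr_wpDl// mul1r lerDl.
have part2 k : `|ip mu2 U (G k \* H) (increment (w k - A k))| <= e / 3.
  have LwA := L2B mD (Lw k) (LA k).
  have [LdA dA] := L2_increment mD bD LwA.
  apply: (le_trans (snorm_CS SI (LGH k) LdA)).
  apply: (@le_trans _ _ (T * snorm (ip mu2 U) H * (Dc * (e / 3 / (S + 1) * B)))).
    apply: ler_pM; rewrite ?snorm_ge0//.
      exact: (snorm_bmul mU T0 (mG k) (GT k) LH).
    apply: (le_trans dA); rewrite ler_wpM2l//.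
    apply: (le_trans (Aw _ (Vw k))); rewrite ler_wpM2l ?wB//.
    by rewrite divr_ge0 ?(ltW e30)// addr_ge0.
  rewrite (_ : _ * (Dc * _) = e / 3 * (S / (S + 1))); last first.
    by rewrite /S; field; rewrite -/S gt_eqF// ltr_wpDl.
  by rewrite ler_piMr ?(ltW e30)// ler_pdivrMr ?ltr_wpDl// mul1r lerDl.
(* Poincare bounds the coefficients [ip lambda D \1_(Q i) (w k)] uniformly in [k]. *)
pose b i := `|c i| * (snorm (ip lambda D) \1_(Q i) * (Cp * B)).
have part3 : \forall k \near Ul, \sum_i b i * `|ip mu2 U (G k) (H \* increment \1_(Q i))| <= e / 3.
  have : (fun k => \sum_i b i * `|ip mu2 U (G k) (H \* increment \1_(Q i))|) @ Ul --> (0 : R).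
    rewrite [X in _ --> X](_ : _ = \sum_(i : I) b i * `|0 : R|); last first.
      by rewrite big1// => i _; rewrite normr0 mulr0.
    apply: (cvg_big (@add_continuous R)) => i _.
    apply: cvgMr; apply: cvg_norm.
    have := G0 _ (LHQ i); rewrite [X in _ --> X -> _](_ : _ = 0)//.
    rewrite /ip; under eq_Rintegral do rewrite mul0r.
    by rewrite Rintegral_cst// mul0r.
  move/cvgr0_norm_le => /(_ _ e30); apply: filterS => k; apply: le_trans; exact: ler_norm.
apply: filterS part3 => k p3; rewrite split3.
apply: (le_trans (ler_normD _ _)); have := part1 k.
have := ler_normD (ip mu2 U (G k \* H) (increment (w k - A k)))
  (\sum_i c i * ip lambda D \1_(Q i) (w k) * ip mu2 U (G k) (H \* increment \1_(Q i))).
have := part2 k.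
suff : `|\sum_i c i * ip lambda D \1_(Q i) (w k) * ip mu2 U (G k) (H \* increment \1_(Q i))| <= e / 3.
  lra.
apply: le_trans p3; apply: (le_trans (ler_norm_sum _ _ _)); apply: ler_sum => i _.
rewrite !normrM ler_wpM2r// /b ler_wpM2l//.
apply: (le_trans (snorm_CS (L2_semi_inner lambda mD) (LQ i) (Lw k))).
rewrite ler_wpM2l ?snorm_ge0//; apply: (le_trans (poincare (Vw k))).
by rewrite ler_wpM2l ?wB.
Qed.

End strong_convergence.

Section solution_convergence.
Context {R : realType} {n : nat}.
Local Notation E := 'rV[R]_n.
Local Notation lambda := (lebesgue_rV n).
Local Notation mu2 := (lebesgue_rV n \x lebesgue_rV n)%E.
Variables (Om : set E) (eps : R) (alpha : E -> E -> E).
Local Notation D := (total_domain Om eps).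
Local Notation U := (D `*` D).
Local Notation Vc := (Vc Om eps alpha).
Local Notation dip := (fun u v => ip mu2 U (delta alpha u) (delta alpha v)).

Hypotheses (mD : measurable D) (bD : bounded_set D).
Hypothesis malpha : measurable_fun U (fun z : E * E => alpha z.1 z.2).
Variable Cp : R.
Hypothesis Cp0 : 0 <= Cp.
Hypothesis poincare : forall v, Vc v -> snorm (ip lambda D) v <= Cp * snorm dip v.
Hypothesis approx : forall e, 0 < e ->
  exists (I : finType) (w : I -> R) (Q : I -> set E), (forall i, measurable (Q i)) /\
  forall v, Vc v ->
    snorm (ip lambda D) (v - fun x => \sum_i w i * ip lambda D \1_(Q i) v * \1_(Q i) x) <=
    e * snorm dip v.

Let mU : measurable U. Proof. exact: measurableX. Qed.
Let Dfin : (lambda D < +oo)%E. Proof. exact: lebesgue_rV_bounded. Qed.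
Let Ufin : (mu2 U < +oo)%E. Proof. exact: lebesgue_square_fin. Qed.

Variables (Ul : set_system nat) (UU : UltraFilter Ul).
Let UP : ProperFilter Ul := ultra_proper.

Variables (th0 th1 : R) (th00 : 0 < th0).

Definition parameter_bounds (th : E * E -> R) : Prop :=
  measurable_fun U th /\ {ae mu2, forall z, U z -> th0 <= th z <= th1}.

Lemma solutions_converge (th_ : nat -> E * E -> R) (th : E * E -> R)
    (f : (E -> R) -> R) (u_ : nat -> E -> R) (u : E -> R) :
  (forall k, parameter_bounds (th_ k)) -> parameter_bounds th ->
  weakly_to mu2 U Ul th_ th -> Vc_dual Om eps alpha f ->
  (forall k, Vc (u_ k)) -> Vc u ->
  (forall k v, Vc v -> Bform Om eps alpha (th_ k) (u_ k) v = f v) ->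
  (forall v, Vc v -> Bform Om eps alpha th u v = f v) ->
  forall e, 0 < e -> \forall k \near Ul, snorm dip (u_ k - u) <= e.
Proof.
move=> th_P thP th_th df Vu_ Vu u_f uf e e0.
have SI := L2_semi_inner mu2 mU.
have SV := Vc_semi_inner mD malpha.
have [Mf Mf0 fM] := Vc_dual_bound mD malpha poincare df.
(* A priori bound: testing the equation with [v] itself gives
   [th0 * |||v|||^2 <= f v <= Mf * |||v|||]. *)
have bnd t v : parameter_bounds t -> Vc v ->
    (forall w, Vc w -> Bform Om eps alpha t v w = f w) -> snorm dip v <= Mf / th0.
  move=> [mt tb] Vv vf.
  have /andP[h _] := Bform_coercive mD malpha mt th00 tb Vv.
  rewrite ler_pdivlMr//; have := snorm_ge0 dip v; rewrite le_eqVlt => /predU1P[<-|v0].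
    by rewrite mul0r.
  rewrite -(ler_pM2l v0) mulrA -expr2 (sqr_snorm SV)// mulrC.
  apply: (le_trans h); rewrite vf// mulrC; apply: (le_trans (ler_norm _)).
  exact: fM.
have thn t : parameter_bounds t -> {ae mu2, forall z, U z -> `|t z| <= `|th1| + 1}.
  by move=> [mt tb]; exact: (parameter_norm th00 tb).
have t1 : 0 <= `|th1| + 1 by rewrite addr_ge0.
have Lth t : parameter_bounds t -> L2 mu2 U t.
  by move=> tP; case: (tP) => mt _; exact: (L2_bounded mU Ufin mt (thn t tP)).
pose G k := th - th_ k.
have mG k : measurable_fun U (G k).
  by apply: measurable_funB; [case: thP|case: (th_P k)].
have GT k : {ae mu2, forall z, U z -> `|G k z| <= 2 * (`|th1| + 1)}.
  apply: filterS2 (thn _ thP) (thn _ (th_P k)) => z h1 h2 Uz.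
  by apply: (le_trans (ler_normB _ _)); rewrite mulr_natl mulr2n lerD ?h1 ?h2.
have G0 : weakly_to mu2 U Ul G 0.
  rewrite -(subrr th).
  apply: (weakly_toB mU _ (fun=> Lth _ thP) (fun k => Lth _ (th_P k)) (Lth _ thP) (Lth _ thP)).
    exact: weakly_to_cst.
  exact: th_th.
have Vw k : Vc (u_ k - u) by exact: (semi_innerB SV).
have wB k : snorm dip (u_ k - u) <= 2 * (Mf / th0).
  apply: (le_trans (snormB SV (Vu_ k) Vu)); rewrite mulr_natl mulr2n.
  by apply: lerD; [exact: (bnd _ _ (th_P k) (Vu_ k) (u_f k))|exact: (bnd _ _ thP Vu uf)].
have MB : 0 <= 2 * (Mf / th0) by rewrite mulr_ge0// divr_ge0// ltW.
have T0 : 0 <= 2 * (`|th1| + 1) by rewrite mulr_ge0.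
have ee : 0 < th0 * e ^+ 2 by rewrite mulr_gt0// exprn_gt0.
have := weak_strong_product mD bD malpha Cp0 poincare approx UU T0 MB mG GT G0 Vu Vw wB ee.
apply: filterS => k small.
rewrite -(@ler_pXn2r _ 2)// ?nnegrE ?snorm_ge0 ?(ltW e0)//.
rewrite (sqr_snorm SV)// -(ler_pM2l th00); apply: le_trans small.
have [mt tb] := th_P k.
have /andP[h _] := Bform_coercive mD malpha mt th00 tb (Vw k).
apply: (le_trans h); apply: (le_trans _ (ler_norm _)).
have [_ _ lin _] := Bform_semi_inner mD malpha mt th00 tb.
have Ldw : L2 mu2 U (delta alpha (u_ k - u)) by case/(Vc_P mD malpha): (Vw k).
have Ldu : L2 mu2 U (delta alpha u) by case/(Vc_P mD malpha): Vu.
rewrite le_eqVlt; apply/orP; left; apply/eqP.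
(* Both state equations have the same right-hand side when tested with [u_ k - u], which trades the
   unknown [u_ k] for the fixed [u]. *)
have -> : Bform Om eps alpha (th_ k) (u_ k - u) (u_ k - u) =
    Bform Om eps alpha th u (u_ k - u) - Bform Om eps alpha (th_ k) u (u_ k - u).
  rewrite {1}[u_ k - u]addrC -{1}(scaleN1r u) lin// mulN1r addrC; congr (_ - _).
  by rewrite u_f// uf.
rewrite /Bform /ip -RintegralB//; last 2 first.
- by apply: L2_mul => //; exact: (L2_bmul mU (proj1 thP) (thn _ thP) Ldu).
- by apply: L2_mul => //; exact: (L2_bmul mU mt (thn _ (th_P k)) Ldu).
apply: eq_Rintegral => z _; rewrite /G /= (_ : (th - th_ k) z = th z - th_ k z)//.
ring.
Qed.

End solution_convergence.

(** * Weak closedness of the admissible set *)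

Section admissible_set.
Context {R : realType} {n : nat}.
Local Notation E := 'rV[R]_n.
Local Notation lambda := (lebesgue_rV n).
Local Notation mu2 := (lebesgue_rV n \x lebesgue_rV n)%E.
Variables (Om : set E) (eps : R).
Local Notation D := (total_domain Om eps).
Local Notation U := (D `*` D).
Hypotheses (mD : measurable D) (bD : bounded_set D).
Variables (th0 th1 C : R).
Hypotheses (th00 : 0 < th0) (C0 : 0 < C).

Let mU : measurable U. Proof. exact: measurableX. Qed.
Let Ufin : (mu2 U < +oo)%E. Proof. exact: lebesgue_square_fin. Qed.

Lemma admissible_bounds theta : admissible Om eps th0 th1 C theta ->
  parameter_bounds Om eps th0 th1 (fun z => theta z.1 z.2).
Proof. by case=> _ b [m _] _; split. Qed.

(** The norm is an infimum over weak gradients; the slack [e] yields one without discussing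
    attainment or uniqueness. *)
Lemma W1oo_norm_witness (f : E * E -> R) e : (W1oo_norm U f <= C%:E)%E -> 0 < e ->
  exists g, [/\ weak_gradient U f g, {ae mu2, forall z, U z -> `|f z| <= C + e} &
    forall k, {ae mu2, forall z, U z -> `|g k z| <= C + e}].
Proof.
move=> fC e0; have Ce : 0 <= C + e by rewrite addr_ge0 ?ltW.
have : (W1oo_norm U f < (C + e)%:E)%E.
  by apply: (le_lt_trans fC); rewrite lte_fin ltrDl.
move=> /ereal_inf_lt[_ [g wg ->]]; rewrite gt_max => /andP[fL gL].
exists g; split => //; first exact/Loo_norm_leP/ltW.
move=> k; apply/Loo_norm_leP => //; apply/ltW; apply: le_lt_trans gL.
exact: (le_bigmax _ (fun k => Loo_norm U (g k))).
Qed.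

Lemma test_function_L2 phi k : test_function U phi ->
  L2 mu2 U phi /\ L2 mu2 U ('D_(basis_vec k) phi).
Proof.
move=> [sm _]; split; apply: L2_continuous => //.
- by have [] := sm [::].
- by have [] := sm [:: basis_vec k].
Qed.

(** Restates the weak derivative identity by real pairings with fixed L^2 functions, both of which
    pass to weak limits. *)
Lemma weak_deriv_ip v (f g : E * E -> R) phi : L2 mu2 U f -> L2 mu2 U g ->
  L2 mu2 U phi -> L2 mu2 U ('D_v phi) ->
  (\int[mu2]_(z in U) (f z * 'D_v phi z)%:E = - \int[mu2]_(z in U) (g z * phi z)%:E)%E <->
  ip mu2 U f ('D_v phi) = - ip mu2 U g phi.
Proof.
move=> Lf Lg Lphi Ldphi.
have e1 : (\int[mu2]_(z in U) (f z * 'D_v phi z)%:E = (ip mu2 U f ('D_v phi))%:E)%E.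
  by rewrite /ip /Rintegral fineK//; apply: integrable_fin_num => //; exact: (L2_mul mU Lf Ldphi).
have e2 : (\int[mu2]_(z in U) (g z * phi z)%:E = (ip mu2 U g phi)%:E)%E.
  by rewrite /ip /Rintegral fineK//; apply: integrable_fin_num => //; exact: (L2_mul mU Lg Lphi).
by rewrite e1 e2 -EFinN; split => [[]|->].
Qed.

Variables (Ul : set_system nat) (UU : UltraFilter Ul) (Ul_oo : \oo `<=` Ul).
Let UP : ProperFilter Ul := ultra_proper.

Lemma admissible_weakly_closed (theta_ : nat -> E -> E -> R) :
  (forall k, admissible Om eps th0 th1 C (theta_ k)) ->
  exists2 theta, admissible Om eps th0 th1 C theta &
    weakly_to mu2 U Ul (fun k z => theta_ k z.1 z.2) (fun z => theta z.1 z.2).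
Proof.
move=> adm; pose t k z := theta_ k z.1 z.2.
have tP k : parameter_bounds Om eps th0 th1 (t k) by exact: admissible_bounds.
have tb k := parameter_norm th00 (proj2 (tP k)).
have Lt k : L2 mu2 U (t k) := L2_bounded mU Ufin (proj1 (tP k)) (tb k).
have norm_bnd M h : 0 <= M -> L2 mu2 U h -> {ae mu2, forall z, U z -> `|h z| <= M} ->
    snorm (ip mu2 U) h <= M * snorm (ip mu2 U) (cst 1).
  move=> M0 [mh hi] hM; have := snorm_bmul mU M0 mh hM (L2_cst mU Ufin 1).
  by rewrite (_ : h \* cst 1 = h)//; apply/funext => z /=; rewrite mulr1.
have [ts Lts t_ts] := weak_compactness mU Ufin UU Lt
  (fun k => norm_bnd _ _ (addr_ge0 (normr_ge0 _) ler01) (Lt k) (tb k)).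
have /choice[g_ gP] k : exists g, [/\ weak_gradient U (t k) g,
    {ae mu2, forall z, U z -> `|t k z| <= C + k.+1%:R^-1} &
    forall i, {ae mu2, forall z, U z -> `|g i z| <= C + k.+1%:R^-1}].
  by case: (adm k) => _ _ _ fC; exact: W1oo_norm_witness.
have Lg i k : L2 mu2 U (g_ k i).
  have [wg _ gb] := gP k; have [mg _] := wg i.
  exact: (L2_bounded mU Ufin mg (gb i)).
have small e : 0 < e -> \forall k \near Ul, (k.+1%:R^-1 : R) <= e.
  move=> e0; apply: Ul_oo; near=> k.
  rewrite -[leRHS]invrK lef_pV2 ?posrE ?invr_gt0//.
  apply: (@le_trans _ _ (Num.truncn e^-1).+1%:R); first exact/ltW/truncnS_gt.
  by rewrite ler_nat ltnS; near: k; exact: nbhs_infty_ge.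
(* All directions converge along the same [Ul], so the limits of the derivatives belong to the limit
   of the parameters. *)
have gsE i : exists gi, L2 mu2 U gi /\ weakly_to mu2 U Ul (fun k => g_ k i) gi.
  have [k|gi Lgi wgi] := @weak_compactness _ _ _ mu2 U mU Ufin _ Ul (fun k => g_ k i)
    ((C + 1) * snorm (ip mu2 U) (cst 1)) UU (Lg i) _; last by exists gi.
  apply: norm_bnd => //; first by rewrite addr_ge0 ?(ltW C0).
  have [_ _ gb] := gP k; apply: filterS (gb i) => z gz Uz.
  apply: (le_trans (gz Uz)); rewrite lerD2l invf_le1 ?ler1n//.
have [gs gsP] := choice gsE.
have abs_bnd (h_ : nat -> E * E -> R) h : (forall k, L2 mu2 U (h_ k)) -> L2 mu2 U h ->
    weakly_to mu2 U Ul h_ h ->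
    (forall k, {ae mu2, forall z, U z -> `|h_ k z| <= C + k.+1%:R^-1}) ->
    {ae mu2, forall z, U z -> `|h z| <= C}.
  move=> Lh_ Lh wh hb.
  have up : {ae mu2, forall z, U z -> h z <= C}.
    apply: (weakly_to_ubound mU Ufin UP Lh_ Lh wh) => e /small; apply: filterS => k ke.
    apply: filterS (hb k) => z hz Uz.
    by apply: (le_trans (ler_norm _)); apply: (le_trans (hz Uz)); rewrite lerD2l.
  have lo : {ae mu2, forall z, U z -> - C <= h z}.
    apply: (weakly_to_lbound mU Ufin UP Lh_ Lh wh) => e /small; apply: filterS => k ke.
    apply: filterS (hb k) => z hz Uz; have := hz Uz; rewrite ler_norml => /andP[h1 _].
    by apply: le_trans h1; rewrite opprD lerD2l lerN2.
  by apply: filterS2 up lo => z h1 h2 Uz; rewrite ler_norml h1// h2.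
have wgs : weak_gradient U ts gs.
  move=> i; have [Lgi wgi] := gsP i; split; first by case: Lgi.
  move=> phi tphi; have [Lphi Ldphi] := test_function_L2 i tphi.
  apply/(weak_deriv_ip Lts Lgi Lphi Ldphi).
  have c2 : (fun k => - ip mu2 U (g_ k i) phi) @ Ul --> - ip mu2 U (gs i) phi.
    by apply: cvgN; exact: wgi.
  (* The same sequence, rewritten through the identity for [t k]; uniqueness of its limit is the
     identity for [ts]. *)
  have c1 : (fun k => - ip mu2 U (g_ k i) phi) @ Ul --> ip mu2 U ts ('D_(basis_vec i) phi).
    rewrite [X in X @ _](_ : _ = fun k => ip mu2 U (t k) ('D_(basis_vec i) phi)).
      exact: t_ts.
    apply/funext => k; apply/esym; apply/(weak_deriv_ip (Lt k) (Lg i k) Lphi Ldphi).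
    by have [wg _ _] := gP k; have [_ ] := wg i; apply.
  by rewrite -(cvg_lim _ c1)// (cvg_lim _ c2).
have norm_le : (W1oo_norm U ts <= C%:E)%E.
  apply: ereal_inf_le; exists (maxe (Loo_norm U ts) (\big[maxe/0%E]_k Loo_norm U (gs k))).
    by exists gs.
  rewrite ge_max; apply/andP; split.
    apply/Loo_norm_leP; first exact: ltW.
    by apply: (abs_bnd t) => // k; case: (gP k).
  apply: bigmax_le; first by rewrite lee_fin ltW.
  move=> i _; have [Lgi wgi] := gsP i; apply/Loo_norm_leP; first exact: ltW.
  by apply: (abs_bnd (fun k => g_ k i)) => // k; case: (gP k).
have tsE : (fun z : E * E => ts (z.1, z.2)) = ts by apply/funext => -[].
have swapE (h : E * E -> R) : L2 mu2 U h -> L2 mu2 U (fun z => h (z.2, z.1)) by exact: L2_swap.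
have wswap : weakly_to mu2 U Ul (fun k z => t k (z.2, z.1)) (fun z => ts (z.2, z.1)).
  move=> phi Lphi; rewrite ip_swap//; under eq_fun do rewrite ip_swap//.
  by apply: t_ts; exact: swapE.
(* Symmetry is an equality, obtained as two inequalities, each closed under weak limits. *)
have sym1 : {ae mu2, forall z, U z -> (ts - (fun z => ts (z.2, z.1))) z <= 0}.
  apply: (weakly_to_le0 mU Ufin UP (h_ := fun k => t k - (fun z => t k (z.2, z.1)))).
  - by move=> k; apply: L2B => //; exact: swapE.
  - by apply: L2B => //; exact: swapE.
  - by apply: weakly_toB => //; [move=> k; exact: swapE|exact: swapE].
  - apply: filterE => k; case: (adm k) => sym _ _ _; apply: filterS sym => z sz Uz.
    by rewrite (_ : (t k - _) z = t k z - t k (z.2, z.1))// /t/= sz// subrr.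
have sym2 : {ae mu2, forall z, U z -> ((fun z => ts (z.2, z.1)) - ts) z <= 0}.
  apply: (weakly_to_le0 mU Ufin UP (h_ := fun k => (fun z => t k (z.2, z.1)) - t k)).
  - by move=> k; apply: L2B => //; exact: swapE.
  - by apply: L2B => //; exact: swapE.
  - by apply: weakly_toB => //; [move=> k; exact: swapE|exact: swapE].
  - apply: filterE => k; case: (adm k) => sym _ _ _; apply: filterS sym => z sz Uz.
    by rewrite (_ : (_ - t k) z = t k (z.2, z.1) - t k z)// /t/= sz// subrr.
have ub : {ae mu2, forall z, U z -> ts z <= th1}.
  apply: (weakly_to_ubound mU Ufin UP Lt Lts t_ts) => e e0; apply: filterE => k.
  case: (tP k) => _; apply: filterS => z tz Uz; have /andP[_ h] := tz Uz.
  by apply: (le_trans h); rewrite lerDl ltW.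
have lb : {ae mu2, forall z, U z -> th0 <= ts z}.
  apply: (weakly_to_lbound mU Ufin UP Lt Lts t_ts) => e e0; apply: filterE => k.
  case: (tP k) => _; apply: filterS => z tz Uz; have /andP[h _] := tz Uz.
  by apply: le_trans h; rewrite gerBl ltW.
exists (fun x y => ts (x, y)); last by rewrite tsE.
rewrite /admissible tsE; split => //.
- apply: filterS2 sym1 sym2 => z s1 s2 Uz; apply/eqP; rewrite eq_le.
  by case: z s1 s2 Uz => x y s1 s2 Uz; rewrite -subr_le0 (s1 Uz) -subr_le0 (s2 Uz).
- by apply: filterS2 lb ub => -[x y] l1 l2 Uz; rewrite l1// l2.
- by split; [case: Lts|apply: le_lt_trans norm_le _; rewrite ltry].
Unshelve. all: by end_near. Qed.

End admissible_set.

(** * Existence of an optimal parameter *)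

Lemma L2_subset d (T : measurableType d) (R : realType) (mu : {measure set T -> \bar R})
    (A B : set T) (f : T -> R) : measurable A -> measurable B -> A `<=` B -> L2 mu B f ->
  L2 mu A f /\ snorm (ip mu A) f <= snorm (ip mu B) f.
Proof.
move=> mA mB AB [mf fi]; have LA : L2 mu A f.
  by split; [exact: measurable_funS mf|exact: integrableS fi].
split => //; rewrite ler_wsqrtr// !ip_sqr -lee_fin /Rintegral !fineK.
- apply: ge0_subset_integral => //; first by apply/measurable_EFinP; exact: measurable_funX.
  by move=> x _; rewrite lee_fin sqr_ge0.
- exact: integrable_fin_num.
- by apply: integrable_fin_num => //; case: LA.
Qed.

Section weak_solutions.
Context {R : realType} {n : nat}.
Local Notation E := 'rV[R]_n.
Local Notation lambda := (lebesgue_rV n).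
Variables (Om : set E) (eps : R) (alpha : E -> E -> E).
Local Notation D := (total_domain Om eps).

Lemma weak_solutionP (th0 th1 : R) f (theta : E -> E -> R) u : measurable D ->
  measurable_fun (D `*` D) (fun z : E * E => alpha z.1 z.2) -> 0 < th0 ->
  parameter_bounds Om eps th0 th1 (fun z => theta z.1 z.2) ->
  weak_solution Om eps alpha f theta u <->
  Vc Om eps alpha u /\
  forall v, Vc Om eps alpha v -> Bform Om eps alpha (fun z => theta z.1 z.2) u v = f v.
Proof.
move=> mD malpha th00 [mth thb].
have BE v := BformE mD malpha mth (parameter_norm th00 thb) (u := u) (v := v).
split => -[Vu uf]; split => // v Vv; have := uf v Vv.
  by rewrite BE// => -[].
by move=> <-; rewrite -BE.
Qed.

Lemma costE (uhat u : E -> R) (theta : E -> E -> R) : measurable Om ->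
  L2 lambda Om (u - uhat) ->
  cost Om uhat u theta = (2^-1 * snorm (ip lambda Om) (u - uhat) ^+ 2)%:E.
Proof.
move=> mOm Lu; rewrite /cost sqr_snorm_ip// ip_sqr /Rintegral EFinM fineK//.
by apply: integrable_fin_num => //; case: Lu.
Qed.

End weak_solutions.

Theorem theorem3p1 (R : realType) (n : nat) (hn : (0 < n)%N)
  (Om : set 'rV[R]_n) (eps : R) (heps : 0 < eps)
  (Om_open : open Om)
  (Om_regular : regular_domain Om)
  (OmI_regular : regular_domain (interaction_domain Om eps))
  (OmOmI_regular : regular_domain (total_domain Om eps))
  (gamma : 'rV[R]_n -> 'rV[R]_n -> R)
  (alpha : 'rV[R]_n -> 'rV[R]_n -> 'rV[R]_n)
  (hgamma : kernel_conditions Om eps gamma)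
  (hcase : kernel_case1 Om eps gamma \/ kernel_case2 Om eps gamma)
  (halpha : antisymmetric_field Om eps alpha)
  (hgamma_alpha : forall x y, total_domain Om eps x -> total_domain Om eps y ->
     gamma x y = dotv (alpha x y) (alpha x y))
  (f : ('rV[R]_n -> R) -> R) (hf : Vc_dual Om eps alpha f)
  (uhat : 'rV[R]_n -> R) (huhat : in_L2 Om uhat)
  (th0 th1 C : R) (hth0 : 0 < th0) (hth01 : th0 <= th1) (hC : 0 < C)
  (admissible_nonempty : exists theta, admissible Om eps th0 th1 C theta) :
  (forall theta, admissible Om eps th0 th1 C theta ->
     exists u, weak_solution Om eps alpha f theta u /\
       forall u', weak_solution Om eps alpha f theta u' ->
         ae_eq (lebesgue_rV n) (total_domain Om eps) u' u) /\
  (forall u : ('rV[R]_n -> 'rV[R]_n -> R) -> 'rV[R]_n -> R,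
     (forall theta, admissible Om eps th0 th1 C theta ->
        weak_solution Om eps alpha f theta (u theta)) ->
     exists2 theta_star, admissible Om eps th0 th1 C theta_star &
       cost Om uhat (u theta_star) theta_star =
       ereal_inf [set cost Om uhat (u theta) theta |
                  theta in [set theta | admissible Om eps th0 th1 C theta]]).
Proof.
have mD : measurable (total_domain Om eps) by exact: measurable_total_domain.
have mOm : measurable Om by exact: open_measurable_rV.
have OmD : Om `<=` total_domain Om eps by move=> x; left.
have [bOm _ _] := Om_regular; have [bD _ _] := OmOmI_regular; have [malpha _] := halpha.
have Dfin := lebesgue_rV_bounded mD bD.
have [M M0 OmM] := bounded_set_rV bOm.
have [c0 c00 coercive'] := kernel_cases_coercive heps hcase.
have coercive x y : total_domain Om eps x -> total_domain Om eps y -> x != y ->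
    enorm (y - x) <= eps -> c0 <= gker alpha (x, y) * enorm (y - x) ^+ n.
  by move=> Dx Dy xy h; rewrite /gker/= -hgamma_alpha//; exact: coercive'.
have [Cp Cp0 poincare] := nonlocal_poincare hn heps malpha M0 OmM c00 coercive.
have approx := finite_rank_approximation hn heps malpha Dfin M0 OmM c00 coercive.
have wsP theta u : admissible Om eps th0 th1 C theta ->
    weak_solution Om eps alpha f theta u <-> Vc Om eps alpha u /\
    forall v, Vc Om eps alpha v -> Bform Om eps alpha (fun z => theta z.1 z.2) u v = f v.
  by move=> adm; apply: (weak_solutionP _ _ mD malpha hth0 (admissible_bounds adm)).
split=> [theta adm|u uP].
  have [mth thb] := admissible_bounds adm.
  have [v Vv vf] := weak_form_solvable mD malpha Dfin Cp0 poincare mth hth0 thb hf.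
  exists v; split; first exact/(wsP _ _ adm).
  move=> v' /(wsP _ _ adm)[Vv' v'f].
  apply: (weak_form_unique mD malpha Cp0 poincare mth hth0 thb) => // w Vw.
  by rewrite vf// v'f.
have uV theta : admissible Om eps th0 th1 C theta -> Vc Om eps alpha (u theta).
  by move=> adm; case/(wsP _ _ adm): (uP _ adm).
have Luhat : L2 (lebesgue_rV n) Om uhat by exact/in_L2P.
have SI := L2_semi_inner (lebesgue_rV n) mOm.
have restr v : Vc Om eps alpha v -> L2 (lebesgue_rV n) Om v /\
    snorm (ip (lebesgue_rV n) Om) v <= snorm (ip (lebesgue_rV n) (total_domain Om eps)) v.
  by move=> /(Vc_P mD malpha)[Lv _ _]; exact: L2_subset.
(* The cost is half the square of [N], so both have the same minimisers; for [N] the triangle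
   inequality is available. *)
pose N theta := snorm (ip (lebesgue_rV n) Om) (u theta - uhat).
have Ld theta : admissible Om eps th0 th1 C theta -> L2 (lebesgue_rV n) Om (u theta - uhat).
  by move=> /uV/restr[Lu _]; exact: L2B.
pose m := inf [set N theta | theta in [set theta | admissible Om eps th0 th1 C theta]].
have hinf : has_inf [set N theta | theta in [set theta | admissible Om eps th0 th1 C theta]].
  split; last by exists 0 => _ [theta _ <-]; exact: snorm_ge0.
  by case: admissible_nonempty => theta adm; exists (N theta), theta.
have /choice[theta_ theta_P] k : exists theta, admissible Om eps th0 th1 C theta /\
    N theta <= m + k.+1%:R^-1.
  have [|_ [theta adm <-] h] := inf_adherent (eps := k.+1%:R^-1) _ hinf; first by [].
  by exists theta; split => //; exact: ltW.
have adm k : admissible Om eps th0 th1 C (theta_ k) by case: (theta_P k).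
(* Refining [\oo] makes everything valid for large [k] valid along [Ul]. *)
have [Ul [UU Ul_oo]] := @ultraFilterLemma nat \oo _.
have UP : ProperFilter Ul := ultra_proper.
have [theta_star adm_star weak] := admissible_weakly_closed mD bD hth0 hC UU Ul_oo adm.
exists theta_star => //.
have conv := solutions_converge mD bD malpha Cp0 poincare approx UU hth0
  (fun k => admissible_bounds (adm k)) (admissible_bounds adm_star) weak hf
  (fun k => uV _ (adm k)) (uV _ adm_star)
  (fun k => proj2 ((wsP _ _ (adm k)).1 (uP _ (adm k))))
  (proj2 ((wsP _ _ adm_star).1 (uP _ adm_star))).
have Nstar : N theta_star <= m.
  apply/ler_addgt0Pr => e e0; have e20 : 0 < e / 2 by rewrite divr_gt0.
  (* Poincare turns this energy tolerance into an L^2 error of at most [e / 2]; [Cp] may be 0, hence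
     the 1. *)
  have e2c : 0 < e / 2 / (Cp + 1) by rewrite divr_gt0// ltr_wpDl.
  have near1 := conv _ e2c.
  have near2 : \forall k \near Ul, (k.+1%:R^-1 : R) <= e / 2.
    apply: Ul_oo; near=> k.
    rewrite -[leRHS]invrK lef_pV2 ?posrE ?invr_gt0//.
    apply: (@le_trans _ _ (Num.truncn (e / 2)^-1).+1%:R); first exact/ltW/truncnS_gt.
    by rewrite ler_nat ltnS; near: k; exact: nbhs_infty_ge.
  have [k [k1 k2]] := filter_ex (filterI near1 near2).
  have Vd : Vc Om eps alpha (u (theta_ k) - u theta_star).
    by apply: VcB => //; exact: uV.
  have [LdO dO] := restr _ Vd.
  have tri : N theta_star <= N (theta_ k) +
      snorm (ip (lebesgue_rV n) Om) (u (theta_ k) - u theta_star).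
    rewrite /N (_ : u theta_star - uhat =
      (u (theta_ k) - uhat) - (u (theta_ k) - u theta_star)); last first.
      by rewrite opprB [RHS]addrC addrA subrK.
    by apply: (snormB SI) => //; exact: Ld.
  apply: (le_trans tri); have [_ Nk] := theta_P k.
  rewrite [e]splitr addrA; apply: lerD.
    by apply: (le_trans Nk); rewrite lerD2l.
  apply: (le_trans dO); apply: (le_trans (poincare _ Vd)).
  apply: (@le_trans _ _ ((Cp + 1) * (e / 2 / (Cp + 1)))).
    by apply: ler_pM; rewrite ?snorm_ge0// lerDl.
  by rewrite mulrC divfK// gt_eqF// ltr_wpDl.
apply/eqP; rewrite eq_le; apply/andP; split; last first.
  by apply: ereal_inf_lbound; exists theta_star.
apply: le_ereal_inf_tmp => _ [theta admt <-].
rewrite !costE//; [|exact: Ld|exact: Ld].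
rewrite lee_fin ler_pM2l ?invr_gt0// ler_pXn2r ?nnegrE ?snorm_ge0//.
apply: (le_trans Nstar); apply: ge_inf; first by case: hinf.
by exists theta.
Unshelve. all: by end_near. Qed.
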